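(* There exist constants $c_1,C_1,C_2>0$ such that the following holds. Let $S\subseteq\{1,\dots,n\}$ with $|S|=s$, let $x\in\mathbb{R}^n$ or $\mathbb{C}^n$ be supported on $S$ and satisfy the random sign assumption, let $A$ be the random sensing matrix of the setting, and let $y=Ax+\epsilon$ with $\|\epsilon\|_2\le\eta$. For every $0<\varepsilon<1$, if $$m\ge c_1\min_{\{S_r\}}\ \max_r\Lambda(S\cup S_r,F)\,\ln\!\left(\tfrac{6\,|\{S_r\}|\,\max_r|S\cup S_r|}{\varepsilon}\right)\ln\!\left(\tfrac{6n}{\varepsilon}\right),$$ where the minimum is over all partitions $\{S_r\}$ of $S^c$ into nonempty sets and $|\{S_r\}|$ is the number of parts, then with probability at least $1-\varepsilon$ every minimizer $x^\sharp$ of (qBP) satisfies $\|x-x^\sharp\|_2\le(C_1+C_2\sqrt s)\eta$. In the noiseless case $\eta=0$, one may take $c_1=19$, and then $x$ is the unique minimizer of (BP) with probability at least $1-\varepsilon$.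
   Context: Setting: Let $n,m\ge 1$. For $\ell=1,\dots,m$ let $F_\ell$ be a probability distribution on $\mathbb{C}^{p_\ell\times n}$ ($p_\ell\ge1$), $F=(F_\ell)_{\ell=1}^m$, let $B_1,\dots,B_m$ be independent random matrices with $B_\ell\sim F_\ell$, and $A=\frac{1}{\sqrt m}\begin{pmatrix}B_1\\ \vdots\\ B_m\end{pmatrix}$. Isotropy is assumed: $\mathbb{E}(A^*A)=\frac1m\sum_{\ell=1}^m\mathbb{E}(B_\ell^*B_\ell)=\mathrm{Id}_n$. For $T\subseteq\{1,\dots,n\}$, $P_T$ is the restriction $P_Tx=x_T$, $M_T:=MP_T^*$, $B_{\ell,T}=B_\ell P_T^*$, and $\Lambda(T,F)$ denotes any positive real number such that almost surely $\|B_{\ell,T}^*B_{\ell,T}\|_{2\to2}\le\Lambda(T,F)$ for all $\ell$. Random sign assumption: the vector $(x_i/|x_i|)_{i\in S}$ is a Rademacher sequence (independent uniform $\pm1$ entries) if $x$ is real, or a Steinhaus sequence (independent entries uniform on the complex unit circle) if $x$ is complex, independent of $A$. (BP): $\min_{z\in\mathbb{C}^n}\|z\|_1$ s.t. $Az=y$. (qBP): $\min_{z\in\mathbb{C}^n}\|z\|_1$ s.t. $\|y-Az\|_2\le\eta$. *)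

(* Defs.v *)
From HB Require Import structures.
From mathcomp Require Import all_boot all_order all_algebra.
From mathcomp Require Import all_classical all_reals all_analysis.
From mathcomp Require Import complex.
Set Implicit Arguments. Unset Strict Implicit. Unset Printing Implicit Defensive.
Import Order.TTheory GRing.Theory Num.Theory.
Local Open Scope classical_set_scope.
Local Open Scope ring_scope.

Section CSDefs.
Context {R : realType}.
Local Notation C := R[i].

Definition cRe (z : C) : R := complex.Re z.
Definition cIm (z : C) : R := complex.Im z.
Definition cmod (z : C) : R := Num.sqrt (cRe z ^+ 2 + cIm z ^+ 2).
Definition ofR (a : R) : C := Complex a 0.

Definition l1norm {n} (v : 'cV[C]_n) : R := \sum_i cmod (v i 0).
Definition l2norm {n} (v : 'cV[C]_n) : R := Num.sqrt (\sum_i cmod (v i 0) ^+ 2).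

Definition adjmx {a b} (M : 'M[C]_(a, b)) : 'M[C]_(b, a) := (map_mx Num.conj M)^T.

Definition opnorm {a b} (M : 'M[C]_(a, b)) : R :=
  sup [set l2norm (M *m v) | v in [set v : 'cV[C]_b | l2norm v <= 1]].

Definition colrestr {p n} (M : 'M[C]_(p, n)) (T : {set 'I_n}) : 'M[C]_(p, #|T|) :=
  \matrix_(i, j) M i (enum_val j).

Definition qBP_minimizer {N n} (A : 'M[C]_(N, n)) (y : 'cV[C]_N) (eta : R)
  (z : 'cV[C]_n) : Prop :=
  l2norm (y - A *m z) <= eta /\
  forall w : 'cV[C]_n, l2norm (y - A *m w) <= eta -> l1norm z <= l1norm w.

Definition BP_minimizer {N n} (A : 'M[C]_(N, n)) (y : 'cV[C]_N) (z : 'cV[C]_n) : Prop :=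
  A *m z = y /\ forall w : 'cV[C]_n, A *m w = y -> l1norm z <= l1norm w.

Definition BP_unique_minimizer {N n} (A : 'M[C]_(N, n)) (y : 'cV[C]_N)
  (z : 'cV[C]_n) : Prop :=
  BP_minimizer A y z /\ forall w, BP_minimizer A y w -> w = z.

Definition sgnc (z : C) : C := z / ofR (cmod z).

Context {d : measure_display} {Omega : measurableType d} (P : probability Omega R).

Definition sigma_gen {I : Type} (X : I -> Omega -> R) : set (set Omega) :=
  <<s setT, \bigcup_(i in [set: I]) preimage_set_system setT (X i) measurable >>.

Definition ccoords (X : Omega -> C) : bool -> Omega -> R :=
  fun b w => if b then cRe (X w) else cIm (X w).

Definition mxcoords {p n} (M : Omega -> 'M[C]_(p, n)) : 'I_p * 'I_n * bool -> Omega -> R :=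
  fun ijb w => ccoords (fun w => M w ijb.1.1 ijb.1.2) ijb.2 w.

Definition indep2 (G1 G2 : set (set Omega)) : Prop :=
  forall E1 E2, G1 E1 -> G2 E2 -> P (E1 `&` E2) = (P E1 * P E2)%E.

Definition mutually_indep {I : finType} (J : {set I}) (G : I -> set (set Omega)) : Prop :=
  forall E : I -> set Omega, (forall k, k \in J -> G k (E k)) ->
    fine (P (\bigcap_(k in [set k | k \in J]) E k)) = \prod_(k in J) fine (P (E k)).

Definition cexpect (X : Omega -> C) : C :=
  Complex (fine ('E_P[fun w => cRe (X w)])) (fine ('E_P[fun w => cIm (X w)])).

Definition cexpect_mx {a b} (M : Omega -> 'M[C]_(a, b)) : 'M[C]_(a, b) :=
  \matrix_(i, j) cexpect (fun w => M w i j).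

Definition sensing_matrix {m n} {p : 'I_m -> nat}
  (B : forall l : 'I_m, Omega -> 'M[C]_(p l, n)) (w : Omega) :
  'M[C]_(\sum_(l < m) p l, n) :=
  ofR (Num.sqrt (m%:R))^-1 *: \mxcol_(l < m) B l w.

Definition random_sensing_setting {m n} {p : 'I_m -> nat}
  (B : forall l : 'I_m, Omega -> 'M[C]_(p l, n)) : Prop :=
  [/\ (forall l ijb, measurable_fun setT (mxcoords (B l) ijb)),
      mutually_indep [set: 'I_m] (fun l => sigma_gen (mxcoords (B l))),
      (forall l ijb, P.-integrable setT
          (EFin \o mxcoords (fun w => adjmx (B l w) *m B l w) ijb)) &
      (m%:R)^-1 *: \sum_(l < m) cexpect_mx (fun w => adjmx (B l w) *m B l w)
        = 1%:M :> 'M[C]_n].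

Definition Lambda_bound {m n} {p : 'I_m -> nat}
  (B : forall l : 'I_m, Omega -> 'M[C]_(p l, n)) (T : {set 'I_n}) (Lam : R) : Prop :=
  0 < Lam /\
  {ae P, forall w, forall l : 'I_m,
     opnorm (adjmx (colrestr (B l w) T) *m colrestr (B l w) T) <= Lam}.

Definition Rademacher_seq {n} (S : {set 'I_n}) (sg : 'I_n -> Omega -> C) : Prop :=
  (forall i, i \in S ->
     P [set w | sg i w = 1] = (2^-1)%:E /\ P [set w | sg i w = -1] = (2^-1)%:E) /\
  mutually_indep S (fun i => sigma_gen (ccoords (sg i))).

Definition Steinhaus_seq {n} (S : {set 'I_n}) (sg : 'I_n -> Omega -> C) : Prop :=
  (forall i, i \in S -> forall a b : R, 0 <= a -> a <= b -> b <= 2 * pi ->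
     P [set w | exists2 t : R, a <= t <= b & sg i w = Complex (cos t) (sin t)]
       = ((b - a) / (2 * pi))%:E) /\
  mutually_indep S (fun i => sigma_gen (ccoords (sg i))).

(** x is supported on S, and satisfies the random sign assumption:
    (x_i/|x_i|)_{i in S} is Rademacher (real case) or Steinhaus (complex case),
    independent of A *)
Definition random_sign_signal {m n} {p : 'I_m -> nat}
  (B : forall l : 'I_m, Omega -> 'M[C]_(p l, n)) (S : {set 'I_n})
  (x : Omega -> 'cV[C]_n) : Prop :=
  let sg := fun i w => sgnc (x w i 0) in
  [/\ (forall w i, i \notin S -> x w i 0 = 0),
      (forall w i, i \in S -> x w i 0 != 0),
      (forall i b, i \in S -> measurable_fun setT (ccoords (sg i) b)),
      Rademacher_seq S sg \/ Steinhaus_seq S sg &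
      indep2
        (sigma_gen (fun ib : {i : 'I_n | i \in S} * bool => ccoords (sg (sval ib.1)) ib.2))
        (sigma_gen (fun lijb : {l : 'I_m & ('I_(p l) * 'I_n * bool)%type} =>
                      mxcoords (B (projT1 lijb)) (projT2 lijb)))].

Definition sampling_condition {m n} {p : 'I_m -> nat}
  (B : forall l : 'I_m, Omega -> 'M[C]_(p l, n)) (c1 : R) (S : {set 'I_n})
  (Q : {set {set 'I_n}}) (Lambda : {set 'I_n} -> R) (eps : R) : Prop :=
  [/\ finset.partition Q (~: S),
      (forall Sr, Sr \in Q -> Lambda_bound B (S :|: Sr) (Lambda (S :|: Sr))) &
      c1 * (\big[Num.max/0]_(Sr in Q) Lambda (S :|: Sr))
         * ln (6 * (#|Q|%:R) * ((\max_(Sr in Q) #|S :|: Sr|)%N%:R) / eps)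
         * ln (6 * n%:R / eps) <= m%:R].

End CSDefs.

(* Main.v *)
Require Import Defs.
From HB Require Import structures.
From mathcomp Require Import all_boot all_order all_algebra.
From mathcomp Require Import all_classical all_reals all_analysis.
From mathcomp Require Import measurable_realfun complex spectral sesquilinear.
From mathcomp Require Import ring lra zify.
Set Implicit Arguments. Unset Strict Implicit. Unset Printing Implicit Defensive.
Import Order.TTheory GRing.Theory Num.Theory.
Import numFieldNormedType.Exports.
Local Open Scope classical_set_scope.
Local Open Scope ring_scope.

(* With H = A^* A, x is recovered as soon as, for each part S_r, H restricted to S u S_r is
   within delta of the identity and |<u_l, sgn x>| < tau for each l outside S, where u_l
   solves H_SS u_l = H_Sl: the vector H_SS^-1 (sgn x) then yields a dual certificate.

   The first property is a matrix Chernoff bound. It is obtained from Chatterjee's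
   exchangeable pairs (resample one block) together with the trace mean value inequality for
   exp, which leads to a differential inequality for E tr exp(t X); no trace convexity
   theorem is needed. Closeness to the identity on S u {l} also gives
   |u_l|^2 <= delta^2 / (1 - delta^2), so that, conditionally on A, the second property is
   Hoeffding's inequality for random signs.

   With L = ln(6n/eps) and K = 2/tau^2, the choice delta^2 = 1/(1 + K L) makes each of the
   two union bounds eps/3. Exact recovery uses tau = 1, where c_1 = 19(1 + K)/3 = 19; robust
   recovery uses tau = 1/2, where c_1 = 57. *)

(** * Complex scalars and matrices *)

(** Where 19 comes from: with [L] the logarithm ln(6n/eps), the Chernoff exponent for a deviation
    delta is (4/25) delta^2 m / Lambda, and it must reach l = ln(6 |Q| max|S u S_r| / eps). At
    delta^2 = 1/(1 + K L) this asks for m >= (25/4) (1 + K L) Lambda l. Since L >= 1, one has 1 + K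
    L <= (1 + K) L, and 25/4 is rounded up to 19/3. For K = 2 the exact need is 18.75, so the losses
    in the Gronwall step and in the choice of t are tuned to stay below 19. The relation K = 2/tau^2
    makes the Hoeffding exponent tau^2 (1 - delta^2) / (2 delta^2) equal to L.

    Nothing is known about H between two different parts. This is harmless, because each column l
    outside S meets S inside a single S u S_r. The price appears in the robust bound: off S the
    error is controlled only in the l1 norm, which produces the factor sqrt s.

    Measurability shapes two constructions. Eigenvectors and inverses are not handled as measurable
    functions of the matrix, so trace exponentials are also written as limits of polynomials, and
    H_SS^-1 is replaced by the adjugate with denominators cleared. *)

Section ComplexScalars.
Context {R : realType}.
Implicit Types (z w : R[i]) (a b : R).

Lemma complexP z w : cRe z = cRe w -> cIm z = cIm w -> z = w.
Proof. by case: z w => [a b] [c d] /= -> ->. Qed.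

Lemma cReD z w : cRe (z + w) = cRe z + cRe w. Proof. by case: z w => [a b] []. Qed.
Lemma cImD z w : cIm (z + w) = cIm z + cIm w. Proof. by case: z w => [a b] []. Qed.
Lemma cReN z : cRe (- z) = - cRe z. Proof. by case: z. Qed.
Lemma cImN z : cIm (- z) = - cIm z. Proof. by case: z. Qed.
Lemma cReB z w : cRe (z - w) = cRe z - cRe w. Proof. by rewrite cReD cReN. Qed.
Lemma cReM z w : cRe (z * w) = cRe z * cRe w - cIm z * cIm w.
Proof. by case: z w => [a b] []. Qed.
Lemma cImM z w : cIm (z * w) = cRe z * cIm w + cIm z * cRe w.
Proof. by case: z w => [a b] []. Qed.
Lemma cReC z : cRe (Num.conj z) = cRe z. Proof. by case: z. Qed.
Lemma cImC z : cIm (Num.conj z) = - cIm z. Proof. by case: z. Qed.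
Lemma cRe0 : cRe (0 : R[i]) = 0. Proof. by []. Qed.
Lemma cIm0 : cIm (0 : R[i]) = 0. Proof. by []. Qed.
Lemma cRe1 : cRe (1 : R[i]) = 1. Proof. by []. Qed.
Lemma cIm1 : cIm (1 : R[i]) = 0. Proof. by []. Qed.
Lemma cRe_ofR a : cRe (ofR a) = a. Proof. by []. Qed.
Lemma cIm_ofR a : cIm (ofR a) = 0. Proof. by []. Qed.

Definition cE := (cReD, cImD, cReN, cImN, cReM, cImM, cReC, cImC,
  cRe0, cIm0, cRe1, cIm1, cRe_ofR, cIm_ofR).

Lemma cRe_sum I (r : seq I) (P : pred I) (F : I -> R[i]) :
  cRe (\sum_(i <- r | P i) F i) = \sum_(i <- r | P i) cRe (F i).
Proof. exact: (big_morph cRe cReD cRe0). Qed.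

Lemma ofRD a b : ofR (a + b) = ofR a + ofR b.
Proof. by apply: complexP; rewrite !cE ?addr0. Qed.
Lemma ofRN a : ofR (- a) = - ofR a.
Proof. by apply: complexP; rewrite !cE ?oppr0. Qed.
Lemma ofRB a b : ofR (a - b) = ofR a - ofR b.
Proof. by rewrite ofRD ofRN. Qed.
Lemma ofRM a b : ofR (a * b) = ofR a * ofR b.
Proof. by apply: complexP; rewrite !cE; ring. Qed.
Lemma ofR0 : ofR 0 = 0 :> R[i]. Proof. by []. Qed.
Lemma ofR1 : ofR 1 = 1 :> R[i]. Proof. by []. Qed.
Lemma ofR_nat n : ofR n%:R = n%:R :> R[i].
Proof. by elim: n => // n IH; rewrite -natr1 ofRD IH -[RHS]natr1. Qed.
Lemma ofR_sum I (r : seq I) (P : pred I) (F : I -> R) :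
  ofR (\sum_(i <- r | P i) F i) = \sum_(i <- r | P i) ofR (F i).
Proof. exact: (big_morph ofR ofRD ofR0). Qed.
Lemma ofRV a : ofR a^-1 = (ofR a)^-1.
Proof.
have [->|a0] := eqVneq a 0; first by rewrite invr0 ofR0 invr0.
have H : ofR a != 0 :> R[i] by apply: contra_neq a0 => /(congr1 cRe).
by apply: (mulfI H); rewrite divff// -ofRM divff.
Qed.
Lemma ofR_inj : injective (@ofR R). Proof. by move=> a b /(congr1 cRe). Qed.
Lemma conj_ofR a : Num.conj (ofR a) = ofR a.
Proof. by apply: complexP; rewrite !cE ?oppr0. Qed.

Lemma cReZ a z : cRe (ofR a * z) = a * cRe z.
Proof. by rewrite !cE; ring. Qed.
Lemma cImZ a z : cIm (ofR a * z) = a * cIm z.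
Proof. by rewrite !cE; ring. Qed.

Lemma cmod_ge0 z : 0 <= cmod z. Proof. exact: sqrtr_ge0. Qed.
Lemma cmod2 z : cmod z ^+ 2 = cRe z ^+ 2 + cIm z ^+ 2.
Proof. by rewrite sqr_sqrtr// addr_ge0 ?sqr_ge0. Qed.
Lemma conj_mul z : Num.conj z * z = ofR (cmod z ^+ 2).
Proof. by rewrite cmod2; apply: complexP; rewrite !cE; ring. Qed.
Lemma mul_conj z : z * Num.conj z = ofR (cmod z ^+ 2).
Proof. by rewrite mulrC conj_mul. Qed.
Lemma cmodM z w : cmod (z * w) = cmod z * cmod w.
Proof.
rewrite /cmod -sqrtrM ?addr_ge0 ?sqr_ge0//; congr Num.sqrt.
by rewrite !cE; ring.
Qed.
Lemma cmod0 : cmod (0 : R[i]) = 0.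
Proof. by rewrite /cmod !cE expr0n /= addr0 sqrtr0. Qed.
Lemma cmod1 : cmod (1 : R[i]) = 1.
Proof. by rewrite /cmod !cE expr0n /= expr1n addr0 sqrtr1. Qed.
Lemma cmodN z : cmod (- z) = cmod z.
Proof. by rewrite /cmod !cE !sqrrN. Qed.
Lemma cmodC z : cmod (Num.conj z) = cmod z.
Proof. by rewrite /cmod !cE !sqrrN. Qed.
Lemma cmod_ofR a : cmod (ofR a) = `|a|.
Proof. by rewrite /cmod !cE expr0n /= addr0 sqrtr_sqr. Qed.
Lemma cmod_eq0 z : (cmod z == 0) = (z == 0).
Proof.
apply/eqP/eqP => [z0|->]; last exact: cmod0.
have /eqP : cmod z ^+ 2 = 0 by rewrite z0 expr0n.
rewrite cmod2 paddr_eq0 ?sqr_ge0// !sqrf_eq0 => /andP[/eqP a /eqP b].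
exact: complexP.
Qed.
Lemma cmod_normC z : `|z| = ofR (cmod z).
Proof. by rewrite normc_def. Qed.
Lemma ler_cmodD z w : cmod (z + w) <= cmod z + cmod w.
Proof. by have := ler_normD z w; rewrite !cmod_normC -ofRD lecR. Qed.
Lemma ler_cmod_sum I (r : seq I) (P : pred I) (F : I -> R[i]) :
  cmod (\sum_(i <- r | P i) F i) <= \sum_(i <- r | P i) cmod (F i).
Proof.
elim/big_ind2 : _ => [|x a y b xa yb|//]; first by rewrite cmod0.
exact: le_trans (ler_cmodD _ _) (lerD _ _).
Qed.
Lemma cRe_le z : `|cRe z| <= cmod z.
Proof.
rewrite -sqrtr_sqr ler_wsqrtr// lerDl sqr_ge0//.
Qed.
Lemma cIm_le z : `|cIm z| <= cmod z.
Proof. by rewrite -sqrtr_sqr ler_wsqrtr// lerDr sqr_ge0. Qed.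
Lemma cRe_le' z : cRe z <= cmod z.
Proof. exact: le_trans (ler_norm _) (cRe_le _). Qed.
End ComplexScalars.

Section Adjoint.
Context {R : realType}.
Local Notation C := R[i].

Lemma adjmxE a b (M : 'M[C]_(a, b)) i j : adjmx M i j = Num.conj (M j i).
Proof. by rewrite !mxE. Qed.
Lemma adjmxK a b (M : 'M[C]_(a, b)) : adjmx (adjmx M) = M.
Proof. by apply/matrixP => i j; rewrite !adjmxE conjCK. Qed.
Lemma adjmxM a b c (M : 'M[C]_(a, b)) (N : 'M[C]_(b, c)) :
  adjmx (M *m N) = adjmx N *m adjmx M.
Proof. by rewrite /adjmx map_mxM trmx_mul. Qed.
Lemma adjmxD a b (M N : 'M[C]_(a, b)) : adjmx (M + N) = adjmx M + adjmx N.
Proof. by apply/matrixP => i j; rewrite !mxE rmorphD. Qed.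
Lemma adjmxN a b (M : 'M[C]_(a, b)) : adjmx (- M) = - adjmx M.
Proof. by apply/matrixP => i j; rewrite !mxE rmorphN. Qed.
Lemma adjmxB a b (M N : 'M[C]_(a, b)) : adjmx (M - N) = adjmx M - adjmx N.
Proof. by rewrite adjmxD adjmxN. Qed.
Lemma adjmxZ a b (x : R) (M : 'M[C]_(a, b)) : adjmx (ofR x *: M) = ofR x *: adjmx M.
Proof. by apply/matrixP => i j; rewrite !mxE rmorphM/= conj_ofR. Qed.
Lemma adjmx_scalar a (x : R) : adjmx (ofR x)%:M = (ofR x)%:M :> 'M[C]_a.
Proof.
apply/matrixP => i j; rewrite !mxE eq_sym; case: eqP => _ /=.
  by rewrite !mulr1n conj_ofR.
by rewrite !mulr0n conj_ofR.
Qed.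
Lemma adjmx1 a : adjmx 1%:M = 1%:M :> 'M[C]_a.
Proof. by rewrite -(@ofR1 R) adjmx_scalar. Qed.
Lemma adjmx0 a b : adjmx (0 : 'M[C]_(a, b)) = 0.
Proof. by apply/matrixP => i j; rewrite !mxE conjC0. Qed.
Lemma adjmx_sum a b I (r : seq I) (P : pred I) (F : I -> 'M[C]_(a, b)) :
  adjmx (\sum_(i <- r | P i) F i) = \sum_(i <- r | P i) adjmx (F i).
Proof. exact: (big_morph adjmx (@adjmxD a b) (@adjmx0 a b)). Qed.

Lemma mxtrace_adj_mul_ge0 a b (M : 'M[C]_(a, b)) i :
  (M *m adjmx M) i i = ofR (\sum_j cmod (M i j) ^+ 2).
Proof.
by rewrite mxE ofR_sum; apply: eq_bigr => j _; rewrite adjmxE mul_conj.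
Qed.

Definition psdmx {d} (M : 'M[C]_d) : Prop :=
  forall u : 'rV[C]_d, 0 <= cRe ((u *m M *m adjmx u) 0 0).

Lemma psdmx_mul_adj a b (M : 'M[C]_(a, b)) : psdmx (M *m adjmx M).
Proof.
move=> u; rewrite mulmxA -mulmxA -adjmxM mxtrace_adj_mul_ge0 /=.
by apply: sumr_ge0 => j _; rewrite sqr_ge0.
Qed.

Lemma psdmxZ d (c : R) (M : 'M[C]_d) : 0 <= c -> psdmx M -> psdmx (ofR c *: M).
Proof.
by move=> c0 hM u; rewrite -scalemxAr -scalemxAl mxE cReZ mulr_ge0.
Qed.

End Adjoint.

(** * Trace exponentials of Hermitian matrices *)

Section TraceExponential.
Local Open Scope sesquilinear_scope.
Context {R : realType}.
Local Notation C := R[i].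

(** The exponential of t A by functional calculus. It is used for Hermitian [A], whose eigenvalues
    are real, so that [cRe] loses nothing. *)
Definition expmx {d} (t : R) (A : 'M[C]_d) : 'M[C]_d :=
  adjmx (spectralmx A) *m
    diag_mx (\row_i ofR (expR (t * cRe (spectral_diag A 0 i)))) *m spectralmx A.

Definition trexp {d} (t : R) (M A : 'M[C]_d) : R := cRe (\tr (M *m expmx t A)).

(** The spectral theorem together with its consequence for [trexp]: in an eigenbasis of [A], a trace
    against the exponential is a positive combination of diagonal entries of the conjugated [M]. *)
Definition unitary_diag {d} (A U : 'M[C]_d) (a : 'I_d -> R) : Prop :=
  [/\ U *m adjmx U = 1%:M, adjmx U *m U = 1%:M,
      A = adjmx U *m diag_mx (\row_i ofR (a i)) *m U &
      forall t M, trexp t M A =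
        \sum_i expR (t * a i) * cRe ((U *m M *m adjmx U) i i)].

Lemma hermitian_unitary_diag d (A : 'M[C]_d) : adjmx A = A ->
  exists U a, unitary_diag A U a.
Proof.
move=> hA; pose U := spectralmx A; pose a i := cRe (spectral_diag A 0 i).
have adjE (M : 'M[C]_d) : M ^t Num.conj = adjmx M.
  by apply/matrixP => i j; rewrite !mxE.
have UU : U *m adjmx U = 1%:M.
  by rewrite -adjE; apply/unitarymxP; exact: spectral_unitarymx.
have hherm : A \is hermsymmx.
  by apply/is_hermitianmxP; rewrite expr0 scale1r adjE hA.
exists U, a; split => //; first exact: mulmx1C.
- have /orthomx_spectralP Aeq := hermitian_normalmx hherm.
  transitivity (adjmx U *m diag_mx (spectral_diag A) *m U).
    by rewrite -adjE -invmx_unitary ?spectral_unitarymx.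
  congr (_ *m _ *m _); congr diag_mx; apply/rowP => i; rewrite [RHS]mxE.
  have /mxOverP/(_ 0 i)/complex_realP[k kE] := hermitian_spectral_diag_real hherm.
  by rewrite /a kE.
- move=> t M; rewrite /trexp /expmx -/U mulmxA mxtrace_mulC !mulmxA.
  rewrite /mxtrace cRe_sum; apply: eq_bigr => i _.
  by rewrite mul_mx_diag [LHS]/= mxE mxE mulrC cReZ.
Qed.

Lemma trexpD d t (M N A : 'M[C]_d) : trexp t (M + N) A = trexp t M A + trexp t N A.
Proof. by rewrite /trexp mulmxDl linearD cReD. Qed.
Lemma trexpN d t (M A : 'M[C]_d) : trexp t (- M) A = - trexp t M A.
Proof. by rewrite /trexp mulNmx linearN cReN. Qed.
Lemma trexpB d t (M N A : 'M[C]_d) : trexp t (M - N) A = trexp t M A - trexp t N A.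
Proof. by rewrite trexpD trexpN. Qed.
Lemma trexpZ d t (c : R) (M A : 'M[C]_d) :
  trexp t (ofR c *: M) A = c * trexp t M A.
Proof. by rewrite /trexp -scalemxAl linearZ /= cReZ. Qed.
Lemma trexp0 d t (A : 'M[C]_d) : trexp t 0 A = 0.
Proof. by rewrite /trexp mul0mx linear0. Qed.
Lemma trexp_sum d t I (r : seq I) (P : pred I) (F : I -> 'M[C]_d) (A : 'M[C]_d) :
  trexp t (\sum_(i <- r | P i) F i) A = \sum_(i <- r | P i) trexp t (F i) A.
Proof.
by apply: (big_morph (fun M => trexp t M A)); [move=> M N; exact: trexpD|exact: trexp0].
Qed.

Lemma trexp_psd_ge0 d t (M A : 'M[C]_d) : adjmx A = A -> psdmx M -> 0 <= trexp t M A.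
Proof.
move=> /hermitian_unitary_diag[U [a [_ _ _ ->]]] hM.
apply: sumr_ge0 => i _; rewrite mulr_ge0 ?expR_ge0//.
suff -> : (U *m M *m adjmx U) i i = (row i U *m M *m adjmx (row i U)) 0 0 by exact: hM.
rewrite !mxE; apply: eq_bigr => k _; rewrite !mxE; congr (_ * _).
by apply: eq_bigr => l _; rewrite !mxE.
Qed.

Lemma trexp_le d t (M N A : 'M[C]_d) :
  adjmx A = A -> psdmx (N - M) -> trexp t M A <= trexp t N A.
Proof. by move=> hA /(trexp_psd_ge0 t hA); rewrite trexpB subr_ge0. Qed.

Lemma unitary_diag_trexp1 d (A U : 'M[C]_d) a t : unitary_diag A U a ->
  trexp t 1%:M A = \sum_i expR (t * a i).
Proof.
move=> [UU _ _ ->]; apply: eq_bigr => i _.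
by rewrite mulmx1 UU mxE eqxx cRe1 mulr1.
Qed.

Lemma unitary_diag_trexp_id d (A U : 'M[C]_d) a t : unitary_diag A U a ->
  trexp t A A = \sum_i expR (t * a i) * a i.
Proof.
move=> [UU _ AE ->]; apply: eq_bigr => i _; congr (_ * _).
rewrite AE !mulmxA UU mul1mx -mulmxA UU mulmx1.
by rewrite mxE eqxx mulr1n mxE.
Qed.

(** The trapezoid rule overestimates the integral of the convex function exp over the interval
    between [y] and [x]. Both sides are symmetric in [x] and [y], so only the increment u = x - y >=
    0 matters. *)
Lemma expR_trapezoid (x y : R) :
  (x - y) * (expR x - expR y) <= 2^-1 * (x - y) ^+ 2 * (expR x + expR y).
Proof.
suff H (u : R) : 0 <= u -> expR u - 1 <= 2^-1 * u * (expR u + 1).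
  wlog xy : x y / y <= x.
    move=> W; have [/W//|/ltW/W] := leP y x.
    by rewrite [X in X <= _ -> _](_ : _ = (x - y) * (expR x - expR y)) ?[X in _ <= X -> _](_ : _ = 2^-1 * (x - y) ^+ 2 * (expR x + expR y))//; ring.
  have h : 0 <= x - y by rewrite subr_ge0.
  have := ler_wpM2l (mulr_ge0 h (expR_ge0 y)) (H _ h).
  have -> : expR (x - y) = expR x / expR y by rewrite expRD expRN.
  have y0 : expR y != 0 by rewrite gt_eqF ?expR_gt0.
  rewrite [X in X <= _ -> _](_ : _ = (x - y) * (expR x - expR y)); last by field.
  by rewrite [X in _ <= X -> _](_ : _ = 2^-1 * (x - y) ^+ 2 * (expR x + expR y)); last by field.
(* [f] is twice the gap of the reduced inequality and vanishes at 0. Its derivative (v - 1) exp v +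
   1 is nonnegative because exp (- v) >= 1 - v. *)
move=> u0; pose f x : R := (x - 2) * expR x + (x + 2).
have df (v : R) : is_derive v (1 : R) f ((v - 1) * expR v + 1).
  by apply: is_derive_eq; rewrite /GRing.scale/=; ring.
have [|c /[!in_itv]/= /andP[c0 _]] := @MVT_segment _ f (fun x => (x - 1) * expR x + 1) _ _ u0 (fun x _ => df x).
  by apply: continuous_subspaceT => v; apply/differentiable_continuous/derivable1_diffP; case: (df v).
suff f'0 : 0 <= (c - 1) * expR c + 1.
  have := mulr_ge0 f'0 u0; rewrite /f expR0 subr0 => h1 h2; lra.
have e0 : expR c != 0 by rewrite gt_eqF ?expR_gt0.
have := ler_wpM2l (expR_ge0 c) (expR_ge1Dx (- c)).
rewrite -expRD subrr expR0; lra.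
Qed.

Lemma diag_sub_entry d (a b : 'I_d -> R) (W : 'M[C]_d) i j :
  (diag_mx (\row_k ofR (a k)) *m W - W *m diag_mx (\row_k ofR (b k))) i j =
  ofR (a i - b j) * W i j.
Proof.
rewrite mul_diag_mx mul_mx_diag !mxE ofRB mulrBl; congr (_ - _); exact: mulrC.
Qed.

(** [A] and [B] need not commute. Reading A - B from an eigenbasis of [B] to one of [A] gives the
    entries (a_i - b_j) W_ij, with W = U V^*. All four traces become sums over pairs (i, j) with the
    same weights |W_ij|^2, and the scalar trapezoid inequality applies to each pair. *)
Lemma trexp_mean_value d t (A B : 'M[C]_d) : adjmx A = A -> adjmx B = B -> 0 <= t ->
  trexp t (A - B) A - trexp t (A - B) B <=
  2^-1 * t * (trexp t ((A - B) *m (A - B)) A + trexp t ((A - B) *m (A - B)) B).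
Proof.
move=> hA hB t0.
have [U [a [UU UU' AE trA]]] := hermitian_unitary_diag hA.
have [V [b [VV VV' BE trB]]] := hermitian_unitary_diag hB.
pose D := A - B; have hD : adjmx D = D by rewrite /D adjmxB hA hB.
pose W := U *m adjmx V.
have EE : U *m D *m adjmx V = \matrix_(i, j) (ofR (a i - b j) * W i j).
  rewrite mulmxBr mulmxBl {1}AE {1}BE !mulmxA UU mul1mx.
  rewrite -!mulmxA VV mulmx1 mulmxA -/W mulmxA -/W.
  by apply/matrixP => i j; rewrite -[diag_mx _ *m U *m _]mulmxA diag_sub_entry mxE.
have adjW : adjmx W = V *m adjmx U by rewrite adjmxM adjmxK.
have hEE : V *m D *m adjmx U = adjmx (U *m D *m adjmx V).
  by rewrite !adjmxM adjmxK hD mulmxA.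
pose w i j := cmod (W i j) ^+ 2.
have A1 i : cRe ((U *m D *m adjmx U) i i) = \sum_j (a i - b j) * w i j.
  have -> : U *m D *m adjmx U = (U *m D *m adjmx V) *m adjmx W.
    by rewrite adjW !mulmxA -[_ *m adjmx V *m V]mulmxA VV' mulmx1.
  rewrite EE mxE cRe_sum; apply: eq_bigr => j _.
  by rewrite mxE adjmxE -mulrA mul_conj cReZ.
have B1 j : cRe ((V *m D *m adjmx V) j j) = \sum_i (a i - b j) * w i j.
  have -> : V *m D *m adjmx V = adjmx W *m (U *m D *m adjmx V).
    by rewrite adjW !mulmxA -[_ *m adjmx U *m U]mulmxA UU' mulmx1.
  rewrite EE mxE cRe_sum; apply: eq_bigr => i _.
  by rewrite mxE adjmxE mulrCA conj_mul cReZ.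
have A2 i : cRe ((U *m (D *m D) *m adjmx U) i i) = \sum_j (a i - b j) ^+ 2 * w i j.
  have -> : U *m (D *m D) *m adjmx U = (U *m D *m adjmx V) *m adjmx (U *m D *m adjmx V).
    by rewrite -hEE !mulmxA -[_ *m adjmx V *m V]mulmxA VV' mulmx1.
  rewrite mxtrace_adj_mul_ge0 EE /=; apply: eq_bigr => j _.
  by rewrite mxE cmodM cmod_ofR exprMn real_normK ?num_real.
have B2 j : cRe ((V *m (D *m D) *m adjmx V) j j) = \sum_i (a i - b j) ^+ 2 * w i j.
  have -> : V *m (D *m D) *m adjmx V = adjmx (U *m D *m adjmx V) *m (U *m D *m adjmx V).
    by rewrite -hEE !mulmxA -[_ *m adjmx U *m U]mulmxA UU' mulmx1.
  rewrite -[X in _ *m X]adjmxK mxtrace_adj_mul_ge0 EE /=; apply: eq_bigr => i _.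
  by rewrite adjmxE cmodC mxE cmodM cmod_ofR exprMn real_normK ?num_real.
rewrite !trA !trB.
under eq_bigr do rewrite A1 mulr_sumr.
under [X in _ - X]eq_bigr do rewrite B1 mulr_sumr.
under [X in _ * (X + _)]eq_bigr do rewrite A2 mulr_sumr.
under [X in _ * (_ + X)]eq_bigr do rewrite B2 mulr_sumr.
rewrite [X in _ - X]exchange_big [X in _ * (_ + X)]exchange_big /=.
rewrite -sumrB -big_split mulr_sumr; apply: ler_sum => i _ /=.
rewrite -sumrB -big_split mulr_sumr; apply: ler_sum => j _ /=.
have w0 : 0 <= w i j by exact: sqr_ge0.
(* The scalar inequality at t a_i and t b_j carries an extra factor t, which has to be cancelled. *)
have [->|tn0] := eqVneq t 0; first by rewrite !mul0r expR0; lra.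
have tgt0 : 0 < t by rewrite lt_def tn0.
have := expR_trapezoid (t * a i) (t * b j).
rewrite [X in X <= _ -> _](_ : _ = t * ((a i - b j) * (expR (t * a i) - expR (t * b j)))); last by ring.
rewrite [X in _ <= X -> _](_ : _ = t * (2^-1 * t * (a i - b j) ^+ 2 * (expR (t * a i) + expR (t * b j)))); last by ring.
rewrite ler_pM2l// => /(ler_wpM2r w0); lra.
Qed.

(* Convexity of exp on each eigenvalue. *)
Lemma trexp_step d t h (A : 'M[C]_d) : adjmx A = A ->
  trexp t 1%:M A - trexp (t - h) 1%:M A <= h * trexp t A A.
Proof.
move=> /hermitian_unitary_diag[U [a Ua]].
rewrite !(unitary_diag_trexp1 _ Ua) (unitary_diag_trexp_id _ Ua) -sumrB mulr_sumr.
apply: ler_sum => i _.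
have -> : expR ((t - h) * a i) = expR (t * a i) * expR (- (h * a i)).
  by rewrite -expRD; congr expR; ring.
have := ler_wpM2l (expR_ge0 (t * a i)) (expR_ge1Dx (- (h * a i))); lra.
Qed.

Lemma trexp1_gt_eigen d t (A : 'M[C]_d) : adjmx A = A -> forall (U : 'M[C]_d) a,
  unitary_diag A U a -> forall i, expR (t * a i) <= trexp t 1%:M A.
Proof.
move=> hA U a Ua i; rewrite (unitary_diag_trexp1 _ Ua) (bigD1 i)//= lerDl.
by apply: sumr_ge0 => j _; exact: expR_ge0.
Qed.

Lemma trexp0_id d (A : 'M[C]_d) : adjmx A = A -> trexp 0 1%:M A = d%:R.
Proof.
move=> /hermitian_unitary_diag[U [a Ua]]; rewrite (unitary_diag_trexp1 _ Ua).
under eq_bigr do rewrite mul0r expR0.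
by rewrite sumr_const card_ord.
Qed.

End TraceExponential.

(** * Power series and crude bounds for trace exponentials *)

Section TraceExponentialLimit.
Context {R : realType}.
Local Notation C := R[i].

Definition mxpow {d} (A : 'M[C]_d) k : 'M[C]_d := iter k (mulmx A) 1%:M.

Lemma unitary_diag_mxpow d (A U : 'M[C]_d) a k : unitary_diag A U a ->
  mxpow A k = adjmx U *m diag_mx (\row_i ofR (a i ^+ k)) *m U.
Proof.
move=> [UU UU' AE _]; elim: k => [|k IH].
  rewrite /mxpow /= (_ : \row_i _ = const_mx 1); last first.
    by apply/rowP => i; rewrite !mxE expr0 ofR1.
  by rewrite diag_const_mx mulmx1 UU'.
rewrite /mxpow iterS -/(mxpow A k) IH {1}AE !mulmxA.
rewrite -[_ *m U *m adjmx U]mulmxA UU mulmx1 -[_ *m diag_mx _ *m diag_mx _]mulmxA.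
rewrite mulmx_diag; congr (_ *m diag_mx _ *m _).
by apply/rowP => i; rewrite !mxE -ofRM -exprS.
Qed.

Lemma tr_mxpow d (M A U : 'M[C]_d) a k : unitary_diag A U a ->
  cRe (\tr (M *m mxpow A k)) =
  \sum_i a i ^+ k * cRe ((U *m M *m adjmx U) i i).
Proof.
move=> Ua; rewrite (unitary_diag_mxpow _ Ua) mulmxA mxtrace_mulC !mulmxA.
rewrite /mxtrace cRe_sum; apply: eq_bigr => i _.
by rewrite mul_mx_diag [LHS]/= mxE mxE mulrC cReZ.
Qed.

(** The spectral decomposition is a choice with no regularity in [A]. The partial sums here are
    polynomials in the entries of [M] and [A], which is how [trexp] is shown to be measurable. *)
Lemma trexp_cvg d t (M A : 'M[C]_d) : adjmx A = A ->
  (fun N : nat => \sum_(0 <= k < N) (t ^+ k / k`!%:R) * cRe (\tr (M *m mxpow A k)))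
  @ \oo --> trexp t M A.
Proof.
move=> /hermitian_unitary_diag[U [a Ua]]; have [_ _ _ ->] := Ua.
pose c i := cRe ((U *m M *m adjmx U) i i).
rewrite (_ : (fun N : nat => _) =
    fun N : nat => \sum_i series (exp_coeff (t * a i)) N * c i); last first.
  apply/funext => N; under eq_bigr do rewrite (tr_mxpow _ _ Ua) mulr_sumr.
  rewrite exchange_big /=; apply: eq_bigr => i _.
  rewrite /series /= mulr_suml; apply: eq_bigr => k _.
  by rewrite /exp_coeff /= exprMn /c; ring.
apply: (@cvg_big _ _ +%R 0 xpredT) => [x|i _]; first exact: add_continuous.
apply: cvgMl; exact: is_cvg_series_exp_coeff.
Qed.

Definition mxbnd {a b} (c : R) (M : 'M[C]_(a, b)) := forall i j, cmod (M i j) <= c.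

Lemma unitary_entry_le1 d (U : 'M[C]_d) i j : U *m adjmx U = 1%:M -> cmod (U i j) <= 1.
Proof.
move=> UU; have := mxtrace_adj_mul_ge0 U i; rewrite UU mxE eqxx -ofR1 => /ofR_inj/esym.
rewrite (bigD1 j)//= => e; rewrite -(@ler_pXn2r _ 2)// ?nnegrE ?cmod_ge0// expr1n -e lerDl.
by apply: sumr_ge0 => k _; exact: sqr_ge0.
Qed.

Lemma unitary_conj_bnd d (U M : 'M[C]_d) c i :
  U *m adjmx U = 1%:M -> mxbnd c M -> `|cRe ((U *m M *m adjmx U) i i)| <= d%:R * (d%:R * c).
Proof.
move=> UU hM; apply: le_trans (cRe_le _) _.
have nat_sum (y : R) : d%:R * y = \sum_(j < d) y by rewrite sumr_const card_ord mulr_natl.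
rewrite mxE nat_sum; apply: le_trans (ler_cmod_sum _ _ _) _; apply: ler_sum => j _.
have h : cmod ((U *m M) i j) <= d%:R * c.
  rewrite mxE nat_sum; apply: le_trans (ler_cmod_sum _ _ _) _; apply: ler_sum => k _.
  rewrite cmodM -[c]mul1r ler_pM ?cmod_ge0//; exact: unitary_entry_le1.
by rewrite cmodM adjmxE cmodC -[_ * c]mulr1 ler_pM ?cmod_ge0//; exact: unitary_entry_le1.
Qed.

(** Only finiteness and uniformity in [M] and [A] matter: the bound makes trace exponentials of
    bounded matrices integrable. *)
Lemma trexp_bnd d t b c (M A : 'M[C]_d) : adjmx A = A -> 0 <= b -> 0 <= c ->
  mxbnd b A -> mxbnd c M ->
  `|trexp t M A| <= d%:R * (expR (`|t| * (d%:R * (d%:R * b))) * (d%:R * (d%:R * c))).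
Proof.
move=> /hermitian_unitary_diag[U [a [UU UU' AE ->]]] b0 c0 hA hM.
have nat_sum (y : R) : d%:R * y = \sum_(j < d) y by rewrite sumr_const card_ord mulr_natl.
rewrite nat_sum; apply: le_trans (ler_norm_sum _ _ _) _; apply: ler_sum => i _.
rewrite normrM ler_pM//; last exact: unitary_conj_bnd.
rewrite ger0_norm ?expR_ge0// ler_expR; apply: le_trans (ler_norm _) _.
rewrite normrM ler_wpM2l//.
have <- : cRe ((U *m A *m adjmx U) i i) = a i; last exact: unitary_conj_bnd.
rewrite AE !mulmxA UU mul1mx -mulmxA UU mulmx1.
by rewrite mxE eqxx mulr1n mxE.
Qed.
End TraceExponentialLimit.

(** * Measurability of complex matrix-valued functions *)

Section ComplexMeasurable.
Context {R : realType} {d : measure_display} {T : measurableType d}.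
Local Notation C := R[i].

Definition cmeas (f : T -> C) : Prop :=
  measurable_fun setT (fun w => cRe (f w)) /\ measurable_fun setT (fun w => cIm (f w)).

Definition mxmeas {a b} (M : T -> 'M[C]_(a, b)) : Prop :=
  forall i j, cmeas (fun w => M w i j).

Lemma cmeas_cst z : cmeas (fun=> z).
Proof. by split; exact: measurable_cst. Qed.
Lemma cmeasD f g : cmeas f -> cmeas g -> cmeas (fun w => f w + g w).
Proof.
by move=> [? ?] [? ?]; split; under eq_fun do rewrite !cE; exact: measurable_funD.
Qed.
Lemma cmeasN f : cmeas f -> cmeas (fun w => - f w).
Proof.
move=> [h1 h2]; split; under eq_fun do rewrite !cE.
  exact: (measurable_funN h1).
exact: (measurable_funN h2).
Qed.
Lemma cmeasM f g : cmeas f -> cmeas g -> cmeas (fun w => f w * g w).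
Proof.
move=> [? ?] [? ?]; split; under eq_fun do rewrite !cE.
  by apply: measurable_funB; exact: measurable_funM.
by apply: measurable_funD; exact: measurable_funM.
Qed.
Lemma cmeas_conj f : cmeas f -> cmeas (fun w => Num.conj (f w)).
Proof.
move=> [h1 h2]; split; under eq_fun do rewrite !cE; first exact: h1.
exact: (measurable_funN h2).
Qed.
Lemma cmeas_sum I (r : seq I) (P : pred I) (F : I -> T -> C) :
  (forall i, P i -> cmeas (F i)) -> cmeas (fun w => \sum_(i <- r | P i) F i w).
Proof.
move=> h; elim: r => [|i r IH]; first by under eq_fun do rewrite big_nil; exact: cmeas_cst.
under eq_fun do rewrite big_cons; have [Pi|//] := boolP (P i); exact: cmeasD (h _ Pi) IH.
Qed.
Lemma cmeas_prod I (r : seq I) (P : pred I) (F : I -> T -> C) :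
  (forall i, P i -> cmeas (F i)) -> cmeas (fun w => \prod_(i <- r | P i) F i w).
Proof.
move=> h; elim: r => [|i r IH]; first by under eq_fun do rewrite big_nil; exact: cmeas_cst.
under eq_fun do rewrite big_cons; have [Pi|//] := boolP (P i); exact: cmeasM (h _ Pi) IH.
Qed.
Lemma cmeas_cmod2 f : cmeas f -> measurable_fun setT (fun w => cmod (f w) ^+ 2).
Proof.
move=> [? ?]; under eq_fun do rewrite cmod2.
by apply: measurable_funD; exact: measurable_funX.
Qed.

Lemma mxmeas_cst a b (M : 'M[C]_(a, b)) : mxmeas (fun=> M).
Proof. by move=> i j; exact: cmeas_cst. Qed.
Lemma mxmeasD a b (M N : T -> 'M[C]_(a, b)) :
  mxmeas M -> mxmeas N -> mxmeas (fun w => M w + N w).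
Proof. by move=> hM hN i j; under eq_fun do rewrite mxE; exact: cmeasD. Qed.
Lemma mxmeasN a b (M : T -> 'M[C]_(a, b)) : mxmeas M -> mxmeas (fun w => - M w).
Proof. by move=> hM i j; under eq_fun do rewrite mxE; exact: cmeasN. Qed.
Lemma mxmeasB a b (M N : T -> 'M[C]_(a, b)) :
  mxmeas M -> mxmeas N -> mxmeas (fun w => M w - N w).
Proof. by move=> hM hN; apply: mxmeasD => //; exact: mxmeasN. Qed.
Lemma mxmeasZ a b (c : T -> C) (M : T -> 'M[C]_(a, b)) :
  cmeas c -> mxmeas M -> mxmeas (fun w => c w *: M w).
Proof. by move=> hc hM i j; under eq_fun do rewrite mxE; exact: cmeasM. Qed.
Lemma mxmeasM a b c (M : T -> 'M[C]_(a, b)) (N : T -> 'M[C]_(b, c)) :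
  mxmeas M -> mxmeas N -> mxmeas (fun w => M w *m N w).
Proof.
move=> hM hN i j; under eq_fun do rewrite mxE.
by apply: cmeas_sum => k _; exact: cmeasM.
Qed.
Lemma mxmeas_adj a b (M : T -> 'M[C]_(a, b)) : mxmeas M -> mxmeas (fun w => adjmx (M w)).
Proof. by move=> hM i j; under eq_fun do rewrite adjmxE; exact: cmeas_conj. Qed.
Lemma mxmeas_sum a b I (r : seq I) (P : pred I) (F : I -> T -> 'M[C]_(a, b)) :
  (forall i, P i -> mxmeas (F i)) -> mxmeas (fun w => \sum_(i <- r | P i) F i w).
Proof.
by move=> h i j; under eq_fun do rewrite summxE; apply: cmeas_sum => k Pk; exact: h.
Qed.
Lemma mxmeas_pow n (A : T -> 'M[C]_n) k : mxmeas A -> mxmeas (fun w => mxpow (A w) k).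
Proof.
move=> hA; elim: k => [|k IH]; first exact: mxmeas_cst.
exact: mxmeasM hA IH.
Qed.
Lemma cmeas_tr n (A : T -> 'M[C]_n) : mxmeas A -> cmeas (fun w => \tr (A w)).
Proof. by move=> hA; apply: cmeas_sum => i _; exact: hA. Qed.
Lemma cmeas_det n (A : T -> 'M[C]_n) : mxmeas A -> cmeas (fun w => \det (A w)).
Proof.
move=> hA; apply: cmeas_sum => s _; apply: cmeasM; first exact: cmeas_cst.
by apply: cmeas_prod => i _; exact: hA.
Qed.
Lemma mxmeas_adjugate n (A : T -> 'M[C]_n) : mxmeas A -> mxmeas (fun w => \adj (A w)).
Proof.
move=> hA i j; under eq_fun do rewrite mxE.
apply: cmeasM; first exact: cmeas_cst.
by apply: cmeas_det => k l; under eq_fun do rewrite !mxE; exact: hA.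
Qed.

Lemma measurable_trexp n t (M A : T -> 'M[C]_n) : mxmeas M -> mxmeas A ->
  (forall w, adjmx (A w) = A w) -> measurable_fun setT (fun w => trexp t (M w) (A w)).
Proof.
move=> hM hA sA; apply: (@measurable_fun_cvg _ _ _ _ (fun N w => \sum_(0 <= k < N) (t ^+ k / k`!%:R) * cRe (\tr (M w *m mxpow (A w) k)))).
  move=> N; apply: measurable_sum => k; apply: measurable_funM; first exact: measurable_cst.
  have := cmeas_tr (mxmeasM hM (mxmeas_pow k hA)); by case.
by move=> w _; exact: trexp_cvg.
Qed.
End ComplexMeasurable.

Lemma cmeas_comp {R : realType} d d' (T : measurableType d) (T' : measurableType d')
  (g : T' -> T) (f : T -> R[i]) :
  measurable_fun setT g -> cmeas f -> cmeas (fun w => f (g w)).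
Proof. by move=> mg [f1 f2]; split; [exact: (measurableT_comp f1)|exact: (measurableT_comp f2)]. Qed.

Lemma mxmeas_comp {R : realType} d d' (T : measurableType d) (T' : measurableType d')
  (g : T' -> T) a b (M : T -> 'M[R[i]]_(a, b)) :
  measurable_fun setT g -> mxmeas M -> mxmeas (fun w => M (g w)).
Proof. by move=> mg hM i j; exact: (cmeas_comp mg (hM i j)). Qed.

(** * Bounded random variables and independence *)

Section BoundedExpectation.
Context {R : realType} {d : measure_display} {T : measurableType d}.
Variable P : probability T R.
Implicit Types f g : T -> R.

(** The bound holds everywhere and not just almost everywhere, so that integrability passes to
    sections and to every probability in Fubini arguments. *)
Definition bmeas f : Prop :=
  measurable_fun setT f /\ exists K : R, forall w, `|f w| <= K.

Lemma bmeas_integrable f : bmeas f -> P.-integrable setT (EFin \o f).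
Proof.
move=> [mf [K hK]]; apply: measurable_bounded_integrable => //.
  by rewrite (le_lt_trans (probability_le1 P measurableT)) ?ltry.
exists K; split; first exact: num_real.
by move=> x Kx w _; exact: le_trans (hK w) (ltW Kx).
Qed.

Lemma bmeas_cst c : bmeas (fun=> c).
Proof. by split; [exact: measurable_cst|exists `|c|]. Qed.

Lemma bmeasD f g : bmeas f -> bmeas g -> bmeas (fun w => f w + g w).
Proof.
move=> [mf [K hK]] [mg [L hL]]; split; first exact: measurable_funD.
by exists (K + L) => w; exact: le_trans (ler_normD _ _) (lerD _ _).
Qed.

Lemma bmeasM f g : bmeas f -> bmeas g -> bmeas (fun w => f w * g w).
Proof.
move=> [mf [K hK]] [mg [L hL]]; split; first exact: measurable_funM.
by exists (K * L) => w; rewrite normrM ler_pM.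
Qed.

Lemma bmeasZ c f : bmeas f -> bmeas (fun w => c * f w).
Proof. by move=> hf; exact: bmeasM (bmeas_cst c) hf. Qed.

Lemma bmeasN f : bmeas f -> bmeas (fun w => - f w).
Proof.
move=> [mf [K hK]]; split; first exact: (measurable_funN mf).
by exists K => w; rewrite normrN.
Qed.

Lemma bmeasB f g : bmeas f -> bmeas g -> bmeas (fun w => f w - g w).
Proof. by move=> hf hg; exact: bmeasD hf (bmeasN hg). Qed.

Lemma bmeas_sum I (r : seq I) (F : I -> T -> R) :
  (forall i, bmeas (F i)) -> bmeas (fun w => \sum_(i <- r) F i w).
Proof.
move=> h; elim: r => [|i r IH]; first by under eq_fun do rewrite big_nil; exact: bmeas_cst.
by under eq_fun do rewrite big_cons; exact: bmeasD (h _) IH.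
Qed.

Definition Ex f : R := \int[P]_w f w.

Lemma ExE f : bmeas f -> (\int[P]_w (f w)%:E)%E = (Ex f)%:E.
Proof. by move=> hf; rewrite /Ex /Rintegral fineK//; apply: integrable_fin_num => //; exact: bmeas_integrable. Qed.

Lemma Ex_cst c : Ex (fun=> c) = c.
Proof.
rewrite /Ex Rintegral_cst//= -[RHS]mulr1; congr (_ * _).
by rewrite probability_setT.
Qed.

Lemma ExD f g : bmeas f -> bmeas g -> Ex (fun w => f w + g w) = Ex f + Ex g.
Proof. by move=> hf hg; apply: RintegralD => //; exact: bmeas_integrable. Qed.

Lemma ExB f g : bmeas f -> bmeas g -> Ex (fun w => f w - g w) = Ex f - Ex g.
Proof. by move=> hf hg; apply: RintegralB => //; exact: bmeas_integrable. Qed.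

Lemma ExZ c f : bmeas f -> Ex (fun w => c * f w) = c * Ex f.
Proof. by move=> hf; apply: RintegralZl => //; exact: bmeas_integrable. Qed.

Lemma Ex_sum I (r : seq I) (F : I -> T -> R) : (forall i, bmeas (F i)) ->
  Ex (fun w => \sum_(i <- r) F i w) = \sum_(i <- r) Ex (F i).
Proof.
move=> h; elim: r => [|i r IH].
  by under [in LHS]eq_fun do rewrite big_nil; rewrite Ex_cst big_nil.
under [in LHS]eq_fun do rewrite big_cons.
by rewrite ExD ?IH ?big_cons//; exact: bmeas_sum.
Qed.

Lemma Ex_ge0 f : (forall w, 0 <= f w) -> 0 <= Ex f.
Proof. by move=> f0; apply: Rintegral_ge0. Qed.

Lemma Ex_le f g : bmeas f -> bmeas g -> (forall w, f w <= g w) -> Ex f <= Ex g.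
Proof. by move=> hf hg fg; apply: le_Rintegral => //; exact: bmeas_integrable. Qed.

Lemma Ex_ae_eq f g : measurable_fun setT f -> measurable_fun setT g ->
  {ae P, forall w, f w = g w} -> Ex f = Ex g.
Proof.
move=> mf mg fg; congr fine; apply: ae_eq_integral => //; try exact/measurable_EFinP.
by apply: filterS fg => w fgw _ /=; rewrite fgw.
Qed.

Lemma Ex_ae_le f g : bmeas f -> bmeas g -> {ae P, forall w, f w <= g w} -> Ex f <= Ex g.
Proof.
move=> hf hg fg; rewrite -subr_ge0 -ExB//.
(* The positive part agrees with g - f almost everywhere and is nonnegative everywhere. *)
rewrite (@Ex_ae_eq _ (fun w => Num.max (g w - f w) 0)).
- by apply: Ex_ge0 => w; rewrite le_max lexx orbT.
- by have [] := bmeasB hg hf.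
- by apply: measurable_maxr; [have [] := bmeasB hg hf|exact: measurable_cst].
- by apply: filterS fg => w fgw; rewrite max_l// subr_ge0.
Qed.
End BoundedExpectation.

Section FubiniMeasurable.
Context {R : realType} {d1 d2 : measure_display}.
Context {T1 : measurableType d1} {T2 : measurableType d2}.
Variable (P2 : probability T2 R).

Lemma bmeas_pair1 (f : T1 * T2 -> R) x : bmeas f -> bmeas (fun y => f (x, y)).
Proof.
by move=> [mf [K hK]]; split; [exact: measurableT_comp mf (measurable_pair1 x)|exists K].
Qed.
Lemma bmeas_pair2 (f : T1 * T2 -> R) y : bmeas f -> bmeas (fun x => f (x, y)).
Proof.
by move=> [mf [K hK]]; split; [exact: measurableT_comp mf (measurable_pair2 y)|exists K].
Qed.

Lemma bmeas_fubini1 (f : T1 * T2 -> R) : bmeas f -> bmeas (fun x => Ex P2 (fun y => f (x, y))).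
Proof.
move=> hf; have [mf [K hK]] := hf; split.
  (* Shifting by the bound makes the integrand nonnegative, as the measurability part of Tonelli's
     theorem requires. *)
  pose f' z := f z + K.
  have hf' : bmeas f' by exact: bmeasD hf (bmeas_cst K).
  have -> : (fun x => Ex P2 (fun y => f (x, y))) =
            (fun x => Ex P2 (fun y => f' (x, y)) - K).
    by apply/funext => x; rewrite ExD ?Ex_cst ?addrK//; [exact: bmeas_pair1|exact: bmeas_cst].
  apply: measurable_funB => //.
  apply: (@measurableT_comp _ _ _ _ _ _ fine); first exact: fine_measurable.
  apply: (measurable_fun_fubini_tonelli_F (EFin \o f')) => /=.
    by apply/measurable_EFinP; have [] := hf'.
  by move=> z; have := hK z; rewrite lee_fin ler_norml => /andP[h _]; rewrite /f'; lra.
exists K => x; have hx := bmeas_pair1 x hf.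
rewrite ler_norml; apply/andP; split.
  rewrite -[X in X <= _](Ex_cst P2); apply: Ex_le => //; first exact: bmeas_cst.
  by move=> y; have := hK (x, y); rewrite ler_norml => /andP[].
rewrite -[X in _ <= X](Ex_cst P2); apply: Ex_le => //; first exact: bmeas_cst.
by move=> y; have := hK (x, y); rewrite ler_norml => /andP[].
Qed.
End FubiniMeasurable.

Section FubiniBounded.
Context {R : realType} {d1 d2 : measure_display}.
Context {T1 : measurableType d1} {T2 : measurableType d2}.
Variables (P1 : probability T1 R) (P2 : probability T2 R).
Implicit Type f : T1 * T2 -> R.

Lemma integrable_prod f : bmeas f -> (P1 \x P2)%E.-integrable setT (EFin \o f).
Proof.
move=> hf; have [mf [K hK]] := hf.
apply/integrable12ltyP; first exact/measurable_EFinP.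
apply: (@le_lt_trans _ _ (\int[P1]_x \int[P2]_y (cst K%:E (x, y)))%E).
  apply: ge0_le_integral => //=.
  - by move=> x _; apply: integral_ge0.
  - apply: (measurable_fun_fubini_tonelli_F (abse \o (EFin \o f))) => //=.
    by apply: measurableT_comp => //; exact/measurable_EFinP.
  move=> x _; apply: ge0_le_integral => //=.
    by apply/measurable_EFinP; apply: measurableT_comp => //; have [] := bmeas_pair1 x hf.
  by move=> y _; rewrite lee_fin.
have cstE d (T : measurableType d) (P : probability T R) : (\int[P]__ K%:E = K%:E)%E.
  by rewrite -[LHS]/(\int[P]_x (cst K%:E x))%E integral_cst//= probability_setT mule1.
suff -> : (\int[P1]_x \int[P2]_y cst K%:E (x, y))%E = K%:E by rewrite ltry.
by rewrite -[RHS](cstE _ _ P1); apply: eq_integral => x _; exact: cstE.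
Qed.

Lemma Ex_Ex_prod f : bmeas f ->
  (Ex P1 (fun x => Ex P2 (fun y => f (x, y))))%:E = (\int[P1 \x P2]_z (f z)%:E)%E.
Proof.
move=> hf; rewrite -ExE; last exact: bmeas_fubini1.
under eq_integral do (rewrite -ExE; last exact: bmeas_pair1).
by rewrite (integral12_prod_meas1 (integrable_prod hf)).
Qed.
End FubiniBounded.

Section FubiniSwap.
Context {R : realType} {d1 d2 : measure_display}.
Context {T1 : measurableType d1} {T2 : measurableType d2}.
Variables (P1 : probability T1 R) (P2 : probability T2 R).

Lemma bmeas_swap (f : T1 * T2 -> R) : bmeas f -> bmeas (fun z => f (z.2, z.1)).
Proof.
move=> [mf [K hK]]; split; last by exists K.
by apply: measurableT_comp mf _; exact: measurable_swap.
Qed.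

Lemma bmeas_fubini2 (f : T1 * T2 -> R) :
  bmeas f -> bmeas (fun y => Ex P1 (fun x => f (x, y))).
Proof. by move=> /bmeas_swap; exact: bmeas_fubini1. Qed.

Lemma Ex_swap (f : T1 * T2 -> R) : bmeas f ->
  Ex P1 (fun x => Ex P2 (fun y => f (x, y))) = Ex P2 (fun y => Ex P1 (fun x => f (x, y))).
Proof.
move=> hf; apply: EFin_inj.
rewrite -ExE; last exact: bmeas_fubini1.
rewrite -ExE; last exact: bmeas_fubini2.
under eq_integral do (rewrite -ExE; last exact: bmeas_pair1).
under [RHS]eq_integral do (rewrite -ExE; last exact: (bmeas_pair2 _ hf)).
exact: Fubini (integrable_prod P1 P2 hf).
Qed.
End FubiniSwap.

Section Independence.
Context {R : realType} {d d1 d2 : measure_display} {Omega : measurableType d}.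
Context {T1 : measurableType d1} {T2 : measurableType d2}.
Variables (P : probability Omega R) (X : Omega -> T1) (Y : Omega -> T2).
Hypotheses (mX : measurable_fun setT X) (mY : measurable_fun setT Y).
Hypothesis XY : forall A B, measurable A -> measurable B ->
  P (X @^-1` A `&` Y @^-1` B) = (P (X @^-1` A) * P (Y @^-1` B))%E.

Let Z w := (X w, Y w).
Let mZ : measurable_fun setT Z. Proof. exact: measurable_fun_pair. Qed.

HB.instance Definition _ := isMeasurableFun.Build _ _ _ _ X mX.
HB.instance Definition _ := isMeasurableFun.Build _ _ _ _ Y mY.
HB.instance Definition _ := isMeasurableFun.Build _ _ _ _ Z mZ.

Lemma Ex_distribution d' (T : measurableType d') (U : {mfun Omega >-> T}) (f : T -> R) :
  bmeas f -> Ex (distribution P U) f = Ex P (fun w => f (U w)).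
Proof.
move=> [mf [K hK]]; congr fine; rewrite integral_distribution//.
  exact/measurable_EFinP.
apply: (@bmeas_integrable _ _ _ P (fun w => f (U w))).
by split; [exact: measurableT_comp mf _|exists K].
Qed.

(** The law of (X, Y) agrees with the product of the marginal laws on rectangles, hence everywhere.
    The independent copy is the same [Y] read at a second point of [Omega], so the probability space
    is not enlarged. *)
Lemma Ex_indep (f : T1 * T2 -> R) : bmeas f ->
  Ex P (fun w => f (X w, Y w)) = Ex P (fun w => Ex P (fun w' => f (X w, Y w'))).
Proof.
move=> hf; rewrite -(Ex_distribution Z hf).
transitivity (Ex (distribution P X) (fun x => Ex (distribution P Y) (fun y => f (x, y)))).
  apply: EFin_inj; rewrite Ex_Ex_prod// -ExE//.
  apply: eq_measure_integral => A mA _; apply/esym.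
  apply: product_measure_unique; last exact: mA.
  by move=> B C mB mC; exact: XY.
rewrite (Ex_distribution X (bmeas_fubini1 (distribution P Y) hf)).
congr Ex; apply/funext => w; rewrite Ex_distribution//; exact: bmeas_pair1.
Qed.
End Independence.

Section MutualIndependence.
Context {R : realType} {d : measure_display} {Omega : measurableType d}.
Variable P : probability Omega R.
Context {I : finType} (J : {set I}) (g : I -> set (set Omega)).
Hypothesis gm : forall i, g i `<=` measurable.
Hypothesis indep : mutually_indep P J (fun i => <<s g i >>).

Let sgm i A : <<s g i >> A -> measurable A.
Proof. by apply: smallest_sub (@gm i) A; exact: sigma_algebra_measurable. Qed.

Let sgT i : <<s g i >> setT.
Proof. exact: (@measurableT _ (g_sigma_algebraType (g i))). Qed.

Let sgI i A B : <<s g i >> A -> <<s g i >> B -> <<s g i >> (A `&` B).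
Proof. exact: (@measurableI _ (g_sigma_algebraType (g i))). Qed.

Definition cylinders (K : {set I}) : set (set Omega) :=
  [set C | exists2 E : I -> set Omega, (forall i, <<s g i >> (E i)) &
    C = \bigcap_(i in [set i | i \in K]) E i].

Lemma cylinders_measurable K : cylinders K `<=` measurable.
Proof.
move=> _ [E hE ->]; apply: fin_bigcap_measurable => //.
by move=> i _; exact: sgm.
Qed.

Lemma cylinders_setI K : setI_closed (cylinders K).
Proof.
move=> _ _ [E hE ->] [F hF ->]; exists (fun i => E i `&` F i).
  by move=> i; exact: sgI.
by rewrite bigcapI.
Qed.

Lemma indep_cylinder k (K : {set I}) A C : k \in J -> K \subset J :\ k ->
  <<s g k >> A -> cylinders K C -> P (A `&` C) = (P A * P C)%E.
Proof.
move=> kJ KJ hA hC; have [E hE CE] := hC.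
(* Padding by the whole space turns a cylinder over [K] into a family indexed by all of [J], where
   independence is stated. *)
pose F B i := if i == k then B else if i \in K then E i else setT.
have FE B : <<s g k >> B ->
    fine (P (B `&` C)) = fine (P B) * \prod_(i in J | i != k) fine (P (F B i)).
  move=> hB; have := indep (E := F B); rewrite (bigD1 (P := [pred i | i \in J]) k)//=.
  have FBk : F B k = B by rewrite /F eqxx.
  rewrite FBk => <-; last first.
    by move=> i _; rewrite /F; case: eqP => [->//|_]; case: ifP.
  congr (fine (P _)); rewrite CE; apply/seteqP; split => [w [Bw Cw] i /= iJ|w h].
    rewrite /F; case: eqP => // _; case: ifPn => // iK; exact: Cw.
  split; first by have := h k kJ; rewrite /F eqxx.
  move=> i /= iK; have /finset.setD1P[ik iJ] := fintype.subsetP KJ _ iK.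
  by have := h i iJ; rewrite /F (negbTE ik) iK.
have prodE : fine (P C) = \prod_(i in J | i != k) fine (P (F A i)).
  rewrite -[C in LHS]setTI FE ?sgT// probability_setT mul1r.
  by apply: eq_bigr => i /andP[_ /negbTE ik]; rewrite /F ik.
have mA := sgm hA; have mC := cylinders_measurable hC.
have fP B : measurable B -> P B \is a fin_num by move=> ?; exact: fin_num_measure.
rewrite -(fineK (fP _ mA)) -(fineK (fP _ mC)) -EFinM prodE -FE// fineK//.
exact/fP/measurableI.
Qed.

(** For fixed [A], both P(A n C) and P(A) P(C) are finite measures in [C]. They agree on the
    cylinders, which are stable under intersection and generate the sigma-algebra of the family [K],
    hence they agree on it. *)
Lemma indep_split k (K : {set I}) A C : k \in J -> K \subset J :\ k ->
  <<s g k >> A -> <<s \bigcup_(i in [set i | i \in K]) <<s g i >> >> C ->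
  P (A `&` C) = (P A * P C)%E.
Proof.
move=> kJ KJ hA hC; have mA := sgm hA.
have fA : P A \is a fin_num by exact: fin_num_measure.
have pA0 : 0 <= fine (P A) by exact: fine_ge0.
have ms B : mscale (NngNum pA0) P B = (P A * P B)%E by rewrite /mscale /= fineK.
rewrite -ms setIC -[LHS]/(mrestr P mA C).
apply: (g_sigma_algebra_measure_unique (cylinders K) _ (fun=> setT)) => //.
- exact: cylinders_measurable.
- by move=> _; exists (fun=> setT) => //; rewrite bigcapT.
- by rewrite bigcup_const//; exists 0%N.
- exact: cylinders_setI.
- by move=> B hB; rewrite /= ms /mrestr setIC; exact: (indep_cylinder kJ KJ).
- move=> _; rewrite /= /mrestr setTI.
  by apply: le_lt_trans (probability_le1 P mA) _; exact: ltry.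
- apply: (smallest_sub _ _ hC); first exact: smallest_sigma_algebra.
  move=> B [i /= iK hB]; apply: sub_sigma_algebra.
  exists (fun j => if j == i then B else setT).
    by move=> j; case: eqP => [->|].
  apply/seteqP; split => [w Bw j _|w /(_ i iK)]; last by rewrite eqxx.
  by case: eqP.
Qed.
End MutualIndependence.

Section FunctionalIndependence.
Context {R : realType} {d : measure_display} {Omega : measurableType d}.
Variable P : probability Omega R.

(* Both factors are Omega itself, carrying the two sub-sigma-algebras. *)
Lemma Ex_indep_sigma (G1 G2 : set (set Omega)) :
  G1 `<=` measurable -> G2 `<=` measurable ->
  (forall A B, <<s G1 >> A -> <<s G2 >> B -> P (A `&` B) = (P A * P B)%E) ->
  forall f : g_sigma_algebraType G1 * g_sigma_algebraType G2 -> R, bmeas f ->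
  Ex P (fun w => f (w, w)) = Ex P (fun w => Ex P (fun w' => f (w, w'))).
Proof.
move=> G1m G2m ind f hf.
have mid (G : set (set Omega)) : G `<=` measurable ->
    measurable_fun setT (id : Omega -> g_sigma_algebraType G).
  move=> Gm _ A mA; rewrite setTI preimage_id.
  by apply: smallest_sub Gm A mA; exact: sigma_algebra_measurable.
by apply: (Ex_indep (mid _ G1m) (mid _ G2m)) => // A B mA mB; exact: ind.
Qed.
End FunctionalIndependence.

(* For u <= 1/11 one has 1 - u >= exp (- 11/10 u); summing the N steps of length
   t / N produces the two factors 11/10. *)
Lemma discrete_gronwall {R : realType} (f : R -> R) (c L t : R) :
  0 < L -> 0 <= t -> t * L < 1 -> 0 <= c -> f 0 <= c -> (forall u, 0 <= f u) ->
  (forall u h, 0 <= h -> h <= u -> u <= t ->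
     f u * (1 - h * (2 * (u * L) / (1 - u * L))) <= f (u - h)) ->
  f t <= c * expR (121 / 100 * (t ^+ 2 * L / (1 - t * L))).
Proof.
move=> L0 t0 tL c0 fc f0 fstep.
have p : 0 < 1 - t * L by rewrite subr_gt0.
have tL0 : 0 <= t * L by rewrite mulr_ge0// ltW.
pose kap := 2 * L / (1 - t * L).
have L0' := ltW L0; have p' := ltW p.
have kap0 : 0 <= kap by rewrite divr_ge0 ?mulr_ge0.
(* N >= 11 kap t^2 keeps every increment [u] below 1/11. N >= 10 gives (N + 1) / N <= 11/10 for the
   ratio left by the sum 1 + ... + N. *)
pose N := ((Num.truncn (11 * kap * t ^+ 2)).+1 + 10)%N.
have N10 : 10 <= N%:R :> R by rewrite ler_nat /N leq_addl.
have Nk : 11 * kap * t ^+ 2 <= N%:R.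
  apply: ltW; apply: lt_le_trans (truncnS_gt _) _.
  by rewrite ler_nat leq_addr.
have N0 : 0 < N%:R :> R by apply: lt_le_trans N10.
pose h := t / N%:R.
have h0 : 0 <= h by rewrite divr_ge0// ltW.
have Nh : N%:R * h = t by rewrite /h mulrC divfK// gt_eqF.
have key j : (j <= N)%N ->
    f (j%:R * h) <= c * expR (11 / 10 * (kap * h ^+ 2) * (j%:R * (j%:R + 1) / 2)).
  elim: j => [_|j IH jN].
    by rewrite !mul0r mulr0 expR0 mulr1.
  have {}IH := IH (ltnW jN).
  have jh : j.+1%:R * h <= t by rewrite -Nh ler_wpM2r// ler_nat.
  have jhL : j.+1%:R * h * L < 1 by apply: le_lt_trans tL; rewrite ler_wpM2r// ltW.
  have hjh : h <= j.+1%:R * h by rewrite ler_peMl// ler1n.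
  have := fstep _ _ h0 hjh jh.
  have -> : j.+1%:R * h - h = j%:R * h by rewrite -natr1; ring.
  set u' := h * _; pose u := kap * h ^+ 2 * j.+1%:R.
  have u'u : u' <= u.
    rewrite /u' /u /kap.
    have -> : 2 * L / (1 - t * L) * h ^+ 2 * j.+1%:R = h * (2 * (j.+1%:R * h * L) / (1 - t * L)) by ring.
    apply: ler_wpM2l => //; apply: ler_wpM2l; first by rewrite !mulr_ge0.
    rewrite lef_pV2 ?posrE ?subr_gt0//; apply: lerB => //; exact: ler_wpM2r.
  have u0 : 0 <= u by rewrite /u; apply: mulr_ge0 => //; apply: mulr_ge0 => //; exact: sqr_ge0.
  have u11 : 11 * u <= 1.
    apply: (@le_trans _ _ (11 * (kap * h ^+ 2 * N%:R))).
      apply: ler_wpM2l => //; apply: ler_wpM2l; last by rewrite ler_nat.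
      by apply: mulr_ge0 => //; exact: sqr_ge0.
    have -> : 11 * (kap * h ^+ 2 * N%:R) = 11 * kap * t ^+ 2 / N%:R.
      by rewrite -Nh; field; rewrite gt_eqF.
    by rewrite ler_pdivrMr// mul1r.
  have e1 : expR (- (11 / 10 * u)) <= 1 - u.
    rewrite expRN -[X in X <= _]mul1r ler_pdivrMr ?expR_gt0//.
    (* (1 - u) (1 + 11 u / 10) = 1 + u (1 - 11 u) / 10, which is at least 1. *)
    have : 0 <= u * (1 - 11 * u) by apply: mulr_ge0 => //; lra.
    have : (1 - u) * (1 + 11 / 10 * u) <= (1 - u) * expR (11 / 10 * u).
      by apply: ler_wpM2l (expR_ge1Dx _); lra.
    move: (expR _) => E; lra.
  move=> hstep.
  have : f (j.+1%:R * h) * expR (- (11 / 10 * u)) <=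
      c * expR (11 / 10 * (kap * h ^+ 2) * (j%:R * (j%:R + 1) / 2)).
    apply: le_trans IH; apply: le_trans hstep; rewrite ler_wpM2l ?f0//.
    by apply: le_trans e1 _; lra.
  rewrite expRN ler_pdivrMr ?expR_gt0// -[c * _ * _]mulrA -expRD.
  rewrite (_ : 11 / 10 * (kap * h ^+ 2) * (j%:R * (j%:R + 1) / 2) + 11 / 10 * u =
    11 / 10 * (kap * h ^+ 2) * (j.+1%:R * (j.+1%:R + 1) / 2))//.
  by rewrite /u -natr1; field.
have := key N (leqnn N); rewrite Nh => /le_trans; apply.
rewrite ler_wpM2l// ler_expR.
have -> : 11 / 10 * (kap * h ^+ 2) * (N%:R * (N%:R + 1) / 2) =
   11 / 10 * (t ^+ 2 * L / (1 - t * L)) * ((N%:R + 1) / N%:R).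
  by rewrite /kap -Nh; field; rewrite !gt_eqF// Nh.
have -> : 121 / 100 * (t ^+ 2 * L / (1 - t * L)) = 11 / 10 * (t ^+ 2 * L / (1 - t * L)) * (11 / 10) by field; rewrite gt_eqF.
rewrite ler_wpM2l//; last by rewrite ler_pdivrMr//; lra.
by rewrite mulr_ge0// divr_ge0 ?mulr_ge0 ?sqr_ge0// ltW.
Qed.

(** * Matrix Chernoff bound *)

Section BoundedHermitian.
Context {R : realType} {d : measure_display} {T : measurableType d}.
Local Notation C := R[i].

Definition bherm {n} (a : T -> 'M[C]_n) : Prop :=
  [/\ mxmeas a, forall w, adjmx (a w) = a w &
      exists2 c : R, 0 <= c & forall w, mxbnd c (a w)].

Lemma bherm_cst n (M : 'M[C]_n) : adjmx M = M -> bherm (fun=> M).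
Proof.
move=> hM; split => //.
exists (\sum_i \sum_j cmod (M i j)).
  by apply: sumr_ge0 => i _; apply: sumr_ge0 => j _; exact: cmod_ge0.
move=> _ i j; rewrite (bigD1 i)//= (bigD1 j)//= -addrA lerDl addr_ge0//.
  by apply: sumr_ge0 => k _; exact: cmod_ge0.
by apply: sumr_ge0 => k _; apply: sumr_ge0 => l _; exact: cmod_ge0.
Qed.

Lemma bhermD n (a b : T -> 'M[C]_n) : bherm a -> bherm b -> bherm (fun w => a w + b w).
Proof.
move=> [ma ha [c c0 ca]] [mb hb [e e0 eb]]; split; first exact: mxmeasD.
  by move=> w; rewrite adjmxD ha hb.
exists (c + e) => [|w i j]; first exact: addr_ge0.
by rewrite mxE; exact: le_trans (ler_cmodD _ _) (lerD (ca w i j) (eb w i j)).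
Qed.

Lemma bhermZ n (x : R) (a : T -> 'M[C]_n) : bherm a -> bherm (fun w => ofR x *: a w).
Proof.
move=> [ma ha [c c0 ca]]; split; first exact: mxmeasZ (cmeas_cst _) ma.
  by move=> w; rewrite adjmxZ ha.
exists (`|x| * c) => [|w i j]; first by rewrite mulr_ge0.
by rewrite mxE cmodM cmod_ofR ler_wpM2l//; exact: ca.
Qed.

Lemma bhermB n (a b : T -> 'M[C]_n) : bherm a -> bherm b -> bherm (fun w => a w - b w).
Proof.
move=> ha /(bhermZ (-1)) hb; have := bhermD ha hb.
by under eq_fun do rewrite ofRN ofR1 scaleN1r.
Qed.

Lemma bherm_sum n I (r : seq I) (Q : pred I) (F : I -> T -> 'M[C]_n) :
  (forall i, bherm (F i)) -> bherm (fun w => \sum_(i <- r | Q i) F i w).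
Proof.
move=> h; elim: r => [|i r IH].
  by under eq_fun do rewrite big_nil; apply: bherm_cst; exact: adjmx0.
under eq_fun do rewrite big_cons; have [Qi|//] := boolP (Q i); exact: bhermD (h _) IH.
Qed.

Lemma bherm_sqr n (a : T -> 'M[C]_n) : bherm a -> bherm (fun w => a w *m a w).
Proof.
move=> [ma ha [c c0 ca]]; split; first exact: mxmeasM.
  by move=> w; rewrite adjmxM ha.
exists (\sum_(k < n) c * c) => [|w i j]; first by apply: sumr_ge0 => _ _; exact: mulr_ge0.
rewrite mxE; apply: le_trans (ler_cmod_sum _ _ _) _; apply: ler_sum => k _.
by rewrite cmodM ler_pM ?cmod_ge0//; exact: ca.
Qed.

Lemma bmeas_trexp n t (M A : T -> 'M[C]_n) : bherm M -> bherm A ->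
  bmeas (fun w => trexp t (M w) (A w)).
Proof.
move=> [mM hM [c c0 cM]] [mA hA [e e0 eA]]; split; first exact: measurable_trexp.
by eexists => w; exact: (trexp_bnd t (hA w) e0 c0 (eA w) (cM w)).
Qed.
End BoundedHermitian.

Lemma bherm_comp {R : realType} d d' (T : measurableType d) (T' : measurableType d')
  (g : T' -> T) n (a : T -> 'M[R[i]]_n) :
  measurable_fun setT g -> bherm a -> bherm (fun w => a (g w)).
Proof.
move=> mg [ma ha [c c0 ca]]; split; first exact: mxmeas_comp.
  by move=> w; exact: ha.
by exists c.
Qed.

Section SwapFunctional.
Context {R : realType}.
Local Notation C := R[i].
Variables (n : nat) (s t : R).
Hypotheses (s2 : s * s = 1) (t0 : 0 <= t).

(* a and b are a block and its independent copy, z is the part of X that does not involve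
   the block. *)
Definition swapf (a b z : 'M[C]_n) : R :=
  s * trexp t (a - b) (z + ofR s *: a)
  - 2^-1 * t * trexp t ((a - b) *m (a - b)) (z + ofR s *: a).

(** The two exponents differ by s (a - b). After multiplying out with s^2 = 1, the claim is exactly
    the mean value inequality for them. *)
Lemma swapf_antisym_le0 a b z : adjmx a = a -> adjmx b = b -> adjmx z = z ->
  swapf a b z + swapf b a z <= 0.
Proof.
move=> ha hb hz; rewrite /swapf.
set A := z + ofR s *: a; set B := z + ofR s *: b.
have hA : adjmx A = A by rewrite /A adjmxD adjmxZ ha hz.
have hB : adjmx B = B by rewrite /B adjmxD adjmxZ hb hz.
have AB : A - B = ofR s *: (a - b).
  by rewrite /A /B opprD addrACA subrr add0r scalerBr.
have := trexp_mean_value hA hB t0.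
rewrite AB -scalemxAl -scalemxAr scalerA -ofRM s2 ofR1 scale1r !trexpZ.
have -> : trexp t (b - a) B = - trexp t (a - b) B by rewrite -trexpN opprB.
have -> : (b - a) *m (b - a) = (a - b) *m (a - b).
  by rewrite -[b - a]opprB mulmxN mulNmx opprK.
move: (trexp t (a - b) A) (trexp t (a - b) B) => p q.
move: (trexp t _ A) (trexp t _ B) => u v; lra.
Qed.

Lemma bmeas_swapf d (T : measurableType d) (a b z : T -> 'M[C]_n) :
  bherm a -> bherm b -> bherm z -> bmeas (fun w => swapf (a w) (b w) (z w)).
Proof.
move=> ha hb hz; have hA : bherm (fun w => z w + ofR s *: a w).
  exact: bhermD hz (bhermZ _ ha).
have hab := bhermB ha hb.
apply: bmeasB; apply: bmeasZ; apply: bmeas_trexp => //; exact: bherm_sqr hab.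
Qed.
End SwapFunctional.

(** The symmetrization step: [u] and [v] will be an expectation and the same one with a block and
    its copy exchanged. *)
Lemma le0_of_eq_add_le0 {R : realDomainType} (u v : R) : u = v -> u + v <= 0 -> u <= 0.
Proof. by move=> -> h; lra. Qed.

Lemma Ex_add_le0 {R : realType} d (T : measurableType d) (P : probability T R)
  (f g : T -> R) : bmeas f -> bmeas g -> (forall w, f w + g w <= 0) -> Ex P f + Ex P g <= 0.
Proof.
move=> hf hg fg; rewrite -ExD// -[X in _ <= X](Ex_cst P).
by apply: Ex_le => //; [exact: bmeasD|exact: bmeas_cst].
Qed.

Section MatrixChernoff.
Context {R : realType} {disp : measure_display} {Omega : measurableType disp}.
Variable P : probability Omega R.
Local Notation C := R[i].
Variables (m n : nat) (g : 'I_m -> set (set Omega)) (Y : 'I_m -> Omega -> 'M[C]_n).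
Variable L : R.
Hypothesis gm : forall k, g k `<=` measurable.
Hypothesis indep : mutually_indep P [set: 'I_m]%SET (fun k => <<s g k >>).
Hypothesis hY : forall k, bherm (Y k : g_sigma_algebraType (g k) -> 'M[C]_n).
Hypothesis L0 : 0 < L.
Hypothesis Y2L : forall k, {ae P, forall w, psdmx (ofR L *: Y k w - Y k w *m Y k w)}.

Definition Exmx (N : Omega -> 'M[C]_n) : 'M[C]_n :=
  \matrix_(i, j) Complex (Ex P (fun w => cRe (N w i j))) (Ex P (fun w => cIm (N w i j))).

Hypothesis EY : \sum_k Exmx (Y k) = 1%:M.

Lemma bherm_sub_sigma (G : set (set Omega)) (a : g_sigma_algebraType G -> 'M[C]_n) :
  G `<=` measurable -> bherm a -> bherm (a : Omega -> 'M[C]_n).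
Proof.
move=> Gm ha.
suff mid : measurable_fun setT (id : Omega -> g_sigma_algebraType G).
  exact: (bherm_comp mid ha).
move=> _ A mA; rewrite setTI preimage_id.
by apply: smallest_sub Gm A mA; exact: sigma_algebra_measurable.
Qed.

Let hY' k : bherm (Y k : Omega -> 'M[C]_n). Proof. exact: bherm_sub_sigma (@gm k) (hY k). Qed.

Variables (s : R).
Hypothesis s1 : s = 1 \/ s = -1.
Let s2 : s * s = 1. Proof. by case: s1 => ->; rewrite ?mulrNN mulr1. Qed.

(** The sign [s] lets a single argument treat the largest and the smallest eigenvalue of the centred
    sum. *)
Let X w := ofR s *: (\sum_k Y k w - 1%:M).
Let Z k w := ofR s *: (\sum_(j | j != k) Y j w - 1%:M).

Let XZ k w : X w = Z k w + ofR s *: Y k w.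
Proof. by rewrite /X /Z -scalerDr; congr (_ *: _); rewrite (bigD1 k)//= -addrA addrC. Qed.

Let hX : bherm X.
Proof.
apply/bhermZ/bhermB; last by apply: bherm_cst; exact: adjmx1.
by apply: bherm_sum => k; exact: hY'.
Qed.

Let gen k := \bigcup_(i in [set i | i \in ([set: 'I_m] :\ k)%SET]) <<s g i >>.

Let gen_measurable k : gen k `<=` measurable.
Proof.
by move=> B [i _]; apply: smallest_sub (@gm i) B; exact: sigma_algebra_measurable.
Qed.

Let hZ k : bherm (Z k : g_sigma_algebraType (gen k) -> 'M[C]_n).
Proof.
apply/bhermZ/bhermB; last by apply: bherm_cst; exact: adjmx1.
under eq_fun do rewrite big_mkcond.
apply: bherm_sum => j; have [jk|_] := boolP (j != k); last by apply: bherm_cst; exact: adjmx0.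
have mid : measurable_fun setT (id : g_sigma_algebraType (gen k) -> g_sigma_algebraType (g j)).
  move=> _ A mA; rewrite setTI preimage_id.
  apply: sub_sigma_algebra; exists j => //=.
  by rewrite in_setD1 finset.in_setT jk.
exact: (bherm_comp mid (hY j)).
Qed.

Let hZ' k : bherm (Z k : Omega -> 'M[C]_n).
Proof. exact: bherm_sub_sigma (@gen_measurable k) (hZ k). Qed.

(** The remainder [Z k] is first replaced by an independent copy and averaged out. The remaining
    expectation is over two independent points, and exchanging them leaves it unchanged, so it is
    half of an antisymmetrized expectation with nonpositive integrand. *)
Lemma Ex_swapf_le0 t k : 0 <= t ->
  Ex P (fun w => Ex P (fun w' => swapf s t (Y k w) (Y k w') (Z k w))) <= 0.
Proof.
move=> t0.
have [_ symY _] := hY k; have [_ symZ _] := hZ k.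
rewrite (@Ex_swap _ _ _ _ _ P P (fun z : Omega * Omega => swapf s t (Y k z.1) (Y k z.2) (Z k z.1))); last first.
  apply: bmeas_swapf.
  - exact: (bherm_comp measurable_fst (hY' k)).
  - exact: (bherm_comp measurable_snd (hY' k)).
  - exact: (bherm_comp measurable_fst (hZ' k)).
pose kap (z : Omega * Omega) := Ex P (fun w'' => swapf s t (Y k z.1) (Y k z.2) (Z k w'')).
have hkap : bmeas kap.
  apply: (@bmeas_fubini1 _ _ _ (Omega * Omega)%type Omega P
    (fun z => swapf s t (Y k z.1.1) (Y k z.1.2) (Z k z.2))).
  have m1 := measurable_fst (T1 := (Omega * Omega)%type) (T2 := Omega).
  apply: bmeas_swapf.
  - exact: (bherm_comp (measurableT_comp measurable_fst m1) (hY' k)).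
  - exact: (bherm_comp (measurableT_comp measurable_snd m1) (hY' k)).
  - exact: (bherm_comp measurable_snd (hZ' k)).
(* With the copy frozen at [y], block [k] and the other blocks are still read at the same point [x];
   independence separates them. *)
have -> : (fun y => Ex P (fun x => swapf s t (Y k x) (Y k y) (Z k x))) =
          (fun y => Ex P (fun x => kap (x, y))).
  apply/funext => y.
  apply: (Ex_indep_sigma (@gm k) (@gen_measurable k) _ (f := fun z => swapf s t (Y k z.1) (Y k y) (Z k z.2))).
    move=> A B hA hB; apply: (indep_split gm indep _ _ hA hB); first exact: finset.in_setT.
    exact: fintype.subxx.
  apply: bmeas_swapf.
  - exact: (bherm_comp measurable_fst (hY k)).
  - by apply: bherm_cst; exact: symY.
  - exact: (bherm_comp measurable_snd (hZ k)).
have e : Ex P (fun y => Ex P (fun x => kap (x, y))) = Ex P (fun y => Ex P (fun x => kap (y, x))).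
  exact: esym (Ex_swap P P hkap).
apply: (le0_of_eq_add_le0 e); clear e.
have hk1 y : bmeas (fun x => kap (x, y)) by exact: (bmeas_pair2 _ hkap).
have hk2 y : bmeas (fun x => kap (y, x)) by exact: (bmeas_pair1 _ hkap).
apply: Ex_add_le0; [exact: (bmeas_fubini2 P hkap)|exact: (bmeas_fubini1 P hkap)|move=> y].
apply: Ex_add_le0; [exact: hk1|exact: hk2|move=> x].
have hsw a b : bmeas (fun w'' => swapf s t (Y k a) (Y k b) (Z k w'')).
  apply: bmeas_swapf; last exact: hZ'.
    by apply: bherm_cst; exact: symY.
  by apply: bherm_cst; exact: symY.
apply: Ex_add_le0; [exact: hsw|exact: hsw|move=> w].
exact: swapf_antisym_le0.
Qed.

Lemma trexp_entries t (N A : 'M[C]_n) : trexp t N A =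
  \sum_i \sum_j (cRe (N i j) * cRe (expmx t A j i) - cIm (N i j) * cIm (expmx t A j i)).
Proof.
rewrite /trexp /mxtrace cRe_sum; apply: eq_bigr => i _.
by rewrite mxE cRe_sum; apply: eq_bigr => j _; rewrite !cE.
Qed.

Lemma bherm_entry_bmeas (N : Omega -> 'M[C]_n) i j : bherm N ->
  bmeas (fun w => cRe (N w i j)) /\ bmeas (fun w => cIm (N w i j)).
Proof.
move=> [mN _ [c c0 hc]]; have [m1 m2] := mN i j.
split; split => //; exists c => w; apply: le_trans (hc w i j).
  exact: cRe_le.
exact: cIm_le.
Qed.

(** With the exponent frozen, [trexp] is real linear in the entries of its first argument. *)
Lemma Ex_trexp_linear t (N : Omega -> 'M[C]_n) (A : 'M[C]_n) : bherm N ->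
  Ex P (fun w => trexp t (N w) A) = trexp t (Exmx N) A.
Proof.
move=> hN; rewrite trexp_entries; under [in LHS]eq_fun do rewrite trexp_entries.
have h i j := bherm_entry_bmeas i j hN.
have hterm i j : bmeas (fun w => cRe (N w i j) * cRe (expmx t A j i) - cIm (N w i j) * cIm (expmx t A j i)).
  by have [h1 h2] := h i j; apply: bmeasB; apply: bmeasM => //; exact: bmeas_cst.
rewrite Ex_sum; last by move=> i; exact: bmeas_sum.
apply: eq_bigr => i _; rewrite Ex_sum//; apply: eq_bigr => j _.
have [h1 h2] := h i j.
under eq_fun do rewrite [X in X - _]mulrC [X in _ - X]mulrC.
rewrite ExB; [|exact: bmeasZ|exact: bmeasZ].
by rewrite !ExZ// [Exmx N i j]mxE /=; congr (_ - _); exact: mulrC.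
Qed.

(** Noncommutative parallelogram identity: the difference is (a + b)^2. *)
Lemma psd_sqr_sub (a b : 'M[C]_n) : adjmx a = a -> adjmx b = b ->
  psdmx ((ofR 2 *: (a *m a) + ofR 2 *: (b *m b)) - (a - b) *m (a - b)).
Proof.
move=> ha hb.
rewrite (_ : _ - _ = (a + b) *m adjmx (a + b)); first exact: psdmx_mul_adj.
rewrite adjmxD ha hb mulmxBl !mulmxBr mulmxDl !mulmxDr.
have two (M : 'M[C]_n) : ofR 2 *: M = M + M by rewrite ofR_nat scaler_nat mulr2n.
rewrite !two.
move: (a *m a) (a *m b) (b *m a) (b *m b) => p q r u.
by apply/matrixP => i j; rewrite !mxE; ring.
Qed.

(** (Y - Y')^2 <= 2 Y^2 + 2 Y'^2 <= 2 L (Y + Y') as quadratic forms. This makes the quadratic term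
    of [swapf] linear in the blocks, hence summable over [k]. *)
Lemma swapf_lower t k w w' : 0 <= t ->
  psdmx (ofR L *: Y k w - Y k w *m Y k w) -> psdmx (ofR L *: Y k w' - Y k w' *m Y k w') ->
  (s - t * L) * trexp t (Y k w) (X w) - (s + t * L) * trexp t (Y k w') (X w)
  <= swapf s t (Y k w) (Y k w') (Z k w).
Proof.
move=> t0 p1 p2; have [_ symX _] := hX; have [_ symY _] := hY' k.
rewrite /swapf -XZ trexpB.
have h1 := trexp_le t (symX w) p1; have h2 := trexp_le t (symX w) p2.
have := trexp_le t (symX w) (psd_sqr_sub (symY w) (symY w')).
rewrite !trexpZ in h1 h2; rewrite trexpD !trexpZ.
move: h1 h2.
move: (trexp t (Y k w) (X w)) (trexp t (Y k w') (X w)) => y y'.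
move: (trexp t (Y k w *m Y k w) (X w)) (trexp t (Y k w' *m Y k w') (X w)) => u v.
move: (trexp t _ (X w)) => q h1 h2 h3.
have : t * q <= t * (2 * (L * y) + 2 * (L * y')) by rewrite ler_wpM2l//; lra.
lra.
Qed.

Lemma Ex_trexp_swap_ineq t k : 0 <= t ->
  Ex P (fun w => (s - t * L) * trexp t (Y k w) (X w)
                 - (s + t * L) * trexp t (Exmx (Y k)) (X w)) <= 0.
Proof.
move=> t0; apply: le_trans (Ex_swapf_le0 k t0).
have symE : adjmx (Exmx (Y k)) = Exmx (Y k).
  have [_ symY _] := hY' k.
  apply/matrixP => i j; rewrite adjmxE !mxE; apply: complexP; rewrite !cE /=.
    by congr Ex; apply/funext => w; rewrite -[in RHS](symY w) adjmxE cReC.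
  rewrite -[LHS]mulN1r -ExZ; last by have [] := bherm_entry_bmeas j i (hY' k).
  by congr Ex; apply/funext => w; rewrite -[in RHS](symY w) adjmxE cImC mulN1r.
have h1 : bmeas (fun w => trexp t (Y k w) (X w)) by exact: bmeas_trexp.
have h2 : bmeas (fun w => trexp t (Exmx (Y k)) (X w)).
  by apply: bmeas_trexp => //; exact: bherm_cst.
have hsw : bmeas (fun z : Omega * Omega => swapf s t (Y k z.1) (Y k z.2) (Z k z.1)).
  apply: bmeas_swapf.
  - exact: (bherm_comp measurable_fst (hY' k)).
  - exact: (bherm_comp measurable_snd (hY' k)).
  - exact: (bherm_comp measurable_fst (hZ' k)).
apply: Ex_ae_le; [by apply: bmeasB; exact: bmeasZ|exact: (bmeas_fubini1 P hsw)|].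
have [_ symX _] := hX.
apply: filterS (Y2L k) => w pw.
have hYA : bmeas (fun w' => trexp t (Y k w') (X w)).
  by apply: bmeas_trexp; [exact: hY'|apply: bherm_cst; exact: symX].
rewrite -(Ex_trexp_linear t (X w) (hY' k)) -[X in X - _](Ex_cst P) -ExZ// -ExB; last 2 first.
- exact: bmeas_cst.
- exact: bmeasZ.
apply: Ex_ae_le.
- by apply: bmeasB; [exact: bmeas_cst|exact: bmeasZ].
- exact: (bmeas_pair1 w hsw).
- by apply: filterS (Y2L k) => w' pw'; exact: swapf_lower.
Qed.

Let mgf t := Ex P (fun w => trexp t 1%:M (X w)).
Let dmgf t := Ex P (fun w => trexp t (X w) (X w)).

Let hm t : bmeas (fun w => trexp t 1%:M (X w)).
Proof. by apply: bmeas_trexp => //; apply: bherm_cst; exact: adjmx1. Qed.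
Let hd t : bmeas (fun w => trexp t (X w) (X w)).
Proof. exact: bmeas_trexp. Qed.

(** Sum the block inequalities: the blocks add up to 1 + s X and their means to 1, so the terms in
    [s] alone cancel. Here [dmgf] stands for the derivative of [mgf]. *)
Lemma dmgf_mgf t : 0 <= t -> (1 - s * t * L) * dmgf t <= 2 * (t * L) * mgf t.
Proof.
move=> t0.
have h1 k : bmeas (fun w => trexp t (Y k w) (X w)) by exact: bmeas_trexp.
have symE k : bherm (fun _ : Omega => Exmx (Y k)).
  have [_ symY _] := hY' k.
  apply: bherm_cst; apply/matrixP => i j; rewrite adjmxE !mxE; apply: complexP; rewrite !cE /=.
    by congr Ex; apply/funext => w; rewrite -[in RHS](symY w) adjmxE cReC.
  rewrite -[LHS]mulN1r -ExZ; last by have [] := bherm_entry_bmeas j i (hY' k).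
  by congr Ex; apply/funext => w; rewrite -[in RHS](symY w) adjmxE cImC mulN1r.
have h2 k : bmeas (fun w => trexp t (Exmx (Y k)) (X w)) by exact: bmeas_trexp.
have h3 k : bmeas (fun w => (s - t * L) * trexp t (Y k w) (X w)
                 - (s + t * L) * trexp t (Exmx (Y k)) (X w)).
  by apply: bmeasB; exact: bmeasZ.
have : \sum_k Ex P (fun w => (s - t * L) * trexp t (Y k w) (X w)
                 - (s + t * L) * trexp t (Exmx (Y k)) (X w)) <= 0.
  by apply: sumr_le0 => k _; exact: Ex_trexp_swap_ineq.
rewrite -(Ex_sum P _ h3).
have -> : (fun w => \sum_k ((s - t * L) * trexp t (Y k w) (X w)
                 - (s + t * L) * trexp t (Exmx (Y k)) (X w))) =
  (fun w => (1 - s * t * L) * trexp t (X w) (X w) - 2 * (t * L) * trexp t 1%:M (X w)).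
  apply/funext => w; rewrite sumrB -!mulr_sumr -!trexp_sum EY.
  have -> : \sum_k Y k w = 1%:M + ofR s *: X w.
    by rewrite /X scalerA -ofRM s2 ofR1 scale1r addrC subrK.
  rewrite trexpD trexpZ; move: (trexp t 1%:M (X w)) (trexp t (X w) (X w)) => p q.
  have -> : (s - t * L) * (p + s * q) - (s + t * L) * p = (s * s - s * t * L) * q - 2 * (t * L) * p by ring.
  by rewrite s2.
rewrite ExB; [|exact: bmeasZ|exact: bmeasZ].
by rewrite (ExZ P _ (hd t)) (ExZ P _ (hm t)) subr_le0.
Qed.

Lemma mgf_ge0 t : 0 <= mgf t.
Proof.
have [_ symX _] := hX.
apply: Ex_ge0 => w; apply: trexp_psd_ge0 => //.
by rewrite -[1%:M](mulmx1) -[X in _ *m X]adjmx1; exact: psdmx_mul_adj.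
Qed.

Lemma dmgf_le t : 0 <= t -> t * L < 1 -> dmgf t <= 2 * (t * L) / (1 - t * L) * mgf t.
Proof.
move=> t0 tL; have tL0 : 0 <= t * L by rewrite mulr_ge0// ltW.
have p : 0 < 1 - t * L by rewrite subr_gt0.
have := dmgf_mgf t0; have := mgf_ge0 t; move: (dmgf t) (mgf t) => D M M0 h.
have r0 : 0 <= 2 * (t * L) * M by apply: mulr_ge0 => //; exact: mulr_ge0.
have [D0|D0] := leP D 0.
  by apply: le_trans D0 _; rewrite mulrAC divr_ge0// ltW.
rewrite mulrAC ler_pdivlMr// mulrC; apply: le_trans h; apply: ler_wpM2r; first exact: ltW.
(* For s = -1 the factor is 1 + t L, which the common factor 1 - t L bounds from below. *)
by case: s1 => ->; lra.
Qed.

(** The differential inequality for [mgf] in finite differences: convexity of exp bounds the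
    increment by h times [dmgf], which avoids differentiating under the expectation. *)
Lemma mgf_step t h : 0 <= h -> h <= t -> t * L < 1 ->
  mgf t * (1 - h * (2 * (t * L) / (1 - t * L))) <= mgf (t - h).
Proof.
move=> h0 ht tL; have t0 := le_trans h0 ht.
have [_ symX _] := hX.
have : mgf t - mgf (t - h) <= h * dmgf t.
  rewrite -(ExB P (hm t) (hm (t - h))) -(ExZ P h (hd t)).
  apply: Ex_le; [exact: bmeasB (hm _) (hm _)|exact: bmeasZ _ (hd t)|].
  by move=> w; exact: trexp_step.
have := ler_wpM2l h0 (dmgf_le t0 tL).
move: (mgf t) (mgf (t - h)) (dmgf t) => M M' D; lra.
Qed.

Lemma mgf_bound t : 0 <= t -> t * L < 1 ->
  mgf t <= n%:R * expR (121 / 100 * (t ^+ 2 * L / (1 - t * L))).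
Proof.
move=> t0 tL; apply: (discrete_gronwall (t := t)) => //.
- rewrite /mgf; have [_ symX _] := hX.
  by under eq_fun do rewrite trexp0_id//; rewrite Ex_cst.
- exact: mgf_ge0.
- move=> u h h0 hu ut; apply: mgf_step => //.
  by apply: le_lt_trans tL; rewrite ler_wpM2r// ltW.
Qed.
End MatrixChernoff.

(** * Euclidean and operator norms *)

Section VectorNorms.
Context {R : realType}.
Local Notation C := R[i].

Lemma l2norm_ge0 n (v : 'cV[C]_n) : 0 <= l2norm v. Proof. exact: sqrtr_ge0. Qed.

Lemma l2norm2 n (v : 'cV[C]_n) : l2norm v ^+ 2 = \sum_i cmod (v i 0) ^+ 2.
Proof. by rewrite sqr_sqrtr// sumr_ge0// => i _; exact: sqr_ge0. Qed.

Lemma l2norm_leX n (u : 'cV[C]_n) (c : R) : 0 <= c ->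
  (l2norm u <= c) = (\sum_i cmod (u i 0) ^+ 2 <= c ^+ 2).
Proof. by move=> c0; rewrite -!l2norm2 ler_pXn2r// nnegrE l2norm_ge0. Qed.

Lemma dot_l2norm2 n (v : 'cV[C]_n) : (adjmx v *m v) 0 0 = ofR (l2norm v ^+ 2).
Proof.
rewrite l2norm2 mxE ofR_sum; apply: eq_bigr => i _.
by rewrite adjmxE conj_mul.
Qed.

Lemma l2norm_eq0 n (v : 'cV[C]_n) : l2norm v = 0 -> v = 0.
Proof.
move=> v0; have /eqP : \sum_i cmod (v i 0) ^+ 2 = 0 by rewrite -l2norm2 v0 expr0n.
rewrite psumr_eq0 => [/allP h|i _]; last exact: sqr_ge0.
apply/colP => i; rewrite [RHS]mxE; apply/eqP; rewrite -cmod_eq0.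
by have := h i; rewrite mem_index_enum sqrf_eq0 => /(_ isT).
Qed.

(** Lagrange's identity writes the gap as half a double sum of squares. *)
Lemma real_cauchy_schwarz I (r : seq I) (a b : I -> R) :
  (\sum_(i <- r) a i * b i) ^+ 2 <= (\sum_(i <- r) a i ^+ 2) * (\sum_(i <- r) b i ^+ 2).
Proof.
rewrite -subr_ge0.
have -> : (\sum_(i <- r) a i ^+ 2) * (\sum_(i <- r) b i ^+ 2) - (\sum_(i <- r) a i * b i) ^+ 2
  = 2^-1 * \sum_(i <- r) \sum_(j <- r) (a i * b j - a j * b i) ^+ 2.
  have e : \sum_(i <- r) \sum_(j <- r) (a i * b j - a j * b i) ^+ 2 =
    \sum_(i <- r) \sum_(j <- r) (a i ^+ 2 * b j ^+ 2) +
    \sum_(i <- r) \sum_(j <- r) (b i ^+ 2 * a j ^+ 2) -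
    2 * \sum_(i <- r) \sum_(j <- r) ((a i * b i) * (a j * b j)).
    rewrite mulr_sumr -big_split -sumrB /=; apply: eq_bigr => i _.
    rewrite mulr_sumr -big_split -sumrB /=; apply: eq_bigr => j _; ring.
  by rewrite e -!big_distrlr /=; field.
by rewrite mulr_ge0// sumr_ge0// => i _; rewrite sumr_ge0// => j _; exact: sqr_ge0.
Qed.

Lemma cmod_sum_mul_le n (u v : 'I_n -> C) (a b : R) : 0 <= a -> 0 <= b ->
  \sum_i cmod (u i) ^+ 2 <= a ^+ 2 -> \sum_i cmod (v i) ^+ 2 <= b ^+ 2 ->
  cmod (\sum_i u i * v i) <= a * b.
Proof.
move=> a0 b0 ua vb; apply: le_trans (ler_cmod_sum _ _ _) _.
under eq_bigr do rewrite cmodM.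
rewrite -(@ler_pXn2r _ 2)// ?nnegrE ?mulr_ge0//; last first.
  by apply: sumr_ge0 => i _; rewrite mulr_ge0 ?cmod_ge0.
apply: le_trans (real_cauchy_schwarz _ _ _) _.
by rewrite exprMn ler_pM// sumr_ge0// => i _; exact: sqr_ge0.
Qed.

Lemma cmod_dot_le n (u v : 'cV[C]_n) : cmod ((adjmx u *m v) 0 0) <= l2norm u * l2norm v.
Proof.
rewrite mxE; apply: cmod_sum_mul_le; rewrite ?l2norm_ge0// l2norm2//.
by under eq_bigr do rewrite adjmxE cmodC.
Qed.

Lemma ler_l2normD n (u v : 'cV[C]_n) : l2norm (u + v) <= l2norm u + l2norm v.
Proof.
rewrite -(@ler_pXn2r _ 2)// ?nnegrE ?addr_ge0 ?l2norm_ge0//.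
have -> : l2norm (u + v) ^+ 2 = cRe ((adjmx (u + v) *m (u + v)) 0 0) by rewrite dot_l2norm2.
have addE (M N : 'M[C]_1) : (M + N) 0 0 = M 0 0 + N 0 0 by rewrite mxE.
rewrite adjmxD mulmxDl !mulmxDr !addE !cReD !dot_l2norm2 !cRe_ofR sqrrD.
have := cmod_dot_le u v; have := cmod_dot_le v u.
have := cRe_le' ((adjmx u *m v) 0 0); have := cRe_le' ((adjmx v *m u) 0 0).
lra.
Qed.

Lemma l2normZ n (c : C) (v : 'cV[C]_n) : l2norm (c *: v) = cmod c * l2norm v.
Proof.
rewrite /l2norm; under eq_bigr do rewrite mxE cmodM exprMn.
by rewrite -mulr_sumr sqrtrM ?sqr_ge0// sqrtr_sqr ger0_norm ?cmod_ge0.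
Qed.

Lemma l2normN n (v : 'cV[C]_n) : l2norm (- v) = l2norm v.
Proof. by rewrite /l2norm; under eq_bigr do rewrite mxE cmodN. Qed.

Lemma ler_l2normB n (u v : 'cV[C]_n) : l2norm (u - v) <= l2norm u + l2norm v.
Proof. by rewrite -(l2normN v) ler_l2normD. Qed.

Lemma l2norm0 n : l2norm (0 : 'cV[C]_n) = 0.
Proof. by rewrite /l2norm big1 ?sqrtr0// => i _; rewrite mxE cmod0 expr0n. Qed.

Lemma ler_l2norm_sum n I (r : seq I) (Q : pred I) (F : I -> 'cV[C]_n) :
  l2norm (\sum_(i <- r | Q i) F i) <= \sum_(i <- r | Q i) l2norm (F i).
Proof.
elim/big_ind2 : _ => [|x a y b xa yb|//]; first by rewrite l2norm0.
exact: le_trans (ler_l2normD _ _) (lerD _ _).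
Qed.

Lemma cmod_le_l2norm n (v : 'cV[C]_n) i : cmod (v i 0) <= l2norm v.
Proof.
rewrite -(@ler_pXn2r _ 2)// ?nnegrE ?cmod_ge0 ?l2norm_ge0// l2norm2 (bigD1 i)//= lerDl.
by apply: sumr_ge0 => j _; exact: sqr_ge0.
Qed.

(** Shows that the set defining [opnorm] is bounded above, so that its [sup] is a genuine upper
    bound. *)
Lemma mulmx_frobenius_le a b (M : 'M[C]_(a, b)) (v : 'cV[C]_b) :
  l2norm (M *m v) <= Num.sqrt (\sum_i \sum_j cmod (M i j) ^+ 2) * l2norm v.
Proof.
rewrite l2norm_leX ?mulr_ge0 ?sqrtr_ge0 ?l2norm_ge0// exprMn sqr_sqrtr; last first.
  by apply: sumr_ge0 => i _; apply: sumr_ge0 => j _; exact: sqr_ge0.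
rewrite mulr_suml; apply: ler_sum => i _.
have h0 : 0 <= \sum_j cmod (M i j) ^+ 2 by apply: sumr_ge0 => j _; exact: sqr_ge0.
rewrite -[X in X * _](sqr_sqrtr h0) -exprMn ler_pXn2r// ?nnegrE ?cmod_ge0 ?mulr_ge0 ?sqrtr_ge0 ?l2norm_ge0//.
by rewrite mxE; apply: cmod_sum_mul_le;
  [exact: sqrtr_ge0|exact: l2norm_ge0|rewrite sqr_sqrtr|rewrite l2norm2].
Qed.

Lemma opnorm_ge a b (M : 'M[C]_(a, b)) (v : 'cV[C]_b) : l2norm v <= 1 ->
  l2norm (M *m v) <= opnorm M.
Proof.
move=> v1; apply: sup_upper_bound; last by exists v.
split; first by exists (l2norm (M *m v)), v.
exists (Num.sqrt (\sum_i \sum_j cmod (M i j) ^+ 2)) => _ [u /= u1 <-].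
apply: le_trans (mulmx_frobenius_le _ _) _.
by rewrite -[X in _ <= X]mulr1 ler_wpM2l ?sqrtr_ge0.
Qed.

Lemma l2norm_mul_le a b (M : 'M[C]_(a, b)) (c : R) : 0 <= c -> opnorm M <= c ->
  forall v : 'cV[C]_b, l2norm (M *m v) <= c * l2norm v.
Proof.
move=> c0 Mc v; have [v0|vn0] := eqVneq (l2norm v) 0.
  by rewrite (l2norm_eq0 v0) mulmx0 !l2norm0 mulr0.
have vp : 0 < l2norm v by rewrite lt_def vn0 l2norm_ge0.
pose u := ofR (l2norm v)^-1 *: v.
have u1 : l2norm u <= 1.
  by rewrite l2normZ cmod_ofR ger0_norm ?invr_ge0 ?l2norm_ge0// mulVf.
have := le_trans (opnorm_ge M u1) Mc.
rewrite -scalemxAr l2normZ cmod_ofR ger0_norm ?invr_ge0 ?l2norm_ge0//.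
by rewrite mulrC ler_pdivrMr.
Qed.

Lemma l2norm_delta n (j : 'I_n) : l2norm (delta_mx j 0 : 'cV[C]_n) = 1.
Proof.
rewrite /l2norm (bigD1 j)//= big1 ?addr0; last first.
  by move=> k kj; rewrite mxE (negbTE kj) cmod0 expr0n.
by rewrite mxE !eqxx cmod1 expr1n sqrtr1.
Qed.

Lemma sqr_le_of_bounds (z q r c : R) : 0 <= z -> 0 <= q -> 0 <= r -> 0 <= c ->
  q ^+ 2 <= z * r -> z ^+ 2 <= c * q ^+ 2 -> q ^+ 2 <= c * r ^+ 2.
Proof.
move=> z0 q0 r0 c0 h1 h2; have [->|qn0] := eqVneq q 0.
  by rewrite expr0n mulr_ge0 ?sqr_ge0.
have qp : 0 < q ^+ 2 by rewrite exprn_gt0// lt_def qn0.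
rewrite -(ler_pM2l qp); apply: (@le_trans _ _ ((z * r) ^+ 2)).
  by rewrite -expr2 ler_pXn2r// nnegrE ?sqr_ge0 ?mulr_ge0.
have -> : q ^+ 2 * (c * r ^+ 2) = c * q ^+ 2 * r ^+ 2 by ring.
by rewrite exprMn ler_wpM2r ?sqr_ge0.
Qed.

(** For Y = M^* M one has |Y v|^2 = <M Y v, M v> and |M Y v|^2 <= c |Y v|^2. Eliminating |M Y v|
    gives |Y v|^2 <= c |M v|^2, the quadratic form of Y^2 <= c Y. *)
Lemma opnorm_gram_bounds p n (M : 'M[C]_(p, n)) (c : R) : 0 <= c ->
  opnorm (adjmx M *m M) <= c ->
  psdmx (ofR c *: (adjmx M *m M) - (adjmx M *m M) *m (adjmx M *m M)) /\
  mxbnd c (adjmx M *m M).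
Proof.
move=> c0 hc; have hY := l2norm_mul_le c0 hc; set Y := adjmx M *m M in hY *.
have symY : adjmx Y = Y by rewrite adjmxM adjmxK.
have hM v : l2norm (M *m v) ^+ 2 <= c * l2norm v ^+ 2.
  rewrite -(cRe_ofR (l2norm (M *m v) ^+ 2)) -dot_l2norm2 adjmxM -mulmxA [adjmx M *m _]mulmxA -/Y.
  apply: le_trans (cRe_le' _) _; apply: le_trans (cmod_dot_le _ _) _.
  by rewrite mulrC expr2 mulrA ler_wpM2r ?l2norm_ge0.
split.
  move=> u; pose v := adjmx u; have uE : u = adjmx v by rewrite /v adjmxK.
  rewrite uE adjmxK mulmxBr mulmxBl mxE cReD -/Y.
  have -> : adjmx v *m (ofR c *: Y) *m v = ofR c *: (adjmx (M *m v) *m (M *m v)).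
    by rewrite -scalemxAr -scalemxAl adjmxM !mulmxA.
  have -> : adjmx v *m (Y *m Y) *m v = adjmx (Y *m v) *m (Y *m v).
    by rewrite adjmxM symY !mulmxA.
  rewrite [X in X + _]/= mxE cReZ dot_l2norm2 mxE dot_l2norm2 -ofRN !cRe_ofR.
  rewrite subr_ge0; set q := l2norm (Y *m v); set r := l2norm (M *m v).
  apply: (@sqr_le_of_bounds (l2norm (M *m (Y *m v)))); rewrite ?l2norm_ge0//.
    rewrite -(cRe_ofR (q ^+ 2)) -dot_l2norm2.
    have -> : adjmx (Y *m v) *m (Y *m v) = adjmx (M *m (Y *m v)) *m (M *m v).
      by rewrite !adjmxM !mulmxA.
  exact: le_trans (cRe_le' _) (cmod_dot_le _ _).
move=> i j; pose ej : 'cV[C]_n := delta_mx j 0.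
have ej1 : l2norm ej = 1 by exact: l2norm_delta.
have -> : Y i j = (Y *m ej) i 0 by rewrite /ej -colE [RHS]mxE.
by apply: le_trans (cmod_le_l2norm _ _) _; have := hY ej; rewrite ej1 mulr1.
Qed.

End VectorNorms.

Section SpectralGap.
Context {R : realType}.
Local Notation C := R[i].

(** The trace dominates each exp (t a_i), so every eigenvalue lies below [del]. *)
Lemma trexp1_lt_psd n (A : 'M[C]_n) (t del : R) : adjmx A = A -> 0 < t ->
  trexp t 1%:M A < expR (t * del) -> psdmx ((ofR del)%:M - A).
Proof.
move=> hA t0 hlt; have [U [a Ua]] := hermitian_unitary_diag hA.
have [UU UU' AE _] := Ua.
have adel i : a i < del.
  have := le_lt_trans (trexp1_gt_eigen t hA Ua i) hlt.
  by rewrite ltr_expR ltr_pM2l.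
have -> : (ofR del)%:M - A = adjmx U *m diag_mx (\row_i ofR (del - a i)) *m U.
  rewrite AE; have -> : \row_i ofR (del - a i) = const_mx (ofR del) - \row_i ofR (a i) :> 'rV[C]_n.
    by apply/rowP => i; rewrite !mxE ofRB.
  rewrite linearB /= mulmxBr mulmxBl diag_const_mx.
  by rewrite mul_mx_scalar -scalemxAl UU' scalemx1.
move=> u; rewrite !mulmxA -[_ *m U *m adjmx u]mulmxA.
have -> : U *m adjmx u = adjmx (u *m adjmx U) by rewrite adjmxM adjmxK.
rewrite mul_mx_diag mxE cRe_sum; apply: sumr_ge0 => i _.
rewrite mxE adjmxE mulrAC mul_conj [X in _ * X]mxE -ofRM cRe_ofR.
by rewrite mulr_ge0 ?sqr_ge0// subr_ge0 ltW.
Qed.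

Lemma two_sided_gap n (E : 'M[C]_n) (del : R) : adjmx E = E -> 0 <= del ->
  psdmx ((ofR del)%:M - E) -> psdmx ((ofR del)%:M + E) ->
  forall v : 'cV[C]_n, l2norm (E *m v) <= del * l2norm v.
Proof.
move=> hE del0 pm pp v; have [U [a [UU UU' EE _]]] := hermitian_unitary_diag hE.
have rowE (N : 'M[C]_n) i : (row i U *m N *m adjmx (row i U)) 0 0 = (U *m N *m adjmx U) i i.
  rewrite !mxE; apply: eq_bigr => k _; rewrite !mxE; congr (_ * _).
  by apply: eq_bigr => l _; rewrite !mxE.
have aE i : cRe ((U *m E *m adjmx U) i i) = a i.
  rewrite EE !mulmxA UU mul1mx -mulmxA UU mulmx1.
  by rewrite mxE eqxx mulr1n mxE.
have dE i : cRe ((U *m (ofR del)%:M *m adjmx U) i i) = del.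
  by rewrite mul_mx_scalar -scalemxAl UU scalemx1 mxE eqxx mulr1n.
have a1 i : a i <= del.
  have := pm (row i U); rewrite rowE mulmxBr mulmxBl mxE cReD [X in _ + cRe X]mxE cReN.
  by rewrite aE dE subr_ge0.
have a2 i : - del <= a i.
  by have := pp (row i U); rewrite rowE mulmxDr mulmxDl mxE cReD aE dE; lra.
have normU (w : 'cV[C]_n) : l2norm (adjmx U *m w) ^+ 2 = l2norm w ^+ 2.
  apply: ofR_inj; rewrite -!dot_l2norm2 adjmxM adjmxK.
  by rewrite -mulmxA [U *m _]mulmxA UU mul1mx.
have normU' : l2norm (U *m v) ^+ 2 = l2norm v ^+ 2.
  apply: ofR_inj; rewrite -!dot_l2norm2 adjmxM.
  by rewrite -mulmxA [adjmx U *m _]mulmxA UU' mul1mx.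
rewrite -(@ler_pXn2r _ 2)// ?nnegrE ?mulr_ge0 ?l2norm_ge0//.
rewrite exprMn -normU' EE -!mulmxA normU !l2norm2 mulr_sumr.
apply: ler_sum => i _; rewrite mul_diag_mx [X in cmod X]mxE [X in X * _]mxE.
rewrite cmodM cmod_ofR exprMn real_normK ?num_real// ler_wpM2r ?sqr_ge0//.
rewrite -subr_ge0 subr_sqr mulr_ge0//; have := a1 i; have := a2 i; lra.
Qed.

End SpectralGap.

Section IndicatorExpectation.
Context {R : realType} {d : measure_display} {T : measurableType d}.
Variable P : probability T R.

Lemma bmeas_indic (A : set T) : measurable A -> bmeas (\1_A : T -> R).
Proof.
move=> mA; split; first exact: measurable_indic.
by exists 1 => w; rewrite indicE; case: (w \in A); rewrite ?normr1 ?normr0.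
Qed.

Lemma Ex_indic (A : set T) : measurable A -> P A = (Ex P (\1_A : T -> R))%:E.
Proof. by move=> mA; rewrite -ExE ?integral_indic ?setIT//; exact: bmeas_indic. Qed.

Lemma Ex_markov (f : T -> R) (c : R) : 0 < c -> bmeas f -> (forall w, 0 <= f w) ->
  (P [set w | (c <= f w)%R] <= (Ex P f / c)%:E)%E.
Proof.
move=> c0 hf f0; have [mf _] := hf.
have mA : measurable [set w | c <= f w].
  by have := measurable_fun_le measurableT (measurable_cst c) mf; rewrite setTI.
rewrite Ex_indic// lee_fin mulrC -ExZ//; apply: Ex_le; [exact: bmeas_indic|exact: bmeasZ|].
move=> w; rewrite indicE; have [/set_mem/= h|_] := boolP (w \in _).
  by rewrite mulrC ler_pdivlMr// mul1r.
by rewrite mulr_ge0// invr_ge0 ltW.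
Qed.

Lemma prob_ge_ae_eq (f g : T -> R) (c : R) : measurable_fun setT f ->
  measurable_fun setT g -> {ae P, forall w, f w = g w} ->
  P [set w | c <= f w] = P [set w | c <= g w].
Proof.
move=> mf mg fg.
have mset (h : T -> R) : measurable_fun setT h -> measurable [set w | c <= h w].
  by move=> mh; have := measurable_fun_le measurableT (measurable_cst c) mh; rewrite setTI.
rewrite (Ex_indic (mset _ mf)) (Ex_indic (mset _ mg)); congr EFin.
apply: Ex_ae_eq; [exact: measurable_indic (mset _ mf)|exact: measurable_indic (mset _ mg)|].
apply: filterS fg => w fgw; rewrite !indicE; congr (_%:R); congr nat_of_bool.
by apply/idP/idP => /set_mem/= h; apply/mem_set => /=; rewrite ?fgw// -fgw.
Qed.

Lemma measurable_all (I : Type) (s : seq I) (b : I -> T -> bool) :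
  (forall i, measurable_fun setT (b i)) -> measurable_fun setT (fun w => all (b^~ w) s).
Proof.
move=> hb; elim: s => [|i s IH] /=; first exact: measurable_cst.
exact: measurable_and.
Qed.

Lemma cmeas_if (b : T -> bool) (f g : T -> R[i]) : measurable_fun setT b ->
  cmeas f -> cmeas g -> cmeas (fun w => if b w then f w else g w).
Proof.
move=> mb [f1 f2] [g1 g2]; split.
  rewrite (_ : (fun w => _) = fun w => if b w then cRe (f w) else cRe (g w)).
    exact: measurable_fun_ifT.
  by apply/funext => w; case: (b w).
rewrite (_ : (fun w => _) = fun w => if b w then cIm (f w) else cIm (g w)).
  exact: measurable_fun_ifT.
by apply/funext => w; case: (b w).
Qed.

Definition mxbndb {n} (c : R) (M : 'M[R[i]]_n) : bool :=
  all (fun i => all (fun j => cmod (M i j) ^+ 2 <= c ^+ 2) (enum 'I_n)) (enum 'I_n).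

Lemma mxbndbP n (c : R) (M : 'M[R[i]]_n) : 0 <= c -> reflect (mxbnd c M) (mxbndb c M).
Proof.
move=> c0; apply: (iffP allP) => [h i j|h i _].
  have /allP/(_ j) := h i (mem_enum _ _); rewrite mem_enum => /(_ isT).
  by rewrite ler_pXn2r// nnegrE cmod_ge0.
by apply/allP => j _; rewrite ler_pXn2r// ?nnegrE ?cmod_ge0.
Qed.

(* The blocks are bounded only almost surely; truncation makes the bound hold everywhere. *)
Definition mxtrunc {n} (c : R) (M : 'M[R[i]]_n) : 'M[R[i]]_n :=
  if mxbndb c M then M else 0.

Lemma bherm_trunc n (c : R) (M : T -> 'M[R[i]]_n) : 0 <= c -> mxmeas M ->
  (forall w, adjmx (M w) = M w) -> bherm (fun w => mxtrunc c (M w)).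
Proof.
move=> c0 mM sM; split.
- move=> i j.
  rewrite (_ : (fun w => _) = fun w => if mxbndb c (M w) then M w i j else 0).
    apply: cmeas_if => //.
    apply: measurable_all => k; apply: measurable_all => l.
    by apply: measurable_fun_ler; [exact: cmeas_cmod2|exact: measurable_cst].
  by apply/funext => w; rewrite /mxtrunc; case: ifP => // _; rewrite mxE.
- by move=> w; rewrite /mxtrunc; case: ifP => // _; exact: adjmx0.
- exists c => // w i j; rewrite /mxtrunc; case: ifPn => [/(mxbndbP _ c0)//|_].
  by rewrite mxE cmod0.
Qed.
End IndicatorExpectation.

(** Here t L = del / 4 <= 3/20, so 1 - t L >= 17/20, and (121/100) (1/16) (20/17) - 1/4 is just
    below - 4/25. *)
Lemma chernoff_exponent {R : realType} (del L : R) (t := del / (4 * L)) :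
  0 < L -> 0 < del -> del <= 3 / 5 ->
  121 / 100 * (t ^+ 2 * L / (1 - t * L)) - t * del <= - (4 / 25 * (del ^+ 2 / L)).
Proof.
move=> L0 d0 d1.
have tL : t * L = del / 4 by rewrite /t; field; rewrite gt_eqF.
have t2 : t ^+ 2 * L = del ^+ 2 / L / 16 by rewrite /t; field; rewrite gt_eqF.
have td : t * del = del ^+ 2 / L / 4 by rewrite /t; field; rewrite gt_eqF.
rewrite tL t2 td; have q0 : 0 <= del ^+ 2 / L by rewrite divr_ge0 ?sqr_ge0 ?ltW.
move: (del ^+ 2 / L) q0 => q q0.
have : q / 16 / (1 - del / 4) <= q / 16 / (17 / 20).
  apply: ler_wpM2l; first by rewrite divr_ge0.
  by rewrite lef_pV2 ?posrE; lra.
lra.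
Qed.

Section ChernoffTail.
Context {R : realType} {disp : measure_display} {Omega : measurableType disp}.
Variable P : probability Omega R.
Local Notation C := R[i].
Variables (m n : nat) (g : 'I_m -> set (set Omega)) (Y : 'I_m -> Omega -> 'M[C]_n).
Variable L : R.
Hypothesis gm : forall k, g k `<=` measurable.
Hypothesis indep : mutually_indep P [set: 'I_m]%SET (fun k => <<s g k >>).
Hypothesis mY : forall k, mxmeas (Y k : g_sigma_algebraType (g k) -> 'M[C]_n).
Hypothesis symY : forall k w, adjmx (Y k w) = Y k w.
Hypothesis L0 : 0 < L.
Hypothesis Ybound : {ae P, forall w, forall k,
  psdmx (ofR L *: Y k w - Y k w *m Y k w) /\ mxbnd L (Y k w)}.
Hypothesis EY : \sum_k Exmx P (Y k) = 1%:M.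

Lemma chernoff_tail (s del : R) : s = 1 \/ s = -1 -> 0 < del -> del <= 3 / 5 ->
  let X w := ofR s *: (\sum_k Y k w - 1%:M) in
  let t := del / (4 * L) in
  measurable [set w | expR (t * del) <= trexp t 1%:M (X w)] /\
  (P [set w | (expR (t * del) <= trexp t 1%:M (X w))%R]
     <= (n%:R * expR (- (4 / 25 * (del ^+ 2 / L))))%:E)%E.
Proof.
move=> s1 d0 d1 X t; have L0' := ltW L0.
pose Yt k w := mxtrunc L (Y k w).
have hYt k : bherm (Yt k : g_sigma_algebraType (g k) -> 'M[C]_n).
  by apply: bherm_trunc => //; exact: mY.
have hYt' k : bherm (Yt k) by exact: bherm_sub_sigma (@gm k) (hYt k).
have YtE : {ae P, forall w, forall k, Yt k w = Y k w}.
  apply: filterS Ybound => w h k; rewrite /Yt /mxtrunc.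
  by have [_ /(mxbndbP _ L0') ->] := h k.
have mid k : measurable_fun setT (id : Omega -> g_sigma_algebraType (g k)).
  move=> _ A mA; rewrite setTI preimage_id.
  by apply: smallest_sub (@gm k) A mA; exact: sigma_algebra_measurable.
have mY' k : mxmeas (Y k : Omega -> 'M[C]_n) by exact: (mxmeas_comp (mid k) (mY k)).
have Y2L k : {ae P, forall w, psdmx (ofR L *: Yt k w - Yt k w *m Yt k w)}.
  apply: filterS2 YtE Ybound => w e h; rewrite e; by have [] := h k.
have EYt : \sum_k Exmx P (Yt k) = 1%:M.
  rewrite -EY; apply: eq_bigr => k _; apply/matrixP => i j; rewrite !mxE.
  have [[mt _ _] [mu1 mu2]] := (hYt' k, mY' k i j).
  have [mt1 mt2] := mt i j.
  congr Complex; apply: Ex_ae_eq => //; apply: filterS YtE => w -> //.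
pose Xt w := ofR s *: (\sum_k Yt k w - 1%:M).
have hXt : bherm Xt.
  apply/bhermZ/bhermB; last by apply: bherm_cst; exact: adjmx1.
  by apply: bherm_sum => k; exact: hYt'.
have symX w : adjmx (X w) = X w.
  rewrite /X adjmxZ adjmxB adjmx1 adjmx_sum; congr (_ *: (_ - _)).
  by apply: eq_bigr => k _; exact: symY.
have mX : mxmeas X.
  apply: mxmeasZ; first exact: cmeas_cst.
  apply: mxmeasB; last exact: mxmeas_cst.
  by apply: mxmeas_sum => k _; exact: mY'.
have t0 : 0 < t by rewrite /t divr_gt0// mulr_gt0.
have tL : t * L < 1.
  have -> : t * L = del / 4 by rewrite /t; field; rewrite gt_eqF.
  lra.
have mtX : measurable_fun setT (fun w => trexp t 1%:M (X w)).
  by apply: measurable_trexp => //; exact: mxmeas_cst.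
have hb : bmeas (fun w => trexp t 1%:M (Xt w)).
  by apply: bmeas_trexp => //; apply: bherm_cst; exact: adjmx1.
have mset (f : Omega -> R) : measurable_fun setT f -> measurable [set w | expR (t * del) <= f w].
  by move=> mf; have := measurable_fun_le measurableT (measurable_cst (expR (t * del))) mf; rewrite setTI.
split; first exact: mset.
(* The event concerns the true sum; its probability is that of the truncated one, to which Markov's
   inequality and [mgf_bound] apply. *)
rewrite (prob_ge_ae_eq (P := P) (expR (t * del)) mtX hb.1); last first.
  apply: filterS YtE => w e; congr (trexp t _ _).
  by rewrite /Xt /X; congr (_ *: (_ - _)); apply: eq_bigr => k _; rewrite e.
apply: le_trans (Ex_markov P (expR_gt0 _) hb _) _.
  move=> w; apply: trexp_psd_ge0; first by have [_ + _] := hXt; apply.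
  by rewrite -[1%:M](mulmx1) -[X in _ *m X]adjmx1; exact: psdmx_mul_adj.
rewrite lee_fin ler_pdivrMr ?expR_gt0//.
apply: le_trans (mgf_bound gm indep hYt L0 Y2L EYt s1 (ltW t0) tL) _.
rewrite -[X in _ <= X]mulrA -expRD ler_wpM2l// ler_expR.
by rewrite -lerBlDr; exact: chernoff_exponent.
Qed.
End ChernoffTail.

(** * Hoeffding bound for random signs *)

Section HyperbolicCosine.
Context {R : realType}.
Implicit Types x y p : R.

(** cosh (l |W|) serves as exponential moment of the modulus of a complex sum, so real and imaginary
    parts are never separated. *)
Definition coshR x : R := (expR x + expR (- x)) / 2.
(** Partial sums of the power series of cosh (sqrt u), whose coefficients are nonnegative. *)
Definition cosh_sqrt_series (N : nat) (u : R) : R := \sum_(0 <= k < N) u ^+ k / (k.*2)`!%:R.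

Lemma coshR_gt0 x : 0 < coshR x.
Proof. by rewrite /coshR divr_gt0// addr_gt0// expR_gt0. Qed.

Lemma coshR0 : coshR 0 = 1.
Proof. by rewrite /coshR oppr0 expR0; lra. Qed.

Lemma expR_le_2coshR x : expR x <= 2 * coshR x.
Proof. by rewrite /coshR mulrC divfK// lerDl expR_ge0. Qed.

Lemma coshRD_le x y : 0 <= y -> coshR (x + y) <= expR y * coshR x.
Proof.
move=> y0; rewrite /coshR mulrA ler_pM2r ?invr_gt0// opprD !expRD mulrDr.
apply: lerD; first by rewrite mulrC.
by rewrite mulrC ler_wpM2r ?expR_ge0// ler_expR; lra.
Qed.

Lemma ler_coshR x y : 0 <= x -> x <= y -> coshR x <= coshR y.
Proof.
move=> x0 xy; rewrite /coshR ler_pM2r ?invr_gt0//.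
rewrite !expRN; have ex : 1 <= expR x by rewrite -expR0 ler_expR.
have exy : expR x <= expR y by rewrite ler_expR.
move: (expR x) (expR y) ex exy => a b a1 ab.
have a0 : 0 < a by lra.
have b0 : 0 < b by lra.
rewrite -subr_ge0.
have -> : b + b^-1 - (a + a^-1) = (b - a) * (a * b - 1) / (a * b).
  by field; rewrite !gt_eqF.
have ab1 : 1 <= a * b by apply: mulr_ege1 => //; lra.
by apply: divr_ge0; [apply: mulr_ge0; rewrite subr_ge0|apply: mulr_ge0; exact: ltW].
Qed.

Lemma coshRD_coshRB x y : coshR (x + y) + coshR (x - y) = 2 * (coshR x * coshR y).
Proof. by rewrite /coshR !opprD opprK !expRD; field. Qed.

Lemma cosh_sqrt_series_exp N x :
  cosh_sqrt_series N (x ^+ 2) =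
  (series (exp_coeff x) N.*2 + series (exp_coeff (- x)) N.*2) / 2.
Proof.
elim: N => [|N IH]; first by rewrite /cosh_sqrt_series /series /= !big_geq// addr0 mul0r.
rewrite /cosh_sqrt_series big_nat_recr//= -/(cosh_sqrt_series N _) IH.
rewrite doubleS /series /= !big_nat_recr//= /exp_coeff /=.
have -> : (x ^+ 2) ^+ N = x ^+ N.*2 by rewrite -exprM mul2n.
have -> : (- x) ^+ N.*2 = x ^+ N.*2 by rewrite exprNn -signr_odd odd_double mul1r.
have -> : (- x) ^+ N.*2.+1 = - x ^+ N.*2.+1.
  by rewrite exprNn -signr_odd /= odd_double mulN1r.
rewrite mulNr; move: (x ^+ N.*2 / _) (x ^+ N.*2.+1 / _) (\sum_(0 <= k < _) _).
by move=> p q A; move: (\sum_(0 <= k < _) _) => B; lra.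
Qed.

Lemma cosh_sqrt_series_cvg x : (fun N => cosh_sqrt_series N (x ^+ 2)) @ \oo --> coshR x.
Proof.
rewrite (_ : (fun N => _) = fun N =>
  (series (exp_coeff x) N.*2 + series (exp_coeff (- x)) N.*2) / 2); last first.
  by apply/funext => N; exact: cosh_sqrt_series_exp.
have dbl : (fun N : nat => N.*2) @ \oo --> \oo.
  apply/cvgnyPge => A; near=> N; rewrite -addnn; apply: leq_trans (leq_addl _ _).
  by near: N; exact: nbhs_infty_ge.
have c y : (fun N : nat => series (exp_coeff y) N.*2) @ \oo --> expR y.
  exact: (cvg_comp _ _ dbl (is_cvg_series_exp_coeff y)).
by apply: cvgMl; apply: cvgD; exact: c.
Unshelve. all: by end_near. Qed.

(** Only the sums are wanted. The differences are carried along because each exponent step mixes the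
    two: the new sum is p times the sum plus x times the difference, and likewise with roles
    exchanged. *)
Lemma binomial_monotone p x y k : 0 <= p -> 0 <= x -> x <= y -> y <= p ->
  [/\ (p + x) ^+ k + (p - x) ^+ k <= (p + y) ^+ k + (p - y) ^+ k,
      (p + x) ^+ k - (p - x) ^+ k <= (p + y) ^+ k - (p - y) ^+ k,
      0 <= (p + x) ^+ k + (p - x) ^+ k & 0 <= (p + x) ^+ k - (p - x) ^+ k].
Proof.
move=> p0 x0 xy yp; elim: k => [|k [h1 h2 h3 h4]]; first by split; rewrite !expr0; lra.
rewrite !exprS; move: ((p + x) ^+ k) ((p - x) ^+ k) ((p + y) ^+ k) ((p - y) ^+ k) h1 h2 h3 h4.
move=> a b c d h1 h2 h3 h4.
have e1 : p * (a + b) <= p * (c + d) by rewrite ler_wpM2l.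
have e2 : x * (a - b) <= y * (c - d) by rewrite ler_pM.
have e3 : p * (a - b) <= p * (c - d) by rewrite ler_wpM2l.
have e4 : x * (a + b) <= y * (c + d) by rewrite ler_pM.
have e5 : 0 <= p * (a + b) by rewrite mulr_ge0.
have e6 : 0 <= x * (a - b) by rewrite mulr_ge0.
have e7 : 0 <= p * (a - b) by rewrite mulr_ge0.
have e8 : 0 <= x * (a + b) by rewrite mulr_ge0.
split; lra.
Qed.

(* Convexity of u |-> cosh (sqrt u), read off the power series. *)
Lemma coshR_spread p x y r q a b : 0 <= p -> 0 <= x -> x <= y -> y <= p ->
  r ^+ 2 = p + x -> q ^+ 2 = p - x -> a ^+ 2 = p + y -> b ^+ 2 = p - y ->
  coshR r + coshR q <= coshR a + coshR b.
Proof.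
move=> p0 x0 xy yp hr hq ha hb.
have c := fun u => cosh_sqrt_series_cvg u.
apply: (ler_cvg_to (cvgD (c r) (c q)) (cvgD (c a) (c b))).
near=> N.
rewrite -[X in X <= _]/(cosh_sqrt_series N (r ^+ 2) + cosh_sqrt_series N (q ^+ 2)).
rewrite -[X in _ <= X]/(cosh_sqrt_series N (a ^+ 2) + cosh_sqrt_series N (b ^+ 2)).
rewrite hr hq ha hb /cosh_sqrt_series -!big_split /=.
apply: ler_sum => k _; rewrite -!mulrDl ler_wpM2r ?invr_ge0//.
by have [] := binomial_monotone k p0 x0 xy yp.
Unshelve. all: by end_near. Qed.

Lemma fact_double_ge k : (2 ^ k * k`! <= (k.*2)`!)%N.
Proof.
elim: k => // k IH; rewrite doubleS !factS expnS.
have -> : (2 * 2 ^ k * (k.+1 * k`!) = (k.*2.+2) * (2 ^ k * k`!))%N.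
  by rewrite -doubleS -muln2; lia.
rewrite leq_mul2l /=; apply: leq_trans IH _; exact: leq_pmull.
Qed.

(** Termwise comparison of the two series, by 2^k k! <= (2k)!. *)
Lemma coshR_le_expR x : coshR x <= expR (x ^+ 2 / 2).
Proof.
apply: (ler_cvg_to (@cosh_sqrt_series_cvg x) (@is_cvg_series_exp_coeff R (x ^+ 2 / 2))).
near=> N; apply: ler_sum => k _; rewrite /exp_coeff /= expr_div_n -mulrA.
apply: ler_wpM2l; first by rewrite exprn_ge0// sqr_ge0.
have f0 : 0 < (k.*2)`!%:R :> R by rewrite ltr0n fact_gt0.
have g0 : 0 < 2 ^+ k * k`!%:R :> R by rewrite mulr_gt0 ?exprn_gt0// ltr0n fact_gt0.
rewrite -invfM lef_pV2 ?posrE//.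
by rewrite -natrX -natrM ler_nat fact_double_ge.
Unshelve. all: by end_near. Qed.
End HyperbolicCosine.

Section CoshModulus.
Context {R : realType}.
Local Notation C := R[i].

(** l^2 |z + w|^2 and l^2 |z - w|^2 are p + c and p - c with |c| <= y, where p + y and p - y are the
    values for collinear vectors. By convexity the collinear case is the worst, and there the
    addition formula gives the product. *)
Lemma coshR_parallelogram (l : R) (z w : C) :
  coshR (l * cmod (z + w)) + coshR (l * cmod (z - w)) <=
  2 * (coshR (l * cmod z) * coshR (l * cmod w)).
Proof.
rewrite -coshRD_coshRB.
pose p := l ^+ 2 * (cmod z ^+ 2 + cmod w ^+ 2).
pose c := 2 * l ^+ 2 * cRe (Num.conj z * w).
pose y := 2 * l ^+ 2 * (cmod z * cmod w).
have z0 := cmod_ge0 z; have w0 := cmod_ge0 w; have l2 := sqr_ge0 l.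
have p0 : 0 <= p by rewrite mulr_ge0// addr_ge0// sqr_ge0.
have cy : `|c| <= y.
  have k0 : 0 <= 2 * l ^+ 2 by rewrite mulr_ge0.
  rewrite /c /y normrM (ger0_norm k0) ler_wpM2l//.
  by apply: le_trans (cRe_le _) _; rewrite cmodM cmodC.
have yp : y <= p.
  rewrite -subr_ge0 (_ : p - y = l ^+ 2 * (cmod z - cmod w) ^+ 2); last by rewrite /p /y; ring.
  by rewrite mulr_ge0// sqr_ge0.
have e1 : (l * cmod (z + w)) ^+ 2 = p + c.
  by rewrite exprMn /p /c !cmod2 !cE; ring.
have e2 : (l * cmod (z - w)) ^+ 2 = p - c.
  by rewrite exprMn /p /c !cmod2 !cE; ring.
have e3 : (l * cmod z + l * cmod w) ^+ 2 = p + y by rewrite /p /y; ring.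
have e4 : (l * cmod z - l * cmod w) ^+ 2 = p - y by rewrite /p /y; ring.
have [c0|/ltW c0] := leP 0 c.
  by apply: (coshR_spread p0 c0 _ yp) => //; rewrite -(ger0_norm c0).
have nc0 : 0 <= - c by rewrite oppr_ge0.
rewrite [X in X <= _]addrC.
apply: (coshR_spread p0 nc0 _ yp) => //; first by rewrite -(ler0_norm c0).
by rewrite opprK.
Qed.
End CoshModulus.

Section MeasurableModulus.
Context {R : realType} {d : measure_display} {T : measurableType d}.

Lemma measurable_cmod (f : T -> R[i]) : cmeas f -> measurable_fun setT (fun w => cmod (f w)).
Proof.
move=> [f1 f2].
have ms : measurable_fun setT (Num.sqrt : R -> R).
  exact: continuous_measurable_fun (@sqrt_continuous R).
have mg : measurable_fun setT (fun w => cRe (f w) ^+ 2 + cIm (f w) ^+ 2).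
  by apply: measurable_funD; exact: measurable_funX.
exact: (measurableT_comp ms mg).
Qed.

Lemma bmeas_cosh_cmod (l K : R) (f : T -> R[i]) : 0 <= l -> cmeas f ->
  (forall w, cmod (f w) <= K) -> bmeas (fun w => coshR (l * cmod (f w))).
Proof.
move=> l0 mf hK; split.
  have me : measurable_fun setT (@expR R).
    exact: continuous_measurable_fun (@continuous_expR R).
  have ml : measurable_fun setT (fun w => l * cmod (f w)).
    by apply: measurable_funM; [exact: measurable_cst|exact: measurable_cmod].
  apply: measurable_funM; last exact: measurable_cst.
  apply: measurable_funD; apply: (measurableT_comp me) => //.
  exact: (measurable_funN ml).
exists (coshR (l * K)) => w; rewrite ger0_norm ?(ltW (coshR_gt0 _))//.
by apply: ler_coshR; [rewrite mulr_ge0 ?cmod_ge0|rewrite ler_wpM2l].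
Qed.
End MeasurableModulus.

Section ApproximatelySymmetric.
Context {R : realType} {d : measure_display} {Omega : measurableType d}.
Variable P : probability Omega R.
Local Notation C := R[i].

(* The law of X is within h, for every h, of a uniform law on finitely many pairs of
   antipodal points; this covers Rademacher and Steinhaus variables at once. *)
Definition approx_symmetric (X : Omega -> C) : Prop := forall h : R, 0 < h ->
  exists (K : nat) (zeta : 'I_K -> C) (A B : 'I_K -> set Omega),
  [/\ (0 < K)%N,
      forall j, [/\ measurable (A j), measurable (B j),
        P (A j) = ((2 * K%:R)^-1)%:E & P (B j) = ((2 * K%:R)^-1)%:E],
      forall j w, (A j w -> cmod (X w - zeta j) <= h) /\ (B j w -> cmod (X w + zeta j) <= h),
      forall j, cmod (zeta j) = 1 &
      {ae P, forall w, exists j, A j w \/ B j w}].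

Lemma coshR_cmod_perturb (l h : R) (W v z u : C) : 0 <= l -> cmod (u - z) <= h ->
  coshR (l * cmod (W + v * u)) <= expR (l * cmod v * h) * coshR (l * cmod (W + v * z)).
Proof.
move=> l0 uz; have h0 := le_trans (cmod_ge0 _) uz.
apply: le_trans (coshRD_le _ _); last by rewrite !mulr_ge0 ?cmod_ge0.
apply: ler_coshR; first by rewrite mulr_ge0 ?cmod_ge0.
rewrite -mulrA -mulrDr ler_wpM2l//.
have -> : W + v * u = (W + v * z) + v * (u - z) by ring.
apply: le_trans (ler_cmodD _ _) _; rewrite lerD2l cmodM ler_wpM2l ?cmod_ge0//.
Qed.

(** Replacing [X] by the nearby point of its antipodal pair costs exp (l |v| h); averaging over each
    pair uses the parallelogram inequality. Then h tends to 0. *)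
Lemma Ex_cosh_approx_symmetric (X : Omega -> C) (l : R) (W v : C) : 0 <= l ->
  cmeas X -> (forall w, cmod (X w) <= 1) -> approx_symmetric X ->
  Ex P (fun w => coshR (l * cmod (W + v * X w))) <= coshR (l * cmod W) * coshR (l * cmod v).
Proof.
move=> l0 mX X1 sX; set E := Ex _ _; set Y := _ * _.
have Y0 : 0 < Y by rewrite mulr_gt0 ?coshR_gt0.
have hbm : bmeas (fun w => coshR (l * cmod (W + v * X w))).
  apply: (@bmeas_cosh_cmod _ _ _ l (cmod W + cmod v)) => //.
    by apply: cmeasD; [exact: cmeas_cst|apply: cmeasM => //; exact: cmeas_cst].
  move=> w; apply: le_trans (ler_cmodD _ _) _; rewrite lerD2l cmodM.
  by rewrite -[X in _ <= X]mulr1 ler_wpM2l ?cmod_ge0.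
pose c := l * cmod v; have c0 : 0 <= c by rewrite mulr_ge0 ?cmod_ge0.
have step h : 0 < h -> E <= expR (c * h) * Y.
  move=> h0; have [K [zeta [A [B [K0 mAB hAB z1 cov]]]]] := sX h h0.
  have hA j w : A j w -> cmod (X w - zeta j) <= h by have [] := hAB j w.
  have hB j w : B j w -> cmod (X w + zeta j) <= h by have [] := hAB j w.
  pose G z := expR (c * h) * coshR (l * cmod (W + v * z)).
  have G0 z : 0 <= G z by rewrite mulr_ge0 ?expR_ge0// ltW ?coshR_gt0.
  have bA j : bmeas (\1_(A j) : Omega -> R) by have [mA _ _ _] := mAB j; exact: bmeas_indic.
  have bB j : bmeas (\1_(B j) : Omega -> R) by have [_ mB _ _] := mAB j; exact: bmeas_indic.
  have bt j : bmeas (fun w => G (zeta j) * \1_(A j) w + G (- zeta j) * \1_(B j) w).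
    by apply: bmeasD; apply: bmeasZ.
  have EE : E <= Ex P (fun w => \sum_j (G (zeta j) * \1_(A j) w + G (- zeta j) * \1_(B j) w)).
    apply: Ex_ae_le; [exact: hbm|exact: bmeas_sum|].
    apply: filterS cov => w [j hj].
    have t0 i : 0 <= G (zeta i) * \1_(A i) w + G (- zeta i) * \1_(B i) w.
      by rewrite addr_ge0// mulr_ge0.
    rewrite (bigD1 j)//=; apply: (@le_trans _ _ (G (zeta j) * \1_(A j) w + G (- zeta j) * \1_(B j) w)).
      case: hj => [Aj|Bj].
        apply: (@le_trans _ _ (G (zeta j))); first exact: coshR_cmod_perturb (hA _ _ Aj).
        by rewrite [\1_(A j) w]indicE mem_set//= mulr1 lerDl mulr_ge0.
      apply: (@le_trans _ _ (G (- zeta j))).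
        by apply: coshR_cmod_perturb => //; rewrite opprK; exact: hB.
      by rewrite [\1_(B j) w]indicE mem_set//= mulr1 lerDr mulr_ge0.
    by rewrite lerDl sumr_ge0.
  apply: le_trans EE _; rewrite Ex_sum//.
  have k0 : 0 < K%:R :> R by rewrite ltr0n.
  apply: (@le_trans _ _ (\sum_(j < K) (expR (c * h) * Y / K%:R))).
    apply: ler_sum => j _; rewrite ExD; [|exact: bmeasZ|exact: bmeasZ].
    rewrite !ExZ//; have [mA mB pA pB] := mAB j.
    move: pA pB; rewrite (Ex_indic P mA) (Ex_indic P mB) => -[->] [->].
    rewrite -mulrDl.
    have -> : expR (c * h) * Y / K%:R = expR (c * h) * (2 * Y) * (2 * K%:R)^-1.
      by field; rewrite gt_eqF.
    apply: ler_wpM2r; first by rewrite invr_ge0 mulr_ge0// ltW.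
    rewrite /G -mulrDr; apply: ler_wpM2l; first exact: expR_ge0.
    have := coshR_parallelogram l W (v * zeta j).
    by rewrite cmodM z1 mulr1 mulrN.
  by rewrite sumr_const card_ord -[X in X <= _]mulr_natr divfK// gt_eqF.
(* If E > Y, then h = ln (E / Y) / (2 c + 1) has c h < ln (E / Y) and contradicts [step]. The
   summand 1 covers c = 0. *)
have [//|YE] := leP E Y.
have E0 : 0 < E by exact: lt_trans YE.
have u0 : 0 < ln (E / Y) by rewrite ln_gt0// ltr_pdivlMr// mul1r.
have c1 : 0 < 2 * c + 1 by lra.
have := step (ln (E / Y) / (2 * c + 1)) (divr_gt0 u0 c1).
rewrite -ler_pdivrMr// -{1}[E / Y]lnK ?posrE ?divr_gt0// ler_expR mulrA ler_pdivlMr//.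
have : 0 <= c * ln (E / Y) by rewrite mulr_ge0// ltW.
lra.
Qed.
End ApproximatelySymmetric.

Section CoordinateSigma.
Context {R : realType} {d : measure_display} {Omega : measurableType d}.

(** The generator inside [sigma_gen], isolated so that [Omega] can be given the sub-sigma-algebra
    through [g_sigma_algebraType]. *)
Definition coordgen {I : Type} (X : I -> Omega -> R) : set (set Omega) :=
  \bigcup_(i in [set: I]) preimage_set_system setT (X i) measurable.

Lemma coordgen_measurable I (X : I -> Omega -> R) :
  (forall i, measurable_fun setT (X i)) -> coordgen X `<=` measurable.
Proof. by move=> mX _ [i _ [B mB <-]]; exact: mX. Qed.

Lemma measurable_coordgen I (X : I -> Omega -> R) i :
  measurable_fun setT (X i : g_sigma_algebraType (coordgen X) -> R).
Proof. by move=> _ B mB; apply: sub_sigma_algebra; exists i => //; exists B. Qed.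

Lemma measurable_id_sub (G H : set (set Omega)) : G `<=` <<s H >> ->
  measurable_fun setT (id : g_sigma_algebraType H -> g_sigma_algebraType G).
Proof.
move=> GH _ A mA; rewrite setTI preimage_id.
by apply: smallest_sub GH A mA; exact: smallest_sigma_algebra.
Qed.

Lemma measurable_id_sigma (G : set (set Omega)) : G `<=` measurable ->
  measurable_fun setT (id : Omega -> g_sigma_algebraType G).
Proof.
move=> Gm _ A mA; rewrite setTI preimage_id.
by apply: smallest_sub Gm A mA; exact: sigma_algebra_measurable.
Qed.
End CoordinateSigma.

Section SignSums.
Context {R : realType} {d : measure_display} {Omega : measurableType d}.
Variable P : probability Omega R.
Local Notation C := R[i].
Context {I : finType} (S : {set I}) (sg : I -> Omega -> C).
Hypothesis msg : forall i, cmeas (sg i).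
Hypothesis sg1 : forall i w, cmod (sg i w) <= 1.
Hypothesis indep : mutually_indep P S (fun i => sigma_gen (ccoords (sg i))).
Hypothesis sym : forall i, i \in S -> approx_symmetric P (sg i).

Let g i := coordgen (ccoords (sg i)).
Let gm i : g i `<=` measurable.
Proof. by apply: coordgen_measurable => b; have [? ?] := msg i; case: b. Qed.

Lemma cmeas_ccoords i : cmeas (sg i : g_sigma_algebraType (coordgen (ccoords (sg i))) -> C).
Proof.
have h b := @measurable_coordgen _ _ _ _ (ccoords (sg i)) b.
by split; [exact: (h true)|exact: (h false)].
Qed.

Lemma cmod_sign_sum_le (K : {set I}) (a : I -> C) w :
  cmod (\sum_(i in K) a i * sg i w) <= \sum_(i in K) cmod (a i).
Proof.
apply: le_trans (ler_cmod_sum _ _ _) _; apply: ler_sum => i _.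
by rewrite cmodM -[X in _ <= X]mulr1 ler_wpM2l ?cmod_ge0.
Qed.

(** Peel off one sign: it is independent of the remaining partial sum [W], and with [W] frozen the
    one-variable bound factors out one cosh. *)
Lemma Ex_cosh_sign_sum (K : {set I}) (a : I -> C) (l : R) : 0 <= l -> K \subset S ->
  Ex P (fun w => coshR (l * cmod (\sum_(i in K) a i * sg i w))) <=
  \prod_(i in K) coshR (l * cmod (a i)).
Proof.
move=> l0; have [N] := ubnP #|K|; elim: N => // N IH in K *.
rewrite ltnS => KN KS; have [->|[k kK]] := set_0Vmem K.
  under eq_fun do rewrite big_set0 cmod0 mulr0 coshR0.
  by rewrite Ex_cst big_set0.
have K'S : K :\ k \subset S by apply: fintype.subset_trans KS; exact: finset.subD1set.
have K'Sk : K :\ k \subset S :\ k by exact: finset.setSD.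
have kS : k \in S by exact: (fintype.subsetP KS).
have {}IH := IH (K :\ k) _ K'S.
have cK' : (#|K :\ k| < N)%N by move: KN; rewrite (cardsD1 k) kK.
have {}IH := IH cK'.
pose W w := \sum_(i in K :\ k) a i * sg i w.
pose H := \bigcup_(i in [set i | i \in K :\ k]) <<s g i >>.
have Hm : H `<=` measurable.
  by move=> B [i _]; apply: smallest_sub (@gm i) B; exact: sigma_algebra_measurable.
have mW : cmeas (W : g_sigma_algebraType H -> C).
  apply: cmeas_sum => i iK; apply: cmeasM; first exact: cmeas_cst.
  apply: (cmeas_comp _ (cmeas_ccoords i)).
  apply: measurable_id_sub => B hB; apply: sub_sigma_algebra; exists i => //.
  exact: sub_sigma_algebra.
have mW' : cmeas W.
  by apply: cmeas_sum => i iK; apply: cmeasM; [exact: cmeas_cst|exact: msg].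
have bW := cmod_sign_sum_le (K :\ k) a.
pose M := \sum_(i in K :\ k) cmod (a i) + cmod (a k).
have hM w w' : cmod (W w' + a k * sg k w) <= M.
  apply: le_trans (ler_cmodD _ _) _; apply: (lerD (bW w')); rewrite cmodM.
  by rewrite -[X in _ <= X]mulr1 ler_wpM2l ?cmod_ge0.
under eq_fun do rewrite (big_setD1 k kK) /= addrC -/(W _).
have hf : bmeas (fun z : g_sigma_algebraType (g k) * g_sigma_algebraType H =>
    coshR (l * cmod (W z.2 + a k * sg k z.1))).
  apply: (bmeas_cosh_cmod (K := M)) => //; apply: cmeasD.
    exact: (cmeas_comp measurable_snd mW).
  apply: cmeasM; first exact: cmeas_cst.
  exact: (cmeas_comp measurable_fst (cmeas_ccoords k)).
have hf' : bmeas (fun z : Omega * Omega => coshR (l * cmod (W z.2 + a k * sg k z.1))).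
  apply: (bmeas_cosh_cmod (K := M)) => //; apply: cmeasD.
    exact: (cmeas_comp measurable_snd mW').
  apply: cmeasM; first exact: cmeas_cst.
  exact: (cmeas_comp measurable_fst (msg k)).
rewrite (@Ex_indep_sigma _ _ _ P (g k) H (@gm k) Hm _ _ hf); last first.
  by move=> A B hA hB; exact: (indep_split gm indep kS K'Sk hA hB).
rewrite (Ex_swap P P hf').
have bWl : bmeas (fun w => coshR (l * cmod (W w))) by exact: (bmeas_cosh_cmod l0 mW' bW).
apply: (@le_trans _ _ (Ex P (fun w => coshR (l * cmod (a k)) * coshR (l * cmod (W w))))).
  apply: Ex_le; [exact: (bmeas_fubini2 P hf')|exact: bmeasZ|move=> w'].
  apply: le_trans (Ex_cosh_approx_symmetric (W w') (a k) l0 (msg k) (sg1 k) (sym kS)) _.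
  by rewrite [X in _ <= X]mulrC.
rewrite (ExZ P _ bWl) (big_setD1 k kK) /=.
by apply: ler_wpM2l IH; exact: ltW (coshR_gt0 _).
Qed.

Lemma sign_sum_tail (a : I -> C) (rho beta : R) : 0 < beta -> 0 <= rho ->
  \sum_(i in S) cmod (a i) ^+ 2 <= beta ^+ 2 ->
  (P [set w | (rho <= cmod (\sum_(i in S) a i * sg i w))%R] <=
    (2 * expR (- (rho ^+ 2 / (2 * beta ^+ 2))))%:E)%E.
Proof.
(* The minimizer of l^2 beta^2 / 2 - l rho. The factor 2 of the tail comes from exp <= 2 cosh. *)
move=> b0 r0 ab; pose l := rho / beta ^+ 2.
have l0 : 0 <= l by rewrite divr_ge0// sqr_ge0.
have mW : cmeas (fun w => \sum_(i in S) a i * sg i w).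
  by apply: cmeas_sum => i iK; apply: cmeasM; [exact: cmeas_cst|exact: msg].
have hb := bmeas_cosh_cmod l0 mW (cmod_sign_sum_le S a).
apply: (@le_trans _ _ (P [set w | (coshR (l * rho) <= coshR (l * cmod (\sum_(i in S) a i * sg i w)))%R])).
  apply: le_measure; rewrite ?inE.
  - have := measurable_fun_le measurableT (measurable_cst rho) (measurable_cmod mW).
    by rewrite setTI.
  - have := measurable_fun_le measurableT (measurable_cst (coshR (l * rho))) hb.1.
    by rewrite setTI.
  - by move=> w /= h; apply: ler_coshR; [rewrite mulr_ge0|rewrite ler_wpM2l].
apply: le_trans (Ex_markov P (coshR_gt0 _) hb _) _.
  by move=> w; exact: ltW (coshR_gt0 _).
rewrite lee_fin ler_pdivrMr ?coshR_gt0//.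
apply: le_trans (Ex_cosh_sign_sum a l0 (fintype.subxx S)) _.
apply: (@le_trans _ _ (expR (l ^+ 2 * beta ^+ 2 / 2))).
  apply: (@le_trans _ _ (\prod_(i in S) expR ((l * cmod (a i)) ^+ 2 / 2))).
    apply: ler_prod => i _; rewrite coshR_le_expR andbT; exact: ltW (coshR_gt0 _).
  rewrite -expR_sum ler_expR -mulr_suml ler_wpM2r ?invr_ge0//.
  under eq_bigr do rewrite exprMn.
  by rewrite -mulr_sumr ler_wpM2l ?sqr_ge0.
apply: (@le_trans _ _ (expR (- (rho ^+ 2 / (2 * beta ^+ 2))) * expR (l * rho))).
  rewrite -expRD ler_expR le_eqVlt; apply/orP; left; apply/eqP.
  by rewrite /l; field; rewrite gt_eqF.
rewrite (_ : forall u v : R, 2 * u * v = u * (2 * v)); last by move=> u v; ring.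
by rewrite ler_wpM2l ?expR_ge0// expR_le_2coshR.
Qed.
End SignSums.

(** * Arcs of the unit circle and the two sign laws *)

Section UnitCircle.
Context {R : realType}.
Local Notation C := R[i].

Definition cis (t : R) : C := Complex (cos t) (sin t).

Lemma cisD (s t : R) : cis (s + t) = cis s * cis t.
Proof. by apply: complexP; rewrite /cis !cE /= ?cosD ?sinD//; ring. Qed.

Lemma cmod_cis t : cmod (cis t) = 1.
Proof. by rewrite /cmod /cRe /cIm /= cos2Dsin2 sqrtr1. Qed.

Lemma cis_pi : cis pi = -1.
Proof. by apply: complexP; rewrite !cE /= ?cospi// sinpi oppr0. Qed.

Lemma conj_cis t : Num.conj (cis t) = cis (- t).
Proof. by apply: complexP; rewrite !cE /= ?cosN// sinN. Qed.

Lemma cis_mul_conj t : cis t * Num.conj (cis t) = 1.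
Proof. by rewrite mul_conj cmod_cis expr1n ofR1. Qed.

Lemma unit_cis_acos (z : C) : cmod z = 1 -> -1 <= cRe z <= 1 /\
  (z = cis (acos (cRe z)) \/ z = cis (- acos (cRe z))).
Proof.
move=> z1; have zz : cRe z ^+ 2 + cIm z ^+ 2 = 1 by rewrite -cmod2 z1 expr1n.
have rz : -1 <= cRe z <= 1 by rewrite -ler_norml -z1 cRe_le.
split => //.
have cz : cos (acos (cRe z)) = cRe z by rewrite acosK ?in_itv.
have sz : sin (acos (cRe z)) = `|cIm z|.
  by rewrite sin_acos// -sqrtr_sqr; congr Num.sqrt; lra.
have [i0|i0] := leP 0 (cIm z).
  by left; apply: complexP; rewrite /cRe /cIm /= -/(cRe z) -/(cIm z) ?cz// sz ger0_norm.
right; apply: complexP; rewrite /cRe /cIm /= -/(cRe z) -/(cIm z) ?cosN ?cz//.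
by rewrite sinN sz ltr0_norm// opprK.
Qed.

Lemma unit_cis (z : C) : cmod z = 1 -> exists2 t : R, 0 <= t <= 2 * pi & z = cis t.
Proof.
move=> z1; have [rz zE] := unit_cis_acos z1.
have a0 := acos_ge0 rz; have a1 := acos_lepi rz; have p0 := pi_ge0 R.
case: zE => zE; first by exists (acos (cRe z)) => //; apply/andP; split=> //; lra.
exists (2 * pi - acos (cRe z)); first by apply/andP; split; lra.
rewrite {1}zE; apply: complexP; rewrite /cis /cRe /cIm /=.
  by rewrite addrC mulr_natl cosD2pi.
by rewrite addrC mulr_natl sinD2pi.
Qed.

Lemma sin_le_id (u : R) : 0 <= u -> sin u <= u.
Proof.
move=> u0; pose f (x : R) := x - sin x.
have df (v : R) : is_derive v (1 : R) f (1 - cos v).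
  by apply: is_derive_eq; rewrite /GRing.scale/=; ring.
have [|c _] := @MVT_segment _ f (fun x => 1 - cos x) _ _ u0 (fun x _ => df x).
  by apply: continuous_subspaceT => v; apply/differentiable_continuous/derivable1_diffP; case: (df v).
rewrite /f sin0 !subr0 => e.
have : 0 <= (1 - cos c) * u by rewrite mulr_ge0// subr_ge0 cos_le1.
lra.
Qed.

Lemma cos_ge_quadratic (u : R) : 0 <= u -> 2 - 2 * cos u <= u ^+ 2.
Proof.
move=> u0; have [u1|u1] := leP u 2; last first.
  (* Beyond 2 the bound is trivial; below it u / 2 lies in [0, pi], where sin is nonnegative and the
     half-angle formula applies. *)
  have := cos_geN1 u; have : 2 * 2 <= u * u by rewrite ler_pM// ltW.
  rewrite expr2; lra.
have h0 : 0 <= u / 2 by lra.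
have s0 : 0 <= sin (u / 2).
  apply: sin_ge0_pi; apply/andP; split => //.
  have := pi_ge2 R; lra.
have : cos u = 1 - 2 * sin (u / 2) ^+ 2.
  have -> : u = u / 2 + u / 2 by lra.
  rewrite cosD -!expr2 cos2sin2 -splitr; ring.
have : sin (u / 2) ^+ 2 <= (u / 2) ^+ 2 by rewrite ler_pXn2r// ?nnegrE// sin_le_id.
move: (sin (u / 2) ^+ 2) => q h ->; lra.
Qed.

Lemma cmod_sub_cis_le (z : C) (c u : R) : cmod z = 1 -> 0 <= u ->
  cos u <= cRe (z * Num.conj (cis c)) -> cmod (z - cis c) <= u.
Proof.
move=> z1 u0 hz; rewrite -(@ler_pXn2r _ 2)// ?nnegrE ?cmod_ge0//.
apply: le_trans (cos_ge_quadratic u0).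
have c1 : cRe (cis c) ^+ 2 + cIm (cis c) ^+ 2 = 1 by rewrite -cmod2 cmod_cis expr1n.
have zz : cRe z ^+ 2 + cIm z ^+ 2 = 1 by rewrite -cmod2 z1 expr1n.
move: hz; rewrite cmod2 !cE => hz; lra.
Qed.

Lemma ler_cos_0pi (x y : R) : 0 <= x <= pi -> 0 <= y <= pi -> (cos x <= cos y) = (y <= x).
Proof. by move=> hx hy; rewrite !leNgt ltr_cos// in_itv. Qed.

(** An arc is the part of the circle in a half-plane. This form is visibly measurable, while the
    existential form is the one in which the Steinhaus law is given. *)
Lemma arc_halfplane (z : C) (c u : R) : cmod z = 1 -> 0 <= u <= pi ->
  (exists2 t : R, c - u <= t <= c + u & z = cis t) <-> cos u <= cRe (z * Num.conj (cis c)).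
Proof.
move=> z1 /andP[u0 upi]; split => [[t /andP[t1 t2] ->]|hz].
  rewrite conj_cis -cisD /cRe /=.
  have -> : cos (t - c) = cos `|t - c| by have [h|h] := ger0P (t - c); rewrite ?cosN.
  have tc : `|t - c| <= u by rewrite ler_norml; apply/andP; split; lra.
  by rewrite ler_cos_0pi ?u0// normr_ge0 (le_trans tc).
have y1 : cmod (z * Num.conj (cis c)) = 1 by rewrite cmodM cmodC cmod_cis z1 mulr1.
have [ry yE] := unit_cis_acos y1; set y := z * _ in hz y1 ry yE.
have zE : z = y * cis c by rewrite /y -mulrA [_ * cis c]mulrC cis_mul_conj mulr1.
have au : acos (cRe y) <= u.
  have a0 := acos_ge0 ry; have a1 := acos_lepi ry.
  by rewrite -ler_cos_0pi ?a0 ?u0// acosK ?in_itv.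
have a0 := acos_ge0 ry.
case: yE => yE.
  exists (acos (cRe y) + c); first by apply/andP; split; lra.
  by rewrite cisD -yE.
exists (- acos (cRe y) + c); first by apply/andP; split; lra.
by rewrite cisD -yE.
Qed.
End UnitCircle.

Section SignLaws.
Context {R : realType} {d : measure_display} {Omega : measurableType d}.
Variable P : probability Omega R.
Local Notation C := R[i].
Variable X : Omega -> C.
Hypothesis mX : cmeas X.

Lemma measurable_level (z : C) : measurable [set w | X w = z].
Proof.
rewrite (_ : [set w | X w = z] = [set w | cRe (X w) = cRe z] `&` [set w | cIm (X w) = cIm z]).
  have [m1 m2] := mX; apply: measurableI.
    by have := m1 measurableT [set cRe z] (measurable_set1 _); rewrite setTI.
  by have := m2 measurableT [set cIm z] (measurable_set1 _); rewrite setTI.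
by apply/seteqP; split => w /=; [move=> ->|move=> [h1 h2]; exact: complexP].
Qed.

Lemma rademacher_approx_symmetric :
  P [set w | X w = 1] = (2^-1)%:E -> P [set w | X w = -1] = (2^-1)%:E ->
  approx_symmetric P X.
Proof.
move=> h1 h2 h h0.
exists 1%N, (fun=> 1), (fun=> [set w | X w = 1]), (fun=> [set w | X w = -1]); split => //.
- by move=> _; split; [exact: measurable_level|exact: measurable_level|rewrite mulr1|rewrite mulr1].
- by move=> _ w; split => /= ->; rewrite ?subrr ?addNr cmod0 ltW.
- by move=> _; exact: cmod1.
- set U := [set w | X w = 1] `|` [set w | X w = -1].
  have mU : measurable U by apply: measurableU; exact: measurable_level.
  have PU : P U = 1%E.
    rewrite /U measureU; [|exact: measurable_level|exact: measurable_level|].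
      by apply: etrans (f_equal2 adde h1 h2) _; rewrite -[LHS]/((2^-1 + 2^-1)%:E); congr EFin; lra.
    apply/seteqP; split => w //= -[-> /(congr1 cRe)]; rewrite !cE => e.
    by have := @ltr01 R; rewrite e ltr0N1.
  exists (~` U); split; first exact: measurableC.
    by rewrite probability_setC// PU subee.
  by move=> w /= hw Uw; apply: hw; exists ord0.
Qed.

Lemma steinhaus_approx_symmetric : (forall w, cmod (X w) = 1) ->
  (forall a b : R, 0 <= a -> a <= b -> b <= 2 * pi ->
     P [set w | exists2 t : R, a <= t <= b & X w = Complex (cos t) (sin t)]
       = ((b - a) / (2 * pi))%:E) ->
  approx_symmetric P X.
Proof.
move=> X1 hP h h0; have p0 : 0 < pi :> R := pi_gt0 R.
(* The circle is cut into 2K closed arcs of half-length u <= h, each of probability 1/(2K). Arc k +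
   K is antipodal to arc k. The arcs may share endpoints, since only a cover is asked for. *)
pose K := (Num.truncn (pi / (2 * h))).+1; pose u := pi / (2 * K%:R) : R.
have K0 : 0 < K%:R :> R by rewrite ltr0n.
have u0 : 0 < u by rewrite divr_gt0// mulr_gt0.
have uh : u <= h.
  have Kb : pi / (2 * h) < K%:R := truncnS_gt _.
  rewrite ltr_pdivrMr ?mulr_gt0// in Kb.
  rewrite /u ler_pdivrMr ?mulr_gt0//; apply: ltW; congr (_ < _): Kb; ring.
have Ku : 2 * K%:R * u = pi by rewrite /u mulrC divfK// gt_eqF// mulr_gt0.
have K1 : 1 <= K%:R :> R by rewrite ler1n.
have K2 : 1 <= 2 * K%:R :> R by rewrite mulr_ege1// ler1n.
have upi : u <= pi by rewrite -Ku ler_peMl// ltW.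
pose ctr (k : nat) := (2 * k%:R + 1) * u : R.
pose arc (k : nat) := [set w | exists2 t : R, ctr k - u <= t <= ctr k + u & X w = cis t].
have arcE k : arc k = [set w | cos u <= cRe (X w * Num.conj (cis (ctr k)))].
  apply/seteqP; split => w /= /arc_halfplane; apply; rewrite ?X1//; apply/andP; split=> //; exact: ltW.
have marc k : measurable (arc k).
  rewrite arcE; have := cmeasM mX (cmeas_cst (Num.conj (cis (ctr k)))) => -[m1 _].
  by have := measurable_fun_le measurableT (measurable_cst (cos u)) m1; rewrite setTI.
have Parc k : (k < K + K)%N -> P (arc k) = ((2 * K%:R)^-1)%:E.
  move=> kK; have k0 : 0 <= k%:R :> R by [].
  have kK' : k%:R + 1 <= 2 * K%:R :> R.
    by rewrite natr1 -natrM ler_nat mul2n -addnn.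
  rewrite /arc hP.
  - congr EFin; rewrite /ctr -Ku; field; rewrite !gt_eqF//.
  - by rewrite /ctr subr_ge0 ler_peMl ?(ltW u0)//; lra.
  - by lra.
  - have : (k%:R + 1) * u <= 2 * K%:R * u by rewrite ler_wpM2r// ltW.
    by rewrite /ctr -Ku; lra.
have dist k w : arc k w -> cmod (X w - cis (ctr k)) <= h.
  rewrite arcE => hw; apply: le_trans uh; apply: cmod_sub_cis_le => //; exact: ltW.
have ctrK k : cis (ctr (k + K)%N) = - cis (ctr k).
  have -> : ctr (k + K)%N = ctr k + pi by rewrite /ctr natrD -Ku; ring.
  by rewrite cisD cis_pi mulrN1.
exists K, (fun j => cis (ctr j)), (fun j => arc j), (fun j => arc (j + K)%N); split => //.
- move=> j; split => //; apply: Parc; last by rewrite ltn_add2r.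
  by apply: leq_trans (ltn_ord j) _; exact: leq_addr.
- move=> j w; split; first exact: dist.
  by move=> hw; have := dist _ _ hw; rewrite ctrK opprK.
- by move=> j; exact: cmod_cis.
- apply: aeW => w; have [t /andP[t0 t1] XE] := unit_cis (X1 w).
  have cover N : t <= 2 * N%:R * u -> (0 < N)%N -> exists2 k, (k < N)%N & 2 * k%:R * u <= t <= 2 * (k%:R + 1) * u.
    elim: N => // N IH tN _; have [tN'|tN'] := leP t (2 * N%:R * u); last first.
      by exists N => //; rewrite (ltW tN')/= natr1.
    have [N0|N0] := posnP N; last by have [k kN hk] := IH tN' N0; exists k => //; exact: ltnW.
    exists 0%N => //; move: tN'; rewrite N0 => t'; apply/andP; split; lra.
  have [|//|k kK /andP[k1 k2]] := cover (K + K)%N.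
    by apply: le_trans t1 _; rewrite natrD -Ku; lra.
  have ak : arc k w by exists t => //; rewrite /ctr; apply/andP; split; lra.
  have [kltK|Kk] := ltnP k K; first by exists (Ordinal kltK); left.
  have kK' : (k - K < K)%N by rewrite ltn_subLR.
  by exists (Ordinal kK'); right; rewrite /= subnK.
Qed.
End SignLaws.

Lemma sqr_le_swap {R : realFieldType} (a b c d : R) : 0 <= a -> 0 <= b -> 0 <= c -> 0 < d ->
  a ^+ 2 <= b * c -> d * b ^+ 2 <= a ^+ 2 -> d * a ^+ 2 <= c ^+ 2.
Proof.
move=> a0 b0 c0 d0 h1 h2; have [->|an0] := eqVneq a 0.
  by rewrite expr0n mulr0 sqr_ge0.
have ap : 0 < a ^+ 2 by rewrite exprn_gt0// lt_def an0.
rewrite -(ler_pM2l ap); apply: (@le_trans _ _ (d * (b * c) ^+ 2)).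
  rewrite mulrCA ler_pM2l// -expr2 ler_pXn2r// nnegrE ?sqr_ge0 ?mulr_ge0//.
by rewrite exprMn mulrA ler_wpM2r ?sqr_ge0.
Qed.

Section RealArithmetic.
Context {R : realFieldType}.
Implicit Types a b c d e t : R.

Lemma half_le_of_lt a b : a < b -> b <= 1 / 2 -> 1 / 2 <= 1 - a.
Proof. by move=> h1 h2; lra. Qed.

Lemma le_of_sqr_le_mul a b : 0 <= a -> 0 <= b -> a ^+ 2 <= a * b -> a <= b.
Proof.
move=> a0 b0; have [->//|an0] := eqVneq a 0.
by rewrite expr2 ler_pM2l// lt_def an0.
Qed.

(** Read [a], [d] as the l1 norms of signal and minimizer, [b] as the real pairing with the
    certificate, [t] as the l1 mass of the error off S, [r] as sqrt s and [h] as eta. *)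
Lemma tail_bound a b c d e t p r h : a + b + c <= d -> d <= a -> 1 / 2 * t <= c ->
  - e <= b -> e <= p -> p <= 5 / 4 * r * (2 * h) -> t <= 5 * r * h.
Proof. by move=> *; lra. Qed.
Lemma lower_bound_three del a b c : del <= 1 / 3 -> 0 <= a -> 0 <= c ->
  (1 - del) * a <= b -> b <= 2 ^+ 2 * c -> a <= 3 ^+ 2 * c.
Proof.
move=> del3 a0 c0 h1 h2.
have : (2 / 3) * a <= (1 - del) * a by rewrite ler_wpM2r//; lra.
rewrite !expr2 in h2 *; lra.
Qed.
Lemma total_bound a b c d e t r : a <= c + d -> c <= 3 * e -> d <= t -> b <= t ->
  t <= 5 * r * e -> a + b <= (3 + 10 * r) * e.
Proof. by move=> *; lra. Qed.
End RealArithmetic.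

(** * Dual certificates *)

Section GramBlock.
Context {R : realType}.
Local Notation C := R[i].
Variables (N n : nat) (A : 'M[C]_(N, n)) (S : {set 'I_n}).
Let H := adjmx A *m A.

Definition csupp (T : {set 'I_n}) (v : 'cV[C]_n) := forall i, i \notin T -> v i 0 = 0.

Definition restr (T : {set 'I_n}) (v : 'cV[C]_n) : 'cV[C]_n :=
  \col_i (if i \in T then v i 0 else 0).

(* The principal block of a Gram matrix on S, completed by the identity off S so that
   no reindexing is needed. *)
Definition gram_block (G : 'M[C]_n) : 'M[C]_n :=
  \matrix_(i, j) (if (i \in S) && (j \in S) then G i j else (i == j)%:R).

(** The operator norm of H_TT - Id is at most [del], written on vectors of full length so that
    different sets [T] share one ambient space. *)
Definition rip (T : {set 'I_n}) (del : R) : Prop := forall v, csupp T v ->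
  \sum_(i in T) cmod ((H *m v - v) i 0) ^+ 2 <= del ^+ 2 * l2norm v ^+ 2.

Lemma csupp_restr T v : csupp T (restr T v).
Proof. by move=> i iT; rewrite mxE (negbTE iT). Qed.

Lemma csuppS (T T' : {set 'I_n}) v : T \subset T' -> csupp T v -> csupp T' v.
Proof. by move=> TT' hv i iT'; apply: hv; apply: contra iT'; exact: (fintype.subsetP TT'). Qed.

Lemma csupp_sum T (v : 'cV[C]_n) (F : 'I_n -> C) : csupp T v ->
  \sum_i F i * v i 0 = \sum_(i in T) F i * v i 0.
Proof.
move=> hv; rewrite [RHS]big_mkcond /=; apply: eq_bigr => i _.
by case: ifPn => // iT; rewrite hv// mulr0.
Qed.

Lemma l2norm2_csupp T v : csupp T v -> l2norm v ^+ 2 = \sum_(i in T) cmod (v i 0) ^+ 2.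
Proof.
move=> hv; rewrite l2norm2 [RHS]big_mkcond /=; apply: eq_bigr => i _.
by case: ifPn => // iT; rewrite hv// cmod0 expr0n.
Qed.

Lemma symH i j : H i j = Num.conj (H j i).
Proof. by rewrite -adjmxE /H adjmxM adjmxK. Qed.

Lemma gram_block_mul v i : (gram_block H *m v) i 0 =
  if i \in S then (H *m restr S v) i 0 else v i 0.
Proof.
rewrite mxE; case: ifPn => iS.
  rewrite mxE; apply: eq_bigr => j _; rewrite !mxE iS /=.
  case: ifPn => // jS; rewrite mulr0 (_ : i == j = false) ?mul0r//.
  by apply: contraNF jS => /eqP <-.
rewrite (bigD1 i)//= big1 ?addr0 => [|j ji]; rewrite mxE (negbTE iS) /= ?eqxx ?mul1r//.
by rewrite eq_sym (negbTE ji) mul0r.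
Qed.

Variable del : R.
Hypotheses (del0 : 0 <= del) (del1 : del < 1).

Lemma rip_sub (T T' : {set 'I_n}) : T \subset T' -> rip T' del -> rip T del.
Proof.
move=> TT' h v hv; apply: le_trans (h v (csuppS TT' hv)).
rewrite [X in _ <= X](big_setID T) /= (finset.setIidPr TT') lerDl.
by apply: sumr_ge0 => i _; exact: sqr_ge0.
Qed.

Let del2 : del ^+ 2 < 1. Proof. by rewrite expr_lt1. Qed.

Lemma rip_kernel v : rip S del -> csupp S v -> (forall i, i \in S -> (H *m v) i 0 = 0) -> v = 0.
Proof.
move=> h hv Hv; have := h v hv.
rewrite (_ : \sum_(i in S) _ = l2norm v ^+ 2); last first.
  rewrite (l2norm2_csupp hv); apply: eq_bigr => i iS.
  by rewrite mxE Hv// add0r mxE cmodN.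
move=> hle; apply: l2norm_eq0; apply/eqP; rewrite -sqrf_eq0 eq_le sqr_ge0 andbT.
have : 0 <= l2norm v ^+ 2 by exact: sqr_ge0.
move: (l2norm v ^+ 2) hle => q hle q0; rewrite leNgt; apply/negP => qp.
by have : del ^+ 2 * q < q; [rewrite -[X in _ < X]mul1r ltr_pM2r|lra].
Qed.

(** The identity part forces a kernel vector to vanish off S, and [rip] makes H_SS injective. *)
Lemma gram_block_det_neq0 : rip S del -> \det (gram_block H) != 0.
Proof.
move=> h; rewrite -det_tr; apply/det0P => -[v vn0 vW]; move/eqP: vn0; apply.
have Wv : gram_block H *m v^T = 0 by rewrite -[gram_block H]trmxK -trmx_mul vW trmx0.
suff v0 : v^T = 0 by rewrite -[v]trmxK v0 trmx0.
have hv : csupp S v^T.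
  by move=> i iS; have := gram_block_mul v^T i; rewrite Wv (negbTE iS) mxE => <-.
apply: (rip_kernel h hv) => i iS; have := gram_block_mul v^T i.
rewrite Wv iS mxE => ->; congr ((H *m _) i 0).
apply/colP => j; rewrite [RHS]mxE; case: ifPn => // jS; exact: hv.
Qed.

(** Cramer's rule without the division: the determinant times the solution of H_SS u = b_S. It is
    polynomial in H, hence measurable, and makes sense for singular H_SS too. *)
Definition adj_sol (b : 'cV[C]_n) : 'cV[C]_n := \adj (gram_block H) *m restr S b.

Lemma adj_sol_csupp b : csupp S (adj_sol b).
Proof.
move=> i iS; have := gram_block_mul (adj_sol b) i; rewrite (negbTE iS) => <-.
by rewrite /adj_sol mulmxA mul_mx_adj mul_scalar_mx mxE csupp_restr ?mulr0.
Qed.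

Lemma restr_id T v : csupp T v -> restr T v = v.
Proof.
by move=> hv; apply/colP => j; rewrite mxE; case: ifPn => // jS; rewrite hv.
Qed.

Lemma adj_solE b i : i \in S ->
  (H *m adj_sol b) i 0 = \det (gram_block H) * b i 0.
Proof.
move=> iS; have := gram_block_mul (adj_sol b) i; rewrite iS.
rewrite (restr_id (adj_sol_csupp b)) => <-.
by rewrite /adj_sol mulmxA mul_mx_adj mul_scalar_mx mxE [restr S b i 0]mxE iS.
Qed.

(* Test rip on the vector (u, -det) supported on S and l: its image under H vanishes
   on S. *)
Lemma adj_sol_col_bound (T : {set 'I_n}) l : l \notin S -> l \in T -> S \subset T -> rip T del ->
  (1 - del ^+ 2) * \sum_(i in S) cmod (adj_sol (col l H) i 0) ^+ 2 <=
  del ^+ 2 * cmod (\det (gram_block H)) ^+ 2.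
Proof.
move=> lS lT ST hT; set u := adj_sol _; set D := \det _.
have hu : csupp S u by exact: adj_sol_csupp.
pose v := u - D *: delta_mx l 0.
have ve i : v i 0 = u i 0 - D * (i == l)%:R by rewrite !mxE eqxx andbT.
have hv : csupp T v.
  move=> i iT; rewrite ve hu; last by apply: contra iT; exact: (fintype.subsetP ST).
  by rewrite (_ : i == l = false) ?mulr0 ?subr0//; apply: contraNF iT => /eqP ->.
have Hv i : i \in S -> (H *m v) i 0 = 0.
  move=> iS; rewrite mulmxBr -scalemxAr -colE mxE [X in _ + X]mxE [X in _ - X]mxE.
  by rewrite adj_solE// subrr.
have vS i : i \in S -> v i 0 = u i 0.
  by move=> iS; rewrite ve (_ : i == l = false) ?mulr0 ?subr0//; apply: contraTF iS => /eqP ->.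
have nv : l2norm v ^+ 2 <= \sum_(i in S) cmod (u i 0) ^+ 2 + cmod D ^+ 2.
  rewrite l2norm2 (bigD1 l)//= ve hu// eqxx mulr1 sub0r cmodN addrC lerD2r.
  rewrite [X in _ <= X]big_mkcond [X in X <= _]big_mkcond /=.
  apply: ler_sum => i _; rewrite ve; case: eqP => [_|_] /=.
    by case: ifP => // _; exact: sqr_ge0.
  by rewrite mulr0 subr0; case: ifPn => // iS; rewrite hu// cmod0 expr0n.
have := hT v hv; rewrite [X in X <= _](big_setID S) /= (finset.setIidPr ST).
have r0 : 0 <= \sum_(i in T :\: S) cmod ((H *m v - v) i 0) ^+ 2.
  by apply: sumr_ge0 => i _; exact: sqr_ge0.
have -> : \sum_(i in S) cmod ((H *m v - v) i 0) ^+ 2 = \sum_(i in S) cmod (u i 0) ^+ 2.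
  by apply: eq_bigr => i iS; rewrite mxE Hv// add0r mxE cmodN vS.
move: nv r0; move: (\sum_(i in T :\: S) _) (\sum_(i in S) _) (l2norm v ^+ 2) (cmod D ^+ 2).
move=> a b c e nv r0 h.
have : del ^+ 2 * c <= del ^+ 2 * (b + e) by rewrite ler_wpM2l ?sqr_ge0.
lra.
Qed.

Lemma csupp_rip_restr v : rip S del -> csupp S v ->
  l2norm (restr S (H *m v - v)) <= del * l2norm v.
Proof.
move=> h hv; rewrite l2norm_leX ?mulr_ge0 ?l2norm_ge0// exprMn.
rewrite -l2norm2 (l2norm2_csupp (@csupp_restr S _)).
by under eq_bigr => i iS do rewrite mxE iS; exact: h.
Qed.

Lemma rip_lower v : rip S del -> csupp S v ->
  (1 - del) * l2norm v ^+ 2 <= l2norm (A *m v) ^+ 2.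
Proof.
move=> h hv.
have e : cRe ((adjmx v *m (H *m v)) 0 0) = l2norm (A *m v) ^+ 2.
  by rewrite -[RHS]cRe_ofR -dot_l2norm2 adjmxM /H !mulmxA.
have e' : adjmx v *m (H *m v) = adjmx v *m (H *m v - v) + adjmx v *m v.
  by rewrite -mulmxDr subrK.
have e2 : (adjmx v *m (H *m v - v)) 0 0 = (adjmx v *m restr S (H *m v - v)) 0 0.
  rewrite !mxE; apply: eq_bigr => i _; rewrite [restr _ _ _ _]mxE; case: ifPn => // iS.
  by rewrite adjmxE hv// conjC0 !mul0r.
rewrite -e e' mxE cReD dot_l2norm2 cRe_ofR e2.
have := cmod_dot_le v (restr S (H *m v - v)).
have := cRe_le ((adjmx v *m restr S (H *m v - v)) 0 0); rewrite ler_norml => /andP[h1 _] h2.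
have := ler_wpM2l (l2norm_ge0 v) (csupp_rip_restr h hv).
rewrite expr2; lra.
Qed.

Section DualCertificate.
Variables (x : 'cV[C]_n) (tau alp : R) (u : 'I_n -> 'cV[C]_n).
Hypothesis ripS : rip S del.
Hypothesis xS : csupp S x.
Hypothesis x0 : forall i, i \in S -> x i 0 != 0.
Hypothesis uS : forall l, l \notin S -> csupp S (u l).
Hypothesis Hu : forall l, l \notin S -> forall i, i \in S -> (H *m u l) i 0 = H i l.
Hypothesis u_norm : forall l, l \notin S -> l2norm (u l) <= alp.
Hypothesis u_sign : forall l, l \notin S ->
  cmod (\sum_(i in S) Num.conj (u l i 0) * sgnc (x i 0)) < tau.

(** [q] = A^* (A k) lies in the range of A^* and equals the sign of x on S: it is the dual
    certificate. *)
Let g : 'cV[C]_n := \col_i (if i \in S then sgnc (x i 0) else 0).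
Let k : 'cV[C]_n := (\det (gram_block H))^-1 *: adj_sol g.
Let q : 'cV[C]_n := H *m k.

Let kS : csupp S k.
Proof. by move=> i iS; rewrite mxE adj_sol_csupp ?mulr0. Qed.

Let qS i : i \in S -> q i 0 = sgnc (x i 0).
Proof.
move=> iS; rewrite /q -scalemxAr mxE adj_solE// mulrA mulVf ?gram_block_det_neq0// mul1r.
by rewrite mxE iS.
Qed.

Lemma cmod_sgnc (z : C) : z != 0 -> cmod (sgnc z) = 1.
Proof.
move=> z0; rewrite /sgnc -ofRV cmodM cmod_ofR ger0_norm ?invr_ge0 ?cmod_ge0//.
by rewrite divff// cmod_eq0.
Qed.

Lemma conj_sgnc_mul (z : C) : Num.conj (sgnc z) * z = ofR (cmod z).
Proof.
have [->|z0] := eqVneq z 0; first by rewrite mulr0 cmod0 ofR0.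
rewrite /sgnc -ofRV rmorphM /= conj_ofR mulrAC conj_mul -ofRM.
by rewrite expr2 mulfK// cmod_eq0.
Qed.

(** Self-adjointness moves H: q_l = <H u_l, k> = <u_l, H k> = <u_l, sgn x>, as [k] and [u l] are
    supported on S. *)
Let q_lt l : l \notin S -> cmod (q l 0) < tau.
Proof.
move=> lS; suff -> : q l 0 = \sum_(i in S) Num.conj (u l i 0) * sgnc (x i 0) by exact: u_sign.
have -> : q l 0 = (adjmx (H *m u l) *m k) 0 0.
  rewrite /q mxE mxE; transitivity (\sum_i H l i * k i 0) => //.
  rewrite (csupp_sum _ kS) (csupp_sum _ kS); apply: eq_bigr => i iS.
  by rewrite adjmxE Hu// -symH.
rewrite adjmxM -mulmxA {1}(_ : adjmx H = H); last by rewrite /H adjmxM adjmxK.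
rewrite mxE [RHS]big_mkcond /=; apply: eq_bigr => i _; rewrite adjmxE.
by case: ifPn => iS; [rewrite -/q qS|rewrite uS// conjC0 mul0r].
Qed.

(** On S, |z_i| is at least the real part of z_i against the sign of x_i. Off S, |z_l| splits into
    |q_l| |z_l|, which pays for the pairing, and the slack (1 - |q_l|) |z_l|. *)
Lemma l1norm_dual_lower (z : 'cV[C]_n) :
  l1norm x + cRe (\sum_i Num.conj (q i 0) * (z - x) i 0) +
  \sum_(l | l \notin S) (1 - cmod (q l 0)) * cmod ((z - x) l 0) <= l1norm z.
Proof.
rewrite /l1norm cRe_sum.
rewrite [X in _ + _ + X <= _]big_mkcond /= -!big_split /=; apply: ler_sum => i _.
have -> : (z - x) i 0 = z i 0 - x i 0 by rewrite mxE [X in _ + X]mxE.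
case: ifPn => iS /=.
  rewrite (xS iS) cmod0 subr0 add0r.
  have := cRe_le' (Num.conj (q i 0) * z i 0); rewrite cmodM cmodC; lra.
rewrite addr0; move/negPn in iS.
rewrite qS// mulrBr cReB conj_sgnc_mul cRe_ofR addrC subrK.
apply: le_trans (cRe_le' _) _.
by rewrite cmodM cmodC cmod_sgnc ?mul1r// x0.
Qed.

Lemma dual_pairing (v : 'cV[C]_n) : \sum_i Num.conj (q i 0) * v i 0 = (adjmx (A *m k) *m (A *m v)) 0 0.
Proof.
rewrite adjmxM mulmxA -[adjmx k *m _ *m A]mulmxA -/H.
have -> : adjmx k *m H = adjmx q by rewrite /q adjmxM {2}/H adjmxM adjmxK.
by rewrite [RHS]mxE; apply: eq_bigr => i _; rewrite adjmxE.
Qed.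

Lemma BP_recovery : tau <= 1 -> BP_unique_minimizer A (A *m x) x.
Proof.
move=> tau1.
have lower z : A *m z = A *m x ->
    l1norm x + \sum_(l | l \notin S) (1 - cmod (q l 0)) * cmod ((z - x) l 0) <= l1norm z.
  move=> Az; have := l1norm_dual_lower z; rewrite dual_pairing mulmxBr Az subrr mulmx0.
  by rewrite mxE cRe0 addr0.
have t0 z l : l \notin S -> 0 <= (1 - cmod (q l 0)) * cmod ((z - x) l 0).
  by move=> lS; rewrite mulr_ge0 ?cmod_ge0// subr_ge0 ltW// (lt_le_trans (q_lt lS)).
have min : BP_minimizer A (A *m x) x.
  split => // w Aw; apply: le_trans (lower w Aw); rewrite lerDl.
  by apply: sumr_ge0 => l; exact: t0.
split => // w [Aw wmin]; apply/eqP; rewrite -subr_eq0; apply/eqP.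
(* Equal l1 norms exhaust the slack, and |q_l| < 1 then puts the support of w - x inside S, where H
   is injective. *)
have s0 : \sum_(l | l \notin S) (1 - cmod (q l 0)) * cmod ((w - x) l 0) = 0.
  apply/eqP; rewrite eq_le; apply/andP; split; last by apply: sumr_ge0 => l; exact: t0.
  have := lower w Aw; have := wmin x erefl; lra.
have vS : csupp S (w - x).
  move=> l lS; move/eqP: s0; rewrite psumr_eq0; last by move=> i; exact: t0.
  move=> /allP/(_ l (mem_index_enum l)); rewrite lS /= mulf_eq0 => /orP[|].
    by rewrite subr_eq0 => /eqP e; have := q_lt lS; rewrite -e ltNge tau1.
  by rewrite cmod_eq0 => /eqP.
apply: (rip_kernel ripS vS) => i _.
by rewrite -mulmxA mulmxBr Aw subrr mulmx0 mxE.
Qed.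

(** |A k|^2 = <k, sgn x> <= |k| sqrt s, and (1 - del) |k|^2 <= |A k|^2; eliminate |k|. *)
Lemma dual_norm_le : (1 - del) * l2norm (A *m k) ^+ 2 <= #|S|%:R.
Proof.
have nk := rip_lower ripS kS.
have e : l2norm (A *m k) ^+ 2 = cRe ((adjmx k *m g) 0 0).
  rewrite -[LHS]cRe_ofR -dot_l2norm2 adjmxM -mulmxA [adjmx A *m _]mulmxA -/H -/q.
  congr cRe; rewrite !mxE; apply: eq_bigr => i _; rewrite adjmxE [g i 0]mxE.
  by case: ifPn => iS; [rewrite qS|rewrite kS// conjC0 !mul0r].
have ng : l2norm g ^+ 2 = #|S|%:R.
  rewrite (@l2norm2_csupp S) => [|i iS]; last by rewrite mxE (negbTE iS).
  rewrite -sum1_card natr_sum; apply: eq_bigr => i iS.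
  by rewrite mxE iS cmod_sgnc ?x0// expr1n.
have h : l2norm (A *m k) ^+ 2 <= l2norm k * l2norm g.
  by rewrite e; apply: le_trans (cRe_le' _) (cmod_dot_le _ _).
rewrite -ng; move: h nk; set a := l2norm (A *m k); set b := l2norm k; set c := l2norm g.
move=> h nk; have a0 : 0 <= a by exact: l2norm_ge0.
have d1 : 0 < 1 - del by rewrite subr_gt0.
apply: (@sqr_le_swap _ a b c (1 - del)) => //; exact: l2norm_ge0.
Qed.

Lemma qBP_recovery (e : 'cV[C]_N) (eta : R) (z : 'cV[C]_n) :
  tau <= 1 / 2 -> del <= 1 / 3 -> alp <= 1 -> l2norm e <= eta ->
  qBP_minimizer A (A *m x + e) eta z ->
  l2norm (x - z) <= (3 + 10 * Num.sqrt #|S|%:R) * eta.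
Proof.
move=> tau2 del3 alp1 he [hz zmin].
have eta0 : 0 <= eta by exact: le_trans (l2norm_ge0 _) he.
rewrite -l2normN opprB; pose v := z - x; rewrite -/v.
have Av : l2norm (A *m v) <= 2 * eta.
  have -> : A *m v = e - (A *m x + e - A *m z).
    rewrite /v mulmxBr; move: (A *m z) (A *m x) => p r.
    by apply/colP => i; rewrite !mxE; ring.
  apply: le_trans (ler_l2normB _ _) _; lra.
have zx : l1norm z <= l1norm x by apply: zmin; rewrite addrAC subrr add0r.
pose tail := \sum_(l | l \notin S) cmod (v l 0).
have tail0 : 0 <= tail by apply: sumr_ge0 => l _; exact: cmod_ge0.
(* 1 - del >= 2/3 gives |A k|^2 <= 3 s / 2, and 3/2 <= (5/4)^2. *)
have Ak : l2norm (A *m k) <= 5 / 4 * Num.sqrt #|S|%:R.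
  rewrite -(@ler_pXn2r _ 2)// ?nnegrE ?mulr_ge0 ?l2norm_ge0 ?sqrtr_ge0//.
  rewrite exprMn [Num.sqrt #|S|%:R ^+ 2]sqr_sqrtr//; have := dual_norm_le; have s0 : 0 <= #|S|%:R :> R by [].
  have := sqr_ge0 (l2norm (A *m k)); move: (l2norm _ ^+ 2) => a a0 h.
  have : (2 / 3) * a <= (1 - del) * a by rewrite ler_wpM2r//; lra.
  rewrite expr2; lra.
have htail : tail <= 5 * Num.sqrt #|S|%:R * eta.
  have := l1norm_dual_lower z; rewrite -/v dual_pairing => hl.
  have h1 : 1 / 2 * tail <= \sum_(l | l \notin S) (1 - cmod (q l 0)) * cmod (v l 0).
    rewrite /tail mulr_sumr; apply: ler_sum => l lS; rewrite ler_wpM2r ?cmod_ge0//.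
    exact: half_le_of_lt (q_lt lS) tau2.
  have h2 := cmod_dot_le (A *m k) (A *m v).
  have := cRe_le ((adjmx (A *m k) *m (A *m v)) 0 0); rewrite ler_norml => /andP[h3 _].
  have h4 : l2norm (A *m k) * l2norm (A *m v) <= 5 / 4 * Num.sqrt #|S|%:R * (2 * eta).
    by apply: ler_pM => //; exact: l2norm_ge0.
  exact: tail_bound hl zx h1 h3 h2 h4.
(* A y is the orthogonal projection of A v onto the span of the columns in S, since each A (u l) is
   the projection of column l. Hence |A y| <= |A v| <= 2 eta, and [rip_lower] returns a bound on [y]
   itself. *)
pose y := restr S v + \sum_(l | l \notin S) v l 0 *: u l.
have yS : csupp S y.
  move=> i iS; rewrite mxE csupp_restr// add0r summxE big1// => l lS.
  by rewrite mxE uS// mulr0.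
have Hy i : i \in S -> (H *m y) i 0 = (H *m v) i 0.
  move=> iS; rewrite mulmxDr mulmx_sumr mxE summxE [RHS]mxE.
  rewrite [RHS](bigID (mem S)) /=; congr (_ + _).
    rewrite mxE [RHS]big_mkcond /=; apply: eq_bigr => j _; rewrite [restr _ _ _ _]mxE.
    by case: ifP => // _; rewrite mulr0.
  by apply: eq_bigr => l lS; rewrite -scalemxAr mxE Hu// mulrC.
have Ay : l2norm (A *m y) <= 2 * eta.
  apply: le_trans Av; apply: le_of_sqr_le_mul; [exact: l2norm_ge0|exact: l2norm_ge0|].
  rewrite -[X in X <= _]cRe_ofR -dot_l2norm2.
  have -> : (adjmx (A *m y) *m (A *m y)) 0 0 = (adjmx (A *m y) *m (A *m v)) 0 0.
    rewrite adjmxM -!mulmxA ![adjmx A *m (A *m _)]mulmxA -/H !mxE.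
    apply: eq_bigr => i _; rewrite adjmxE; have [iS|iS] := boolP (i \in S); first by rewrite Hy.
    by rewrite yS// conjC0 !mul0r.
  exact: le_trans (cRe_le' _) (cmod_dot_le _ _).
have ny : l2norm y <= 3 * eta.
  rewrite -(@ler_pXn2r _ 2)// ?nnegrE ?mulr_ge0 ?l2norm_ge0//.
  have := rip_lower ripS yS.
  have : l2norm (A *m y) ^+ 2 <= (2 * eta) ^+ 2.
    by rewrite ler_pXn2r// nnegrE ?l2norm_ge0// mulr_ge0.
  have := sqr_ge0 (l2norm y); have := sqr_ge0 eta; rewrite !exprMn.
  move: (l2norm y ^+ 2) (l2norm (A *m y) ^+ 2) (eta ^+ 2) => a b c c0 a0 h1 h2.
  exact: lower_bound_three del3 a0 c0 h2 h1.
have sumu : l2norm (\sum_(l | l \notin S) v l 0 *: u l) <= tail.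
  apply: le_trans (ler_l2norm_sum _ _ _) _; apply: ler_sum => l lS.
  rewrite l2normZ -[X in _ <= X]mulr1 ler_wpM2l ?cmod_ge0//.
  exact: le_trans (u_norm lS) alp1.
(* The two sums are each bounded by the l1 tail 5 sqrt s eta, which makes the constant 10; the term
   [y] gives the 3. *)
have vdec : v = y - (\sum_(l | l \notin S) v l 0 *: u l) +
    \sum_(l | l \notin S) v l 0 *: delta_mx l 0.
  rewrite /y addrK; apply/colP => i; rewrite [RHS]mxE summxE [restr _ _ _ _]mxE.
  case: ifPn => iS.
    rewrite big1 ?addr0// => l lS; rewrite !mxE.
    by rewrite (_ : i == l = false) ?mulr0//; apply: contraNF lS => /eqP <-.
  rewrite add0r (bigD1 i)//= big1 ?addr0 => [|l /andP[_ li]].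
    by rewrite [RHS]mxE [delta_mx _ _ _ _]mxE !eqxx mulr1.
  by rewrite [LHS]mxE [delta_mx _ _ _ _]mxE eq_sym (negbTE li) mulr0.
have sume : l2norm (\sum_(l | l \notin S) v l 0 *: (delta_mx l 0 : 'cV[C]_n)) <= tail.
  apply: le_trans (ler_l2norm_sum _ _ _) _; apply: ler_sum => l lS.
  rewrite l2normZ -[X in _ <= X]mulr1 ler_wpM2l ?cmod_ge0//.
  by rewrite l2norm_delta.
rewrite vdec; apply: le_trans (ler_l2normD _ _) _.
exact: total_bound (ler_l2normB _ _) ny sumu sume htail.
Qed.

End DualCertificate.
End GramBlock.

Section Expectation.
Context {R : realType} {d : measure_display} {Omega : measurableType d}.
Variable P : probability Omega R.

Lemma fine_expectation (X : Omega -> R) : fine 'E_P[X] = Ex P X.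
Proof. by rewrite unlock. Qed.

Lemma ExZ_integrable (c : R) (f : Omega -> R) : P.-integrable setT (EFin \o f) ->
  Ex P (fun w => c * f w) = c * Ex P f.
Proof. exact: RintegralZl. Qed.
End Expectation.

(** * The random sensing matrix *)

Section SensingMatrix.
Context {R : realType} {d : measure_display} {Omega : measurableType d}.
Variable P : probability Omega R.
Local Notation C := R[i].
Variables (n m : nat) (p : 'I_m -> nat) (B : forall l : 'I_m, Omega -> 'M[C]_(p l, n)).
Hypothesis m0 : (0 < m)%N.

Let mR : 0 < m%:R :> R. Proof. by rewrite ltr0n. Qed.

Lemma sensing_gram w : adjmx (sensing_matrix B w) *m sensing_matrix B w =
  \sum_l ofR (m%:R^-1) *: (adjmx (B l w) *m B l w).
Proof.
rewrite /sensing_matrix adjmxZ -scalemxAl -scalemxAr scalerA -ofRM.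
rewrite -invfM -expr2 sqr_sqrtr ?ler0n// -scaler_sumr; congr (_ *: _).
have -> : adjmx (\mxcol_l B l w) = \mxrow_l adjmx (B l w).
  by apply/matrixP => i j; rewrite !mxE.
exact: mul_mxrow_mxcol.
Qed.

Variable T : {set 'I_n}.

(** Reindexed by the cardinality of [T], so that the Chernoff bound carries the dimension |T| and
    not n. *)
Definition block_gram (l : 'I_m) (w : Omega) : 'M[C]_#|T| :=
  ofR (m%:R^-1) *: (adjmx (colrestr (B l w) T) *m colrestr (B l w) T).

Lemma block_gramE l w i j : block_gram l w i j =
  ofR (m%:R^-1) * (adjmx (B l w) *m B l w) (enum_val i) (enum_val j).
Proof.
rewrite mxE; congr (_ * _); rewrite !mxE; apply: eq_bigr => k _.
by rewrite !adjmxE !mxE.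
Qed.

Lemma sum_block_gramE w i j : (\sum_l block_gram l w) i j =
  (adjmx (sensing_matrix B w) *m sensing_matrix B w) (enum_val i) (enum_val j).
Proof.
rewrite sensing_gram !summxE; apply: eq_bigr => l _.
by rewrite block_gramE [RHS]mxE.
Qed.

Lemma rip_of_gap w del : 0 <= del ->
  (forall v : 'cV[C]_#|T|, l2norm ((\sum_l block_gram l w - 1%:M) *m v) <= del * l2norm v) ->
  rip (sensing_matrix B w) T del.
Proof.
move=> del0 h v hv; pose H := adjmx (sensing_matrix B w) *m sensing_matrix B w; rewrite -/H.
pose v' : 'cV[C]_#|T| := \col_j v (enum_val j) 0.
have e1 : l2norm v' ^+ 2 = l2norm v ^+ 2.
  rewrite (l2norm2_csupp hv) big_enum_val l2norm2.
  by apply: eq_bigr => j _; rewrite [v' j 0]mxE.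
have e2 : l2norm ((\sum_l block_gram l w - 1%:M) *m v') ^+ 2 =
    \sum_(i in T) cmod ((H *m v - v) i 0) ^+ 2.
  rewrite [RHS]big_enum_val l2norm2; apply: eq_bigr => j _; congr (cmod _ ^+ 2).
  rewrite mulmxBl mul1mx [LHS]mxE [RHS]mxE; congr (_ + _).
    rewrite [LHS]mxE [RHS]mxE [RHS](csupp_sum _ hv) [RHS]big_enum_val /=.
    by apply: eq_bigr => k _; rewrite sum_block_gramE [v' k 0]mxE.
  by rewrite [LHS]mxE [RHS]mxE [v' j 0]mxE.
rewrite -e1 -e2 -exprMn; move: (h v') => hle.
apply: lerXn2r; rewrite ?nnegrE; [exact: l2norm_ge0| |exact: hle].
by apply: mulr_ge0 => //; exact: l2norm_ge0.
Qed.

Hypothesis setting : random_sensing_setting P B.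

Let g l := coordgen (mxcoords (B l)).

Lemma sensing_coordgen_measurable l : g l `<=` measurable.
Proof. by have [mB _ _ _] := setting; apply: coordgen_measurable; exact: mB. Qed.

Lemma mxmeas_mxcoords l :
  mxmeas (B l : g_sigma_algebraType (coordgen (mxcoords (B l))) -> 'M[C]_(p l, n)).
Proof.
move=> i j; have h b := @measurable_coordgen _ _ _ _ (mxcoords (B l)) (i, j, b).
by split; [exact: (h true)|exact: (h false)].
Qed.

Lemma mxmeas_block_gram l (D : measure_display) (U : measurableType D) (f : U -> Omega) :
  mxmeas (fun u => B l (f u)) -> mxmeas (fun u => block_gram l (f u)).
Proof.
move=> hB i j; under eq_fun do rewrite block_gramE.
by apply: cmeasM; [exact: cmeas_cst|exact: (mxmeasM (mxmeas_adj hB) hB)].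
Qed.

Lemma block_gram_sym l w : adjmx (block_gram l w) = block_gram l w.
Proof. by rewrite /block_gram adjmxZ adjmxM adjmxK. Qed.

Lemma sum_Exmx_block_gram : \sum_l Exmx P (block_gram l) = 1%:M.
Proof.
have [mB _ iB iso] := setting; apply/matrixP => i j.
have e : (1%:M : 'M[C]_n) (enum_val i) (enum_val j) = (1%:M : 'M[C]_#|T|) i j.
  by rewrite !mxE (inj_eq enum_val_inj).
rewrite -e -iso.
rewrite [RHS]mxE !summxE big_distrr /=; apply: eq_bigr => l _; rewrite !mxE.
have ib b := iB l (enum_val i, enum_val j, b).
rewrite -ofR_nat -ofRV; apply: complexP; rewrite ?cReZ ?cImZ /cRe /cIm /=.
  rewrite fine_expectation -ExZ_integrable; last exact: (ib true).
  by congr Ex; apply/funext => w; rewrite block_gramE; exact: cReZ.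
rewrite fine_expectation -ExZ_integrable; last exact: (ib false).
by congr Ex; apply/funext => w; rewrite block_gramE; exact: cImZ.
Qed.

Variable Lam : R.
Hypothesis LamT : Lambda_bound P B T Lam.

Lemma block_gram_bound : {ae P, forall w, forall l,
  psdmx (ofR (Lam / m%:R) *: block_gram l w - block_gram l w *m block_gram l w) /\
  mxbnd (Lam / m%:R) (block_gram l w)}.
Proof.
have [L0 hL] := LamT; apply: filterS hL => w h l.
have [hp hb] := opnorm_gram_bounds (ltW L0) (h l).
set G := adjmx _ *m _ in hp hb; have c0 : 0 <= m%:R^-1 :> R by rewrite invr_ge0 ltW.
split.
  have -> : ofR (Lam / m%:R) *: block_gram l w - block_gram l w *m block_gram l w =
      ofR (m%:R^-1 * m%:R^-1) *: (ofR Lam *: G - G *m G).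
    rewrite /block_gram -/G -scalemxAl -scalemxAr !scalerA -!ofRM scalerBr scalerA -ofRM.
    by congr (ofR _ *: _ - _); ring.
  by apply: psdmxZ => //; exact: mulr_ge0.
move=> i j; rewrite /block_gram -/G mxE cmodM cmod_ofR ger0_norm// mulrC.
by apply: ler_wpM2r.
Qed.

(** The bad event is the union of the two one-sided tails, s = 1 and s = -1; hence the factor 2. *)
Lemma rip_tail del : 0 < del -> del <= 3 / 5 -> exists Bad : set Omega,
  [/\ measurable Bad,
      (P Bad <= (2 * (#|T|%:R * expR (- (4 / 25 * (del ^+ 2 / (Lam / m%:R))))))%:E)%E &
      forall w, ~ Bad w -> rip (sensing_matrix B w) T del].
Proof.
move=> d0 d1; have [L0 _] := LamT; have [_ ind _ _] := setting.
have L'0 : 0 < Lam / m%:R by rewrite divr_gt0.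
have mG l : mxmeas (block_gram l : g_sigma_algebraType (g l) -> _).
  exact: (mxmeas_block_gram (f := fun u : g_sigma_algebraType (g l) => u) (@mxmeas_mxcoords l)).
pose t := del / (4 * (Lam / m%:R)).
pose A s := [set w | expR (t * del) <= trexp t 1%:M (ofR s *: (\sum_k block_gram k w - 1%:M))].
pose K := #|T|%:R * expR (- (4 / 25 * (del ^+ 2 / (Lam / m%:R)))).
have tail s : s = 1 \/ s = -1 -> measurable (A s) /\ (P (A s) <= K%:E)%E.
  move=> hs; exact: (chernoff_tail sensing_coordgen_measurable ind mG block_gram_sym L'0
    block_gram_bound sum_Exmx_block_gram hs d0 d1).
have [m1 p1] := tail 1 (or_introl erefl); have [m2 p2] := tail (-1) (or_intror erefl).
exists (A 1 `|` A (-1)); split; first exact: (measurableU _ _ m1 m2).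
  apply: le_trans (measureU2 _ m1 m2) _; apply: le_trans (leeD p1 p2) _.
  by rewrite -EFinD lee_fin mulrDl !mul1r.
move=> w /= nA; apply: rip_of_gap; first exact: ltW.
set E := \sum_l _ - _.
have symE : adjmx E = E.
  rewrite /E adjmxB adjmx1 adjmx_sum; congr (_ - _); apply: eq_bigr => l _.
  exact: block_gram_sym.
have t0 : 0 < t by rewrite /t divr_gt0// mulr_gt0.
apply: (two_sided_gap symE (ltW d0)).
  apply: (trexp1_lt_psd symE t0); rewrite ltNge; apply/negP => h.
  by apply: nA; left; rewrite /A /= ofR1 scale1r.
have symN : adjmx (- E) = - E by rewrite adjmxN symE.
rewrite -[E]opprK; apply: (trexp1_lt_psd symN t0); rewrite ltNge; apply/negP => h.
by apply: nA; right; rewrite /A /= ofRN ofR1 scaleN1r.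
Qed.
End SensingMatrix.

Section SignEvent.
Context {R : realType} {I : finType} (S : {set I}).
Local Notation C := R[i].

(** The sign condition fails for the coefficients a / D, with denominators cleared. Including the
    norm bound and D != 0 makes the conditional estimate valid for every value of the matrix. The
    abstract [T] allows reading it on [Omega] and on [Omega * Omega]. *)
Definition sign_event {T : Type} (alp tau : R) (a : I -> T -> C) (D : T -> C) (s : I -> T -> C) :
    set T :=
  [set z | \sum_(i in S) cmod (a i z) ^+ 2 <= alp ^+ 2 * cmod (D z) ^+ 2] `&`
  ([set z | 0 < cmod (D z) ^+ 2] `&`
   [set z | tau ^+ 2 * cmod (D z) ^+ 2 <= cmod (\sum_(i in S) a i z * s i z) ^+ 2]).

Lemma measurable_sign_event {d : measure_display} {T : measurableType d} (alp tau : R)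
    (a : I -> T -> C) (D : T -> C) (s : I -> T -> C) :
  (forall i, i \in S -> cmeas (a i)) -> cmeas D -> (forall i, i \in S -> cmeas (s i)) ->
  measurable (sign_event alp tau a D s).
Proof.
move=> ma mD ms.
have mle (f g : T -> R) : measurable_fun setT f -> measurable_fun setT g ->
    measurable [set z | f z <= g z].
  by move=> mf mg; have := measurable_fun_le measurableT mf mg; rewrite setTI.
have mD2 (c : R) : measurable_fun setT (fun z => c * cmod (D z) ^+ 2).
  by apply: measurable_funM; [exact: measurable_cst|exact: cmeas_cmod2].
apply: measurableI; [|apply: measurableI].
- apply: mle => //; rewrite (_ : (fun z => _) =
      fun z => \sum_(i <- enum S) cmod (a i z) ^+ 2); last first.
    by apply/funext => z; rewrite big_enum.
  have : all (fun i => i \in S) (enum S) by apply/allP => i; rewrite mem_enum.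
  elim: (enum S) => [_|i r IH /= /andP[iS rS]].
    by under eq_fun do rewrite big_nil; exact: measurable_cst.
  under eq_fun do rewrite big_cons; apply: measurable_funD; last exact: IH.
  exact/cmeas_cmod2/ma.
- rewrite (_ : [set z | _] = ~` [set z | 1 * cmod (D z) ^+ 2 <= 0]).
    by apply: measurableC; apply: mle => //; exact: measurable_cst.
  by apply/seteqP; split=> z /=; rewrite mul1r; [rewrite ltNge => /negP|move/negP; rewrite -ltNge].
- apply: mle => //; apply: cmeas_cmod2; apply: cmeas_sum => i iS.
  by apply: cmeasM; [exact: ma|exact: ms].
Qed.
End SignEvent.

Section ConditionalSignTail.
Context {R : realType} {d : measure_display} {Omega : measurableType d}.
Variable P : probability Omega R.
Local Notation C := R[i].
Context {I : finType} (S : {set I}) (sg : I -> Omega -> C).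
Hypothesis msg : forall i, cmeas (sg i).
Hypothesis sg1 : forall i w, cmod (sg i w) <= 1.
Hypothesis indep : mutually_indep P S (fun i => sigma_gen (ccoords (sg i))).
Hypothesis sym : forall i, i \in S -> approx_symmetric P (sg i).
Variables G H : set (set Omega).
Hypotheses (Gm : G `<=` measurable) (Hm : H `<=` measurable).
Hypothesis indepGH : forall A B, <<s G >> A -> <<s H >> B -> P (A `&` B) = (P A * P B)%E.
Hypothesis sgG : forall i, i \in S -> cmeas (sg i : g_sigma_algebraType G -> C).
Variables (a : I -> Omega -> C) (D : Omega -> C).
Hypothesis aH : forall i, i \in S -> cmeas (a i : g_sigma_algebraType H -> C).
Hypothesis DH : cmeas (D : g_sigma_algebraType H -> C).

Lemma conditional_sign_tail (alp tau : R) : 0 < alp -> 0 <= tau ->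
  measurable (sign_event S alp tau a D sg) /\
  (P (sign_event S alp tau a D sg) <= (2 * expR (- (tau ^+ 2 / (2 * alp ^+ 2))))%:E)%E.
Proof.
move=> al0 tau0; set E := sign_event _ _ _ _ _ _.
have sub (f : Omega -> C) : cmeas (f : g_sigma_algebraType H -> C) -> cmeas f.
  by move=> hf; exact: (cmeas_comp (measurable_id_sigma Hm) hf).
have mE : measurable E.
  by apply: measurable_sign_event => // [i iS|]; apply: sub; [exact: aH|exact: DH].
split=> //; rewrite (Ex_indic P mE) lee_fin.
(* Signs read at the first point, matrix at the second. [E] is the diagonal trace of [F], and
   independence turns it into an average over sections with the matrix fixed. *)
pose F : set (Omega * Omega) :=
  sign_event S alp tau (fun i z => a i z.2) (fun z => D z.2) (fun i z => sg i z.1).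
have mF : @measurable _ (g_sigma_algebraType G * g_sigma_algebraType H)%type F.
  apply: measurable_sign_event => [i iS||i iS].
  - exact: (cmeas_comp measurable_snd (aH iS)).
  - exact: (cmeas_comp measurable_snd DH).
  - exact: (cmeas_comp measurable_fst (sgG iS)).
have mF' : measurable F.
  apply: measurable_sign_event => [i iS||i iS].
  - exact: (cmeas_comp measurable_snd (sub _ (aH iS))).
  - exact: (cmeas_comp measurable_snd (sub _ DH)).
  - exact: (cmeas_comp measurable_fst (msg i)).
have hf' : bmeas (\1_F : Omega * Omega -> R) by exact: bmeas_indic.
have -> : Ex P (\1_E : Omega -> R) = Ex P (fun w => \1_F (w, w)) by [].
rewrite (@Ex_indep_sigma _ _ _ P G H Gm Hm indepGH _ (bmeas_indic mF)) (Ex_swap P P hf').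
set K := 2 * _; rewrite -[K](Ex_cst P); apply: Ex_le.
- exact: (bmeas_fubini2 P hf').
- exact: bmeas_cst.
move=> w'.
have mFw : measurable [set w : Omega | F (w, w')].
  by have := measurable_pair2 w' measurableT mF'; rewrite setTI.
rewrite -lee_fin; rewrite -[X in (X <= _)%E](Ex_indic P mFw).
(* If the matrix at [w'] violates the norm bound or has D = 0, the section is empty. *)
have [h1|h1] := leP (\sum_(i in S) cmod (a i w') ^+ 2) (alp ^+ 2 * cmod (D w') ^+ 2); last first.
  rewrite (_ : [set w | _] = set0) ?measure0 ?lee_fin ?mulr_ge0 ?expR_ge0//.
  by apply/seteqP; split=> w // [/=]; rewrite leNgt h1.
have [h2|h2] := ltP 0 (cmod (D w') ^+ 2); last first.
  rewrite (_ : [set w | _] = set0) ?measure0 ?lee_fin ?mulr_ge0 ?expR_ge0//.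
  by apply/seteqP; split=> w // [_ [/=]]; rewrite ltNge h2.
have D0 : 0 < cmod (D w').
  by rewrite lt_def cmod_ge0 andbT; apply: contraTneq h2 => ->; rewrite expr0n ltxx.
have b0 : 0 < alp * cmod (D w') by exact: mulr_gt0.
have r0 : 0 <= tau * cmod (D w') by rewrite mulr_ge0// ltW.
have ab : \sum_(i in S) cmod (a i w') ^+ 2 <= (alp * cmod (D w')) ^+ 2 by rewrite exprMn.
have := sign_sum_tail msg sg1 indep sym b0 r0 ab.
rewrite (_ : (tau * cmod (D w')) ^+ 2 / (2 * (alp * cmod (D w')) ^+ 2) =
   tau ^+ 2 / (2 * alp ^+ 2)); last by field; rewrite !gt_eqF.
apply: le_trans; apply: le_measure; rewrite ?inE//.
  have mW : cmeas (fun w => \sum_(i in S) a i w' * sg i w).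
    by apply: cmeas_sum => i iK; apply: cmeasM; [exact: cmeas_cst|exact: msg].
  have := measurable_fun_le measurableT (measurable_cst (tau * cmod (D w'))) (measurable_cmod mW).
  by rewrite setTI.
move=> w [_ [_ /=]]; rewrite -exprMn ler_pXn2r// nnegrE//; exact: cmod_ge0.
Qed.
End ConditionalSignTail.

(** * Choice of parameters and union bounds *)

Section RealParameters.
Context {R : realType}.
Implicit Types K L del alp : R.

(** exp (-1/2) >= 1/2 gives exp (1/2) <= 2, so e <= 4. *)
Lemma ln6_ge1 (a : R) : 6 <= a -> 1 <= ln a.
Proof.
move=> a6; rewrite -[X in X <= _]expRK ler_ln ?posrE ?expR_gt0//; last by lra.
apply: le_trans a6; have h := expR_ge1Dx (- (1 / 2) : R); have p := expR_gt0 (1 / 2 : R).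
have e : expR (- (1 / 2)) * expR (1 / 2) = 1 :> R by rewrite -expRD addNr expR0.
have h2 : expR (1 / 2) <= 2 :> R by have := ler_wpM2r (ltW p) h; rewrite e; lra.
have -> : 1 = 1 / 2 + 1 / 2 :> R by field.
rewrite expRD; have := ler_pM (ltW p) (ltW p) h2 h2; lra.
Qed.

Lemma sample_exponent K L del c1 mx Lam m l1 : 0 <= K -> 1 <= L -> del ^+ 2 * (1 + K * L) = 1 ->
  19 * (1 + K) <= 3 * c1 -> 0 < Lam -> Lam <= mx -> 0 <= l1 -> 0 < m ->
  c1 * mx * l1 * L <= m -> l1 <= 4 / 25 * (del ^+ 2 / (Lam / m)).
Proof.
move=> K0 L1 hd hc Lam0 Lmx l0 m0 hm.
have c0 : 0 < c1 by lra.
have KL : 0 < 1 + K * L by rewrite ltr_pwDl// mulr_ge0//; lra.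
have -> : del ^+ 2 = (1 + K * L)^-1 by rewrite -[LHS](mulfK (lt0r_neq0 KL)) hd mul1r.
have -> : 4 / 25 * ((1 + K * L)^-1 / (Lam / m)) = 4 * m / (25 * (1 + K * L) * Lam).
  by field; rewrite !gt_eqF.
rewrite ler_pdivlMr ?mulr_gt0//.
have h1 : c1 * Lam * l1 * L <= m.
  apply: le_trans hm; rewrite -!mulrA ler_wpM2l ?(ltW c0)//.
  by apply: ler_wpM2r => //; rewrite mulr_ge0//; lra.
(* 4 c1 L >= (76/3) (1 + K) L, and 76/3 exceeds 25. *)
have h2 : 25 * (1 + K * L) <= 4 * (c1 * L).
  have : 19 * (1 + K) * L <= 3 * c1 * L by rewrite ler_wpM2r//; lra.
  have : 0 <= K * L by rewrite mulr_ge0//; lra.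
  lra.
have h3 : 0 <= l1 * Lam by rewrite mulr_ge0// ltW.
have := ler_wpM2r h3 h2; lra.
Qed.

Lemma parameter_choice K L : 2 <= K -> 1 <= L -> exists del alp : R,
  [/\ [/\ 0 < del, del < 1 & del <= 3 / 5], del ^+ 2 * (1 + K * L) = 1, 0 < alp,
      alp ^+ 2 * (K * L) = 1 & 8 <= K -> del <= 1 / 3 /\ alp <= 1].
Proof.
move=> K2 L1; have KL : 2 <= K * L by rewrite -[2]mulr1 ler_pM//; lra.
have KL1 : 0 < 1 + K * L by lra.
have KL0 : 0 < K * L by lra.
pose del := Num.sqrt (1 + K * L)^-1; pose alp := Num.sqrt (K * L)^-1.
have d0 : 0 < del by rewrite sqrtr_gt0 invr_gt0.
have a0 : 0 < alp by rewrite sqrtr_gt0 invr_gt0.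
have d2 : del ^+ 2 * (1 + K * L) = 1 by rewrite sqr_sqrtr ?invr_ge0 ?ltW// mulVf ?gt_eqF.
have a2 : alp ^+ 2 * (K * L) = 1 by rewrite sqr_sqrtr ?invr_ge0 ?ltW// mulVf ?gt_eqF.
have dle (c : R) : 0 < c -> 1 <= c ^+ 2 * (1 + K * L) -> del <= c.
  move=> c0; rewrite -[X in X <= _ -> _]d2 ler_pM2r// ler_pXn2r ?nnegrE//; exact: ltW.
exists del, alp; split => //.
  have d35 : del <= 3 / 5 by apply: dle; rewrite ?expr2; lra.
  by split => //; lra.
move=> K8; have KL8 : 8 <= K * L by rewrite -[8]mulr1 ler_pM//; lra.
split; first by apply: dle; rewrite ?expr2; lra.
rewrite -(@ler_pXn2r _ 2)// ?nnegrE ?(ltW a0)// expr1n -(ler_pM2r KL0) a2; lra.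
Qed.
End RealParameters.

Section UnionBound.
Context {R : realType} {d : measure_display} {Omega : measurableType d}.
Variable P : probability Omega R.

Lemma union_bound (I : eqType) (r : seq I) (F : I -> set Omega) (c : R) :
  (forall i, i \in r -> measurable (F i) /\ (P (F i) <= c%:E)%E) ->
  let U := [set w | exists2 i, i \in r & F i w] in
  measurable U /\ (P U <= ((size r)%:R * c)%:E)%E.
Proof.
elim: r => [_|i r IH h] /=.
  by rewrite (_ : [set w | _] = set0) ?measure0 ?mul0r//; apply/seteqP; split=> w // [].
have [mi pi] := h i (mem_head _ _).
have {IH} [j jr|mU pU] := IH; first by apply: h; rewrite inE jr orbT.
rewrite (_ : [set w | _] = F i `|` [set w | exists2 i, i \in r & F i w]); last first.
  apply/seteqP; split => w /=.
    by move=> [j]; rewrite inE => /orP[/eqP ->|jr] hj; [left|right; exists j].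
  by move=> [hi|[j jr hj]]; [exists i; rewrite ?mem_head|exists j; rewrite // inE jr orbT].
split; first exact: (measurableU _ _ mi mU).
apply: le_trans (measureU2 _ mi mU) _; apply: le_trans (leeD pi pU) _.
by rewrite -EFinD lee_fin -[(size r).+1]add1n natrD mulrDl mul1r.
Qed.
End UnionBound.

Section GramBlockMeasurability.
Context {R : realType} {d : measure_display} {T : measurableType d}.
Local Notation C := R[i].
Variables (n : nat) (S : {set 'I_n}) (H : T -> 'M[C]_n).
Hypothesis mH : mxmeas H.

Lemma mxmeas_gram_block : mxmeas (fun w => gram_block S (H w)).
Proof.
move=> i j; under eq_fun do rewrite mxE.
by case: (_ && _); [exact: mH|exact: cmeas_cst].
Qed.

Lemma mxmeas_restr_col l : mxmeas (fun w => restr S (col l (H w))).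
Proof.
move=> i j; under eq_fun do rewrite mxE; case: (i \in S); last exact: cmeas_cst.
by under eq_fun do rewrite mxE; exact: mH.
Qed.
End GramBlockMeasurability.

Section Recovery.
Context {R : realType} {d : measure_display} {Omega : measurableType d}.
Variable P : probability Omega R.
Local Notation C := R[i].
Variables (n m : nat) (p : 'I_m -> nat) (B : forall l : 'I_m, Omega -> 'M[C]_(p l, n)).
Variables (S : {set 'I_n}) (x : Omega -> 'cV[C]_n).
Hypotheses (n0 : (0 < n)%N) (m0 : (0 < m)%N).
Hypothesis setting : random_sensing_setting P B.
Hypothesis signal : random_sign_signal P B S x.

Let A w := sensing_matrix B w.
Let H w := adjmx (A w) *m A w.
Let D w := \det (gram_block S (H w)).
Let b l w := adj_sol (A w) S (col l (H w)).
Let sg i w := sgnc (x w i 0).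

Lemma sign_tail (l : 'I_n) (alp tau : R) : 0 < alp -> 0 <= tau ->
  let E := sign_event S alp tau (fun i w => Num.conj (b l w i 0)) D sg in
  measurable E /\ (P E <= (2 * expR (- (tau ^+ 2 / (2 * alp ^+ 2))))%:E)%E.
Proof.
move=> al0 tau0; have [x0 xS msgS law ind] := signal.
have [mB _ _ _] := setting.
pose X1 (ib : {i : 'I_n | i \in S} * bool) : Omega -> R := ccoords (sg (sval ib.1)) ib.2.
pose X2 (lijb : {l : 'I_m & ('I_(p l) * 'I_n * bool)%type}) : Omega -> R :=
  mxcoords (B (projT1 lijb)) (projT2 lijb).
have mX1 : coordgen X1 `<=` measurable.
  by apply: coordgen_measurable => -[[i iS] c]; exact: msgS.
have mX2 : coordgen X2 `<=` measurable.
  by apply: coordgen_measurable => -[k ijb]; exact: mB.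
(* Off S the sign is 0 divided by 0, which is 0; so [sg i] is measurable for all indices. *)
have sgS0 i : i \notin S -> sg i = fun=> 0.
  by move=> iS; apply/funext => w; rewrite /sg x0// /sgnc mul0r.
have msg i : cmeas (sg i).
  have [iS|iS] := boolP (i \in S); last by rewrite sgS0//; exact: cmeas_cst.
  by split; [exact: (msgS i true iS)|exact: (msgS i false iS)].
have sgS1 i w : i \in S -> cmod (sg i w) = 1 by move=> iS; exact: cmod_sgnc (xS w i iS).
have sg1 i w : cmod (sg i w) <= 1.
  have [iS|iS] := boolP (i \in S); first by rewrite sgS1.
  by rewrite sgS0// cmod0.
have [indS sym] : mutually_indep P S (fun i => sigma_gen (ccoords (sg i))) /\
    forall i, i \in S -> approx_symmetric P (sg i).
  case: law => -[h ?]; split=> // i iS.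
    by have [h1 h2] := h i iS; exact: (rademacher_approx_symmetric (msg i)).
  apply: (steinhaus_approx_symmetric (msg i)); last exact: h.
  by move=> w; exact: sgS1.
have sgG i : i \in S -> cmeas (sg i : g_sigma_algebraType (coordgen X1) -> C).
  move=> iS; have h c := @measurable_coordgen _ _ _ _ X1 (exist _ i iS, c).
  by split; [exact: (h true)|exact: (h false)].
have mBH k : mxmeas (B k : g_sigma_algebraType (coordgen X2) -> _).
  move=> i j; have h c := @measurable_coordgen _ _ _ _ X2 (existT _ k (i, j, c)).
  by split; [exact: (h true)|exact: (h false)].
have mH : mxmeas (H : g_sigma_algebraType (coordgen X2) -> _).
  rewrite (_ : H = fun w => \sum_l ofR (m%:R^-1) *: (adjmx (B l w) *m B l w)); last first.
    by apply/funext => w; exact: sensing_gram.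
  apply: mxmeas_sum => k _; apply: mxmeasZ; first exact: cmeas_cst.
  exact: (mxmeasM (mxmeas_adj (mBH k)) (mBH k)).
have mG := mxmeas_gram_block S mH.
have mD : cmeas (D : g_sigma_algebraType (coordgen X2) -> C) by exact: cmeas_det.
have mb i : cmeas (fun w : g_sigma_algebraType (coordgen X2) => Num.conj (b l w i 0)).
  by apply: cmeas_conj; exact: (mxmeasM (mxmeas_adjugate mG) (mxmeas_restr_col S mH l)).
exact: (conditional_sign_tail msg sg1 indS sym mX1 mX2 ind sgG (fun i _ => mb i) mD).
Qed.

Variables (Q : {set {set 'I_n}}) (Lambda : {set 'I_n} -> R) (c1 K tau eps : R).
Hypotheses (eps01 : 0 < eps < 1) (Sn : (#|S| < n)%N).
Hypothesis sampling : sampling_condition P B c1 S Q Lambda eps.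
Hypotheses (K2 : 2 <= K) (tau0 : 0 <= tau) (tauK : tau ^+ 2 * K = 2).
Hypothesis c1K : 19 * (1 + K) <= 3 * c1.

Let L := ln (6 * n%:R / eps).

Let L1 : 1 <= L.
Proof.
have /andP[e0 e1] := eps01.
have n1 : 1 <= n%:R :> R by rewrite ler1n.
by apply: ln6_ge1; rewrite ler_pdivlMr//; lra.
Qed.

Lemma part_exponent (del : R) (Sr : {set 'I_n}) : Sr \in Q -> del ^+ 2 * (1 + K * L) = 1 ->
  2 * (#|S :|: Sr|%:R * expR (- (4 / 25 * (del ^+ 2 / (Lambda (S :|: Sr) / m%:R))))) <=
  eps / (3 * #|Q|%:R).
Proof.
move=> SrQ hdel; have [Qpart LamQ hm] := sampling; have /andP[e0 e1] := eps01.
have [Lam0 _] := LamQ Sr SrQ.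
set M := (\max_(Sr in Q) #|S :|: Sr|)%N in hm.
have q1 : (0 < #|Q|)%N by apply/card_gt0P; exists Sr.
have Sr1 : (0 < #|S :|: Sr|)%N.
  have /and3P[_ _ Q0] := Qpart.
  rewrite card_gt0; apply: contraNneq Q0 => h; rewrite (_ : finset.set0 = Sr)//.
  by apply/esym/eqP; rewrite -finset.subset0 -h finset.subsetUr.
have SrM : (#|S :|: Sr| <= M)%N by exact: (leq_bigmax_cond (F := fun T => #|S :|: T|)).
have qM : 1 <= #|Q|%:R * M%:R :> R.
  by rewrite -natrM ler1n muln_gt0 q1 (leq_trans Sr1 SrM).
have Y6 : 1 <= 6 * #|Q|%:R * M%:R / eps by rewrite ler_pdivlMr// -mulrA; lra.
have mx : Lambda (S :|: Sr) <= \big[Num.max/0]_(Sr in Q) Lambda (S :|: Sr).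
  exact: (le_bigmax_cond _ (fun Sr => Lambda (S :|: Sr))).
have K0 : 0 <= K := le_trans (ler0n R 2) K2.
have mR : 0 < m%:R :> R by rewrite ltr0n.
have := sample_exponent K0 L1 hdel c1K Lam0 mx (ln_ge0 Y6) mR hm.
set v := 4 / 25 * _ => hv.
have q0 : 0 < #|Q|%:R :> R by rewrite ltr0n.
have M0 : 0 < M%:R :> R by rewrite ltr0n (leq_trans Sr1 SrM).
have hE : expR (- v) <= eps / (6 * #|Q|%:R * M%:R).
  apply: (@le_trans _ _ (expR (- ln (6 * #|Q|%:R * M%:R / eps)))).
    by rewrite ler_expR lerN2.
  by rewrite expRN lnK ?invf_div// posrE; exact: lt_le_trans Y6.
have hT : #|S :|: Sr|%:R <= M%:R :> R by rewrite ler_nat.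
(* The 6 in the logarithm is spent here: 2 for the two tails and 3 for the share eps/3 of all parts
   together. *)
apply: (@le_trans _ _ (2 * (M%:R * (eps / (6 * #|Q|%:R * M%:R))))).
  by rewrite ler_pM2l// ler_pM// expR_ge0.
rewrite le_eqVlt; apply/orP; left; apply/eqP.
by field; rewrite !gt_eqF.
Qed.

Lemma certificate_probability : exists del alp : R,
  [/\ 0 <= del < 1, 8 <= K -> del <= 1 / 3 /\ alp <= 1 &
   exists G : set Omega, [/\ measurable G, ((1 - eps)%:E <= P G)%E &
   forall w, G w -> rip (A w) S del /\ exists u : 'I_n -> 'cV[C]_n,
     [/\ forall l, l \notin S -> csupp S (u l),
         forall l, l \notin S -> forall i, i \in S -> (H w *m u l) i 0 = H w i l,
         forall l, l \notin S -> l2norm (u l) <= alp &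
         forall l, l \notin S -> cmod (\sum_(i in S) Num.conj (u l i 0) * sg i w) < tau]]].
Proof.
have /andP[e0 e1] := eps01.
have [del [alp [[d0 d1 d35] hdel a0 halp d8]]] := parameter_choice K2 L1.
exists del, alp; split=> //; first by rewrite ltW.
have [Qpart LamQ _] := sampling.
have K0 : 0 < K := lt_le_trans (ltr0n R 2) K2.
have L0 : 0 < L := lt_le_trans ltr01 L1.
have KL0 : 0 < K * L by exact: mulr_gt0.
have n0R : 0 < n%:R :> R by rewrite ltr0n.
have [Bad hBad] : exists Bad : {set 'I_n} -> set Omega, forall Sr, Sr \in Q ->
    [/\ measurable (Bad Sr), (P (Bad Sr) <= (eps / (3 * #|Q|%:R))%:E)%E &
        forall w, ~ Bad Sr w -> rip (A w) (S :|: Sr) del].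
  suff /choice [Bad h] : forall Sr, exists E : set Omega, Sr \in Q -> [/\ measurable E,
      (P E <= (eps / (3 * #|Q|%:R))%:E)%E & forall w, ~ E w -> rip (A w) (S :|: Sr) del].
    by exists Bad.
  move=> Sr; have [SrQ|SrQ] := boolP (Sr \in Q); last by exists set0.
  have [E [mE PE hE]] := rip_tail m0 setting (LamQ Sr SrQ) d0 d35.
  exists E => _; split=> //; apply: le_trans PE _; rewrite lee_fin.
  exact: part_exponent.
pose E l := sign_event S alp tau (fun i w => Num.conj (b l w i 0)) D sg.
have hE l : measurable (E l) /\ (P (E l) <= (eps / (3 * n%:R))%:E)%E.
  have [mE PE] := sign_tail l a0 tau0; split=> //; apply: le_trans PE _; rewrite lee_fin.
  have -> : tau ^+ 2 / (2 * alp ^+ 2) = L.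
    have -> : tau ^+ 2 / (2 * alp ^+ 2) = tau ^+ 2 * K * L / (2 * (alp ^+ 2 * (K * L))).
      by field; rewrite !gt_eqF.
    by rewrite tauK halp mulr1 mulrAC divff ?mul1r.
  rewrite expRN lnK ?posrE ?divr_gt0// ?mulr_gt0//.
  rewrite le_eqVlt; apply/orP; left; apply/eqP.
  by field; rewrite !gt_eqF.
have [mU1 PU1] := union_bound (r := enum Q) (F := Bad) (c := eps / (3 * #|Q|%:R))
  (P := P) (fun Sr h => let: And3 h1 h2 _ := hBad Sr (etrans (esym (mem_enum _ _)) h) in conj h1 h2).
have [mU2 PU2] := union_bound (r := enum 'I_n) (F := E) (c := eps / (3 * n%:R))
  (P := P) (fun l _ => hE l).
move: mU1 PU1 mU2 PU2; set U1 := [set w | _]; set U2 := [set w | _] => mU1 PU1 mU2 PU2.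
have mU : measurable (U1 `|` U2) by exact: (measurableU _ _ mU1 mU2).
exists (~` (U1 `|` U2)); split; first exact: measurableC.
  rewrite probability_setC// EFinB; apply: leeB => //.
  apply: le_trans (measureU2 _ mU1 mU2) _; apply: le_trans (leeD PU1 PU2) _.
  rewrite -EFinD lee_fin -!cardE card_ord.
  have -> : n%:R * (eps / (3 * n%:R)) = eps / 3 by field; rewrite gt_eqF.
  have : #|Q|%:R * (eps / (3 * #|Q|%:R)) <= eps / 3.
    have [->|q0] := posnP #|Q|; first by rewrite mul0r divr_ge0// ltW.
    rewrite le_eqVlt; apply/orP; left; apply/eqP.
    by field; rewrite gt_eqF// ltr0n.
  lra.
move=> w /not_orP[nU1 nU2].
have ripQ Sr : Sr \in Q -> rip (A w) (S :|: Sr) del.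
  move=> SrQ; have [_ _] := hBad Sr SrQ; apply => bad.
  by apply: nU1; exists Sr; rewrite ?mem_enum.
have cov l : l \notin S -> exists2 Sr, Sr \in Q & l \in Sr.
  move=> lS; have /and3P[/eqP covQ _ _] := Qpart.
  have : l \in finset.cover Q by rewrite covQ finset.inE.
  by move=> /finset.bigcupP[Sr]; exists Sr.
have ripS : rip (A w) S del.
  (* S is proper, so [Q] has at least one part, and [rip] on S is inherited from any S u S_r. *)
  have [l lS] : exists l, l \notin S.
    apply/existsP; rewrite -negb_forall; apply: contraTN Sn => /forallP h.
    by rewrite -leqNgt -[X in (X <= _)%N](card_ord n) subset_leq_card//; apply/fintype.subsetP => i _.
  have [Sr SrQ _] := cov l lS.
  exact: rip_sub (finset.subsetUl S Sr) (ripQ Sr SrQ).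
have D0 : D w != 0 by exact: (gram_block_det_neq0 (ltW d0) d1 ripS).
have cD0 : 0 < cmod (D w) by rewrite lt_def cmod_eq0 D0 cmod_ge0.
have bnd l : l \notin S ->
    \sum_(i in S) cmod (b l w i 0) ^+ 2 <= alp ^+ 2 * cmod (D w) ^+ 2.
  move=> lS; have [Sr SrQ lSr] := cov l lS.
  have lT : l \in S :|: Sr by rewrite finset.inE lSr orbT.
  have := adj_sol_col_bound lS lT (finset.subsetUl S Sr) (ripQ Sr SrQ).
  rewrite -/(H w) -/(D w) -/(b l w).
  (* Dividing the column bound by 1 - del^2 leaves exactly alp^2, by the choice of both
     parameters. *)
  have -> : 1 - del ^+ 2 = K * L * del ^+ 2 by rewrite -{1}hdel; ring.
  have -> : del ^+ 2 * cmod (D w) ^+ 2 = K * L * del ^+ 2 * (alp ^+ 2 * cmod (D w) ^+ 2).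
    rewrite (_ : K * L * _ * _ = alp ^+ 2 * (K * L) * (del ^+ 2 * cmod (D w) ^+ 2)); last by ring.
    by rewrite halp mul1r.
  by rewrite ler_pM2l// mulr_gt0// exprn_gt0.
split=> //; exists (fun l => (D w)^-1 *: b l w); split.
- by move=> l _ i iS; rewrite mxE (adj_sol_csupp _ _ iS) mulr0.
- move=> l _ i iS; rewrite -scalemxAr mxE adj_solE// -/(H w) -/(D w) mulrA mulVf// mul1r.
  by rewrite mxE.
- move=> l lS; rewrite l2norm_leX ?(ltW a0)//.
  rewrite -l2norm2 (@l2norm2_csupp _ _ S) => [|i iS]; last by rewrite mxE (adj_sol_csupp _ _ iS) mulr0.
  under eq_bigr do rewrite mxE cmodM exprMn.
  rewrite -mulr_sumr -(@ler_pM2l _ (cmod (D w) ^+ 2)) ?exprn_gt0// mulrA -exprMn -cmodM.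
  by rewrite divff// cmod1 expr1n mul1r [X in _ <= X]mulrC; exact: bnd.
- move=> l lS.
  have -> : \sum_(i in S) Num.conj (((D w)^-1 *: b l w) i 0) * sg i w =
      Num.conj (D w)^-1 * \sum_(i in S) Num.conj (b l w i 0) * sg i w.
    by rewrite mulr_sumr; apply: eq_bigr => i _; rewrite mxE rmorphM mulrA.
  (* A failing sign condition would put [w] in the sign event, whose other two requirements are
     [bnd] and [D0]. *)
  rewrite ltNge; apply/negP => h; apply: nU2; exists l; first by rewrite mem_enum.
  split; first by rewrite /=; under eq_bigr do rewrite cmodC; exact: bnd.
  split; first exact: exprn_gt0.
  rewrite /= -exprMn ler_pXn2r ?nnegrE ?cmod_ge0// ?mulr_ge0 ?cmod_ge0//.
  have := ler_wpM2r (ltW cD0) h; rewrite cmodM cmodC mulrAC -cmodM mulVf// cmod1.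
  by rewrite mul1r.
Qed.
End Recovery.

Theorem mainTheorem5 (R : realType) :
  exists c1 C1 C2 : R, [/\ 0 < c1, 0 < C1, 0 < C2,
  (* robust recovery by (qBP) *)
  (forall (d : measure_display) (Omega : measurableType d) (P : probability Omega R)
     (n m : nat) (p : 'I_m -> nat) (B : forall l : 'I_m, Omega -> 'M[R[i]]_(p l, n))
     (S : {set 'I_n}) (x : Omega -> 'cV[R[i]]_n)
     (e : Omega -> 'cV[R[i]]_(\sum_(l < m) p l)) (eta eps : R)
     (Q : {set {set 'I_n}}) (Lambda : {set 'I_n} -> R),
     (0 < n)%N -> (0 < m)%N -> (forall l, 0 < p l)%N ->
     random_sensing_setting P B ->
     random_sign_signal P B S x ->
     0 <= eta -> (forall w, l2norm (e w) <= eta) ->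
     0 < eps < 1 ->
     (#|S| < n)%N ->
     sampling_condition P B c1 S Q Lambda eps ->
     exists G : set Omega, [/\ measurable G, ((1 - eps)%:E <= P G)%E &
       forall w, G w -> forall z : 'cV[R[i]]_n,
         qBP_minimizer (sensing_matrix B w) (sensing_matrix B w *m x w + e w) eta z ->
         l2norm (x w - z) <= (C1 + C2 * Num.sqrt (#|S|%:R)) * eta]) &
  (* noiseless case, c1 = 19: exact recovery by (BP) *)
  (forall (d : measure_display) (Omega : measurableType d) (P : probability Omega R)
     (n m : nat) (p : 'I_m -> nat) (B : forall l : 'I_m, Omega -> 'M[R[i]]_(p l, n))
     (S : {set 'I_n}) (x : Omega -> 'cV[R[i]]_n) (eps : R)
     (Q : {set {set 'I_n}}) (Lambda : {set 'I_n} -> R),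
     (0 < n)%N -> (0 < m)%N -> (forall l, 0 < p l)%N ->
     random_sensing_setting P B ->
     random_sign_signal P B S x ->
     0 < eps < 1 ->
     (#|S| < n)%N ->
     sampling_condition P B 19 S Q Lambda eps ->
     exists G : set Omega, [/\ measurable G, ((1 - eps)%:E <= P G)%E &
       forall w, G w ->
         BP_unique_minimizer (sensing_matrix B w) (sensing_matrix B w *m x w) (x w)])].
Proof.
exists 57, 3, 10; split => //.
- move=> d Omega P n m p B S x e eta eps Q Lambda n0 m0 _ setting signal _ he eps01 Sn sampling.
  have [||||del [alp [/andP[d0 d1] d8 [G [mG PG hG]]]]] := certificate_probability
    (K := 8) (tau := 1 / 2) n0 m0 setting signal eps01 Sn sampling; try by rewrite ?expr2; lra.
  have [d3 a1] := d8 (lexx _).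
  have [x0 xS _ _ _] := signal.
  exists G; split=> // w Gw z hz; have [ripS [u [u1 u2 u3 u4]]] := hG w Gw.
  exact: (qBP_recovery d0 d1 ripS (x0 w) (xS w) u1 u2 u3 u4 _ d3 a1 (he w) hz).
move=> d Omega P n m p B S x eps Q Lambda n0 m0 _ setting signal eps01 Sn sampling.
have [||||del [alp [/andP[d0 d1] _ [G [mG PG hG]]]]] := certificate_probability
  (K := 2) (tau := 1) n0 m0 setting signal eps01 Sn sampling; try by rewrite ?expr2; lra.
have [x0 xS _ _ _] := signal.
exists G; split=> // w Gw; have [ripS [u [u1 u2 _ u4]]] := hG w Gw.
exact: (BP_recovery d0 d1 ripS (x0 w) (xS w) u1 u2 u4 (lexx _)).
Qed.
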